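(* Let $\nu\ge 3$ be an integer. For each $n$ let $X_1,\dots,X_n$ be independent random integers uniformly distributed on $\{1,\dots,M\}$, where $M=M(n)\to\infty$ (however slowly), and let $Z_n$ be the number of perfect ordered partitions of $[n]$ into $\nu$ non-empty subsets. Let $c_M:=M^{-2}\mathbb E[X^2]$ (so $c_M=1/3+O(M^{-1})$), where $X$ is uniform on $\{1,\dots,M\}$. Assume $\lim n/\log M$ exists. (0) If $\lim\frac{n}{\log M}<\frac{2}{\log\nu}$, then $\lim\mathbb E[Z_n]=0$. (i) If $\nu=3$ and $\lim\frac{n}{\log M}\in\bigl(\frac{2}{\log 3},\infty\bigr)\setminus\{2,4\}$, then $$\mathbb E[Z_n]=(1+o(1))\frac{\nu^n}{M^{\nu-1}}\cdot\frac{\nu^{\nu-3/2}}{(2\pi\nu c_M n)^{\frac{\nu-1}{2}}}\to\infty.\qquad( * )$$ (ii) Suppose $\nu\ge 4$. The function $\eta\mapsto\frac{e^{(\nu-1)\eta}}{\nu e\eta}-1$ has two positive roots, the smaller one below $\frac{1}{\nu-1}$ and the larger one, denoted $\eta(\nu)$, in $\bigl(\frac{1}{\nu-1},\frac{2\log\nu}{\nu-1}\bigr)$. If $\lim\frac{n}{\log M}\in\bigl(\frac{2}{\eta(\nu)},\infty\bigr)\setminus\{2(\nu-1)\}$, then $( * )$ holds.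
   Context: An ordered partition of $[n]$ into $\nu$ non-empty subsets is a $\nu$-tuple $(S_1,\dots,S_\nu)$ of non-empty pairwise disjoint subsets of $[n]$ with union $[n]$; it is perfect if all sums $\sum_{j\in S_\alpha}X_j$, $\alpha\in[\nu]$, are equal. *)

(* Defs.v *)
From HB Require Import structures.
From mathcomp Require Import all_boot all_order all_algebra.
From mathcomp Require Import all_classical all_reals all_analysis.
Import Order.TTheory GRing.Theory Num.Theory.
Import numFieldNormedType.Exports.

Set Implicit Arguments.
Unset Strict Implicit.
Unset Printing Implicit Defensive.

Local Open Scope classical_set_scope.
Local Open Scope ring_scope.

Definition ordered_partition (n nu : nat) (S : nu.-tuple {set 'I_n}) : bool :=
  [&& [forall a, tnth S a != finset.set0],
      [forall a, forall b, (a != b) ==> [disjoint tnth S a & tnth S b]]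
    & \bigcup_(a < nu) tnth S a == [set: 'I_n]]%SET.

Definition perfect (n nu : nat) (x : 'I_n -> nat)
    (S : nu.-tuple {set 'I_n}) : bool :=
  [forall a, forall b,
     (\sum_(j in tnth S a) x j == \sum_(j in tnth S b) x j)%N].

Definition num_perfect (n nu : nat) (x : 'I_n -> nat) : nat :=
  #|[set S : nu.-tuple {set 'I_n} | ordered_partition S & perfect x S]%SET|.

Definition mutually_independent d d' (T : measurableType d)
    (T' : measurableType d') (R : realType) (P : probability T R)
    (I : finType) (X : I -> {RV P >-> T'}) : Prop :=
  forall (J : {set I}) (A : I -> set T'),
    (forall i, measurable (A i)) ->
    P (\bigcap_(i in [set` J]) (X i @^-1` A i)) =
    (\prod_(i in J) P (X i @^-1` A i))%E.

Definition uniform_upto d (T : measurableType d) (R : realType)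
    (P : probability T R) (m : nat) (X : {RV P >-> nat}) : Prop :=
  forall k : nat,
    distribution P X [set k] = (if (1 <= k <= m)%N then m%:R^-1 else 0)%:E.

(* m^-2 times the second moment of the uniform law on {1, ..., m} *)
Definition cM (R : realType) (m : nat) : R :=
  m%:R ^- 2 * (m%:R^-1 * \sum_(1 <= k < m.+1) k%:R ^+ 2).

Definition main_term (R : realType) (nu m n : nat) : R :=
  nu%:R ^+ n / m%:R ^+ nu.-1 *
  (nu%:R `^ (nu%:R - 3 / 2) /
   (2 * pi * nu%:R * cM R m * n%:R) `^ ((nu%:R - 1) / 2)).

Definition num_perfect_rv d (T : measurableType d) (R : realType)
    (P : probability T R) (n nu : nat) (X : 'I_n -> {RV P >-> nat}) : T -> R :=
  fun w => (num_perfect nu (fun i => X i w))%:R.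

Definition first_moment_asymptotics (R : realType) (nu : nat) (M : nat -> nat)
    (EZ : nat -> \bar R) : Prop :=
  (exists2 o1 : nat -> R, o1 n @[n --> \oo] --> (0 : R) &
     \forall n \near \oo, EZ n = ((1 + o1 n) * main_term R nu (M n) n)%:E)
  /\ EZ n @[n --> \oo] --> (+oo)%E.

Definition eta_fun (R : realType) (nu : nat) (eta : R) : R :=
  expR ((nu%:R - 1) * eta) / (nu%:R * expR 1 * eta) - 1.

(* Main.v *)
Require Import Defs.
From HB Require Import structures.
From mathcomp Require Import all_boot all_order all_algebra.
From mathcomp Require Import all_classical all_reals all_analysis.
From mathcomp Require Import measurable_realfun.
From mathcomp Require Import ring lra.
Import Order.TTheory GRing.Theory Num.Theory.
Import numFieldNormedType.Exports.

(** Conditioning on one class keeps the Fourier analysis one-dimensional: once the target sum is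
    fixed the other classes are independent, and the characteristic function of a centred uniform
    variable is real. The price is an average over the vector Y, whose coordinates share the
    fluctuation of S.

    The constant 6 nu is 1 / (2 sigma^2) for a typical class: n / nu summands of variance about M^2
    / 12, measured in units of M sqrt n. The covariance of a step is invariant under permutations of
    the d coordinates, so it has only two eigenspaces, the line of (1, ..., 1) and its complement. A
    Gaussian test function therefore evolves inside an explicit two-parameter family, and
    Lindeberg's argument needs only elementary Taylor bounds.

    Since M may grow arbitrarily slowly compared with n, the estimates preceding the comparison with
    log M are uniform in both beyond a threshold; this is why the integrand of the Fourier inversion
    gets a dominating function independent of m and k. *)

(* Write nu = d + 1 and colour [n] with nu colours. Given a colouring, the
   probability that all colour classes have the same sum is obtained by
   conditioning on the class of colour 0: it is the expectation of the product,
   over the other d classes, of the probability that the class hits the sum S of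
   class 0. Fourier inversion and dominated convergence give a local limit
   theorem for sums of uniform variables, uniform in M and in the point, so for a
   typical colouring this product is close to
   (6 nu / (pi n M^2))^(d/2) exp(- 6 nu |Y|^2) with
   Y_a = (S - n_a (M+1)/2) / (M sqrt n); atypical colourings are negligible by a
   Chernoff bound.

   Averaged over colourings and values, Y is a normalised sum of n independent
   centred steps in R^d, and E exp(- 6 nu |Y|^2) converges to the corresponding
   Gaussian expectation by Lindeberg's replacement argument, run along an explicit
   heat flow. The limit, as M -> oo, is 2^-d nu^(-1/2). Hence the asymptotics hold as soon as
   n and M tend to infinity; the position of lim n / log M only decides whether
   the main term tends to infinity. In (ii) this follows from
   eta(nu) < 2 log nu / (nu - 1), and (0) is the bound E Z_n <= nu^n M^-d. *)

Set Implicit Arguments.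
Unset Strict Implicit.
Unset Printing Implicit Defensive.

Local Open Scope classical_set_scope.
Local Open Scope ring_scope.

(** * Fourier transform of the Gaussian *)

Section dominated_convergence_Rintegral.
Context {R : realType}.
Local Notation mu := (@lebesgue_measure R).
Variables (D : set R) (f_ : nat -> R -> R) (f g : R -> R).
Hypothesis mD : measurable D.
Hypothesis mf_ : forall n : nat, measurable_fun D (f_ n).
Hypothesis mf : measurable_fun D f.
Hypothesis ff : forall x, D x -> f_ n x @[n --> \oo] --> f x.
Hypothesis ig : mu.-integrable D (EFin \o g).
Hypothesis fg : forall n x, D x -> `|f_ n x| <= g x.

Lemma dominated_integrable_lim : mu.-integrable D (EFin \o f).
Proof.
apply: (@le_integrable _ _ _ mu _ _ _ (EFin \o g)) => //.
  exact/measurable_EFinP.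
move=> x Dx /=; rewrite lee_fin.
apply: (@le_trans _ _ (g x)); last exact: ler_norm.
have /cvg_norm h := ff Dx.
have -> : `|f x| = lim ((fun n => `|f_ n x|) @ \oo) by rewrite (cvg_lim _ h).
apply: limr_le; first by apply/cvg_ex; eexists; exact: h.
by apply: nearW => n; exact: fg.
Qed.

Lemma dominated_cvg_Rintegral :
  \int[mu]_(x in D) f_ n x @[n --> \oo] --> \int[mu]_(x in D) f x /\
  \int[mu]_(x in D) `|f_ n x - f x| @[n --> \oo] --> (0 : R).
Proof.
have [] := @dominated_convergence _ _ R mu D mD (fun n => EFin \o f_ n) (EFin \o f) (EFin \o g).
- by move=> n; apply/measurable_EFinP; exact: mf_.
- exact/measurable_EFinP.
- apply: aeW => x Dx; apply: cvg_EFin; [exact: nearW|exact: ff].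
- exact: ig.
- by apply: aeW => x n Dx; rewrite /= lee_fin fg.
move=> _ h1 h2; split.
  have fi : (\int[mu]_(t in D) (f t)%:E)%E \is a fin_num.
    by apply: integrable_fin_num => //; exact: dominated_integrable_lim.
  by rewrite /Rintegral; apply: fine_cvg; rewrite fineK.
by rewrite /Rintegral; apply: fine_cvg.
Qed.

End dominated_convergence_Rintegral.

Section gaussian_fourier.
Context {R : realType}.
Local Notation mu := (@lebesgue_measure R).

Lemma is_derive1_continuous (f : R -> R) (x df : R) :
  is_derive x (1 : R) f df -> {for x, continuous f}.
Proof. by move=> [] d _; apply/differentiable_continuous/derivable1_diffP. Qed.

Lemma mvt_le (f df : R -> R) (x y B : R) :
  (forall z : R, is_derive z (1 : R) f (df z)) ->
  (forall z, Num.min x y <= z <= Num.max x y -> `|df z| <= B) ->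
  `|f y - f x| <= B * `|y - x|.
Proof.
move=> dF; wlog xy : x y / x <= y.
  move=> H bF; have [/H|/ltW/H] := leP x y; first exact.
  by rewrite minC maxC distrC [in X in _ -> _ <= X]distrC; exact.
rewrite (min_idPl xy) (max_idPr xy) => bF.
have cF : {within `[x, y], continuous f}.
  by apply: continuous_subspaceT => z; exact: is_derive1_continuous (dF z).
have [c /[!in_itv]/= cxy ->] := MVT_segment xy (fun z _ => dF z) cF.
by rewrite normrM ler_wpM2r// bF.
Qed.

Lemma is_derive_mulr (c x : R) : is_derive x (1 : R) (fun y : R => y * c) c.
Proof.
apply: (is_derive_eq (is_deriveM (is_derive_id x 1) (is_derive_cst c x 1))).
by rewrite /GRing.scale /=; ring.
Qed.

Lemma is_derive_mull (c x : R) : is_derive x (1 : R) (fun y : R => c * y) c.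
Proof.
apply: (is_derive_eq (is_deriveM (is_derive_cst c x 1) (is_derive_id x 1))).
by rewrite /GRing.scale /=; ring.
Qed.

Lemma continuous_integrable_itv (f : R -> R) (a b : R) :
  continuous f -> mu.-integrable `[a, b] (EFin \o f).
Proof.
move=> cf; apply: continuous_compact_integrable; first exact: segment_compact.
exact: continuous_subspaceT.
Qed.

Lemma continuous_cosM (x : R) : continuous (fun t => cos (x * t)).
Proof.
move=> t; apply: (@continuous_comp _ _ _ ( *%R x) cos); last exact: continuous_cos.
exact: mulrl_continuous.
Qed.

Lemma continuous_sinM (x : R) : continuous (fun t => sin (x * t)).
Proof.
move=> t; apply: (@continuous_comp _ _ _ ( *%R x) sin); last exact: continuous_sin.
exact: mulrl_continuous.
Qed.

Definition gcos (x t : R) := gauss_fun t * cos (x * t).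

Lemma continuous_gcos x : continuous (gcos x).
Proof.
move=> t; apply: cvgM; first exact: continuous_gauss_fun.
exact: continuous_cosM.
Qed.

Lemma is_derive_gcos (x t : R) :
  is_derive x 1 (gcos ^~ t) (- (t * gauss_fun t * sin (x * t))).
Proof.
rewrite /gcos.
have -> : - (t * gauss_fun t * sin (x * t)) =
   gauss_fun t *: (- sin (x * t) * t).
  by rewrite /GRing.scale /=; ring.
apply: is_deriveZ.
exact: (@is_derive1_comp _ cos (fun y : R => y * t) x (- sin (x * t)) t _ (is_derive_mulr _ _)).
Qed.

Lemma is_derive_gsin (x t : R) :
  is_derive t 1 (fun t => gauss_fun t * sin (x * t))
   (x * gcos x t - 2 * (t * gauss_fun t * sin (x * t))).
Proof.
have hs := @is_derive1_comp _ sin (fun y : R => x * y) t (cos (x * t)) x _ (is_derive_mull _ _).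
have h2 : is_derive t 1 (fun y : R => - y ^+ 2) (- (2 * t)).
  by apply: is_derive_eq; rewrite /GRing.scale /= ; ring.
have hg := @is_derive1_comp _ expR (fun y : R => - y ^+ 2) t
  (expR (- t ^+ 2)) (- (2 * t)) _ h2.
apply: (is_derive_eq (is_deriveM (hg (is_derive_expR _)) (hs (is_derive_sin _)))).
by rewrite /gcos /gauss_fun /GRing.scale /=; ring.
Qed.

Lemma continuous_tgsin (x : R) : continuous (fun t : R => t * gauss_fun t * sin (x * t)).
Proof.
move=> t; apply: cvgM; last exact: continuous_sinM.
by apply: cvgM; [exact: cvg_id|exact: continuous_gauss_fun].
Qed.

(** Integration by parts: the derivative of [gauss_fun t * sin (x * t)] is integrated over [0, T].
    The boundary term at T is the error that vanishes later. *)
Lemma Rintegral_tgsin (x T : R) : 0 < T ->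
  \int[mu]_(t in `[0, T]) (t * gauss_fun t * sin (x * t)) =
  x / 2 * \int[mu]_(t in `[0, T]) gcos x t - gauss_fun T * sin (x * T) / 2.
Proof.
move=> T0.
have cA : continuous (fun t => x * gcos x t - 2 * (t * gauss_fun t * sin (x * t))).
  move=> t; apply: cvgB; apply: cvgM; try exact: cvg_cst.
    exact: continuous_gcos.
  exact: continuous_tgsin.
have F2 := @continuous_FTC2 R (fun t => x * gcos x t - 2 * (t * gauss_fun t * sin (x * t)))
  (fun t => gauss_fun t * sin (x * t)) 0 T T0.
have dF (t : R) : derivable (fun t => gauss_fun t * sin (x * t)) t 1.
  by case: (is_derive_gsin x t).
have cF (t : R) : {for t, continuous (fun t => gauss_fun t * sin (x * t))}.
  by apply/differentiable_continuous/derivable1_diffP.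
have {F2} := F2 _ _ _.
rewrite mulr0 sin0 mulr0 sube0 => F2.
have {}F2 : (\int[mu]_(t in `[0, T]) (x * gcos x t - 2 * (t * gauss_fun t * sin (x * t)))
     = gauss_fun T * sin (x * T)).
  rewrite /Rintegral F2//.
  - exact: continuous_subspaceT.
  - split => //.
    + by apply: cvg_at_right_filter; exact: (cF 0).
    + by apply: cvg_at_left_filter; exact: cF.
  - by move=> t _; rewrite derive1E; have [_ ->] := is_derive_gsin x t.
move: F2; rewrite RintegralB//; last 2 first.
- by apply: continuous_integrable_itv => t; apply: cvgM; [exact: cvg_cst|exact: continuous_gcos].
- by apply: continuous_integrable_itv => t; apply: cvgM; [exact: cvg_cst|exact: continuous_tgsin].
rewrite !RintegralZl//; last 2 first.
- exact/continuous_integrable_itv/continuous_tgsin.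
- exact/continuous_integrable_itv/continuous_gcos.
set A := \int[mu]_(x0 in _) _; set B := \int[mu]_(x0 in _) _.
by move=> <-; field.
Qed.

(* As a function of x, FT satisfies y' = - (x / 2) y up to an error that vanishes
   as T -> oo. *)
Definition FT (T x : R) := \int[mu]_(t in `[0, T]) gcos x t.

Lemma is_derive_FT (T x : R) : 0 < T ->
  is_derive x 1 (FT T) (gauss_fun T * sin (x * T) / 2 - x / 2 * FT T x).
Proof.
move=> T0.
have ix : x \in `](x - 1), (x + 1)[ by rewrite in_itv/= ltrBlDr ltrDl ltr01.
have ub (y t : R) : `](x - 1), (x + 1)[%classic y -> `[0, T]%classic t -> `|partial1of2 gcos y t| <= T.
  move=> _ /=; rewrite in_itv/= => /andP[t0 tT].
  rewrite partial1of2E; have [_ ->] := is_derive_gcos y t.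
  rewrite normrN !normrM (ger0_norm t0) (ger0_norm (gauss_fun_ge0 _)).
  have h : gauss_fun t * `|sin (y * t)| <= 1 by rewrite mulr_ile1 ?gauss_fun_ge0 ?gauss_fun_le1 ?sin_max.
  by rewrite -mulrA (le_trans _ tT)// ler_piMr.
have ci : forall y, `](x - 1), (x + 1)[%classic y -> mu.-integrable `[0, T] (EFin \o gcos y).
  by move=> y _; exact/continuous_integrable_itv/continuous_gcos.
have cd (y t : R) : `](x - 1), (x + 1)[%classic y -> `[0, T]%classic t -> derivable (gcos ^~ t) y 1.
  by move=> _ _; have [] := is_derive_gcos y t.
have iT : mu.-integrable `[0, T] (EFin \o (fun=> T)).
  by apply: continuous_integrable_itv => ?; exact: cvg_cst.
have h1 := @derivable_under_integral R _ _ mu gcos `[0, T] (measurable_itv _) x (x - 1) (x + 1) ix ci cd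
  (fun=> T) (fun=> ltW T0) iT ub.
have h2 := @differentiation_under_integral R _ _ mu gcos `[0, T] (measurable_itv _) x (x - 1) (x + 1) ix ci cd
  (fun=> T) (fun=> ltW T0) iT ub.
apply: DeriveDef => //.
rewrite -derive1E h2.
rewrite (_ : \int[mu]_(y in _) _ = - \int[mu]_(t in `[0, T]) (t * gauss_fun t * sin (x * t))).
  by rewrite Rintegral_tgsin// opprB.
rewrite -mulN1r -RintegralZl//; last exact/continuous_integrable_itv/continuous_tgsin.
apply: eq_Rintegral => t _; rewrite partial1of2E; have [_ ->] := is_derive_gcos x t.
by rewrite mulN1r.
Qed.

(** The integrating factor [expR (x ^+ 2 / 4)] cancels the linear term of the differential equation
    of [FT]; what remains of the derivative is of size [gauss_fun T], and the mean value theorem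
    applies. *)
Lemma FT_bound (T x : R) : 0 < T ->
  `|FT T x * expR (x ^+ 2 / 4) - FT T 0| <= `|x| * (expR (x ^+ 2 / 4) * gauss_fun T).
Proof.
move=> T0.
pose F y := FT T y * expR (y ^+ 2 / 4).
pose F' y := expR (y ^+ 2 / 4) * gauss_fun T * sin (y * T) / 2.
have dF y : is_derive y (1 : R) F (F' y).
  have h : is_derive y 1 (fun y : R => y ^+ 2 / 4) (y / 2).
    by apply: is_derive_eq; rewrite /GRing.scale /=; field.
  have he := @is_derive1_comp _ expR (fun y : R => y ^+ 2 / 4) y (expR (y ^+ 2 / 4)) (y / 2) _ h.
  have := is_deriveM (is_derive_FT y T0) (he (is_derive_expR _)).
  by move=> /is_derive_eq; apply; rewrite /F' /GRing.scale /=; field.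
have bF' y : `|y| <= `|x| -> `|F' y| <= expR (x ^+ 2 / 4) * gauss_fun T.
  move=> yx; rewrite /F' !normrM (ger0_norm (gauss_fun_ge0 _)) (ger0_norm (expR_ge0 _)).
  rewrite -!(mulrA _ (gauss_fun T)) -!mulrA ler_pM ?expR_ge0 ?mulr_ge0 ?gauss_fun_ge0 ?ler_expR//.
    rewrite mulrA -expr2 [leRHS]mulrA -expr2.
    by rewrite ler_pM2r ?invr_gt0// -(real_normK (num_real x)) -(real_normK (num_real y)) lerXn2r ?nnegrE.
  rewrite -[leRHS]mulr1 ler_pM ?mulr_ge0 ?gauss_fun_ge0//.
  by rewrite mulr_ile1 ?sin_max// normfV ger0_norm// invf_le1// ler1n.
have -> : FT T 0 = F 0 by rewrite /F expr0n mul0r expR0 mulr1.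
rewrite (mulrC `|x|) -[in X in _ <= _ * X](subr0 x); apply: (mvt_le dF) => z.
rewrite ge_min le_max => zx; apply: bF'; have := zx; have := ltrgt0P x.
by case=> [x0|x0|->]; case: (ltrgt0P z) => //=; move: zx; lra.
Qed.

Lemma measurable_gcos x : measurable_fun setT (gcos x).
Proof. apply: continuous_measurable_fun; exact: continuous_gcos. Qed.

Lemma gcos_le x t : `|gcos x t| <= gauss_fun t.
Proof.
rewrite normrM (ger0_norm (gauss_fun_ge0 _)) -[leRHS]mulr1.
by rewrite ler_pM ?gauss_fun_ge0 ?cos_max.
Qed.

Lemma cvg_FT x : FT n%:R x @[n --> \oo] --> \int[mu]_(t in `[0, +oo[) gcos x t.
Proof.
pose f_ (n : nat) t := gcos x t * \1_(`[0, n%:R]) t.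
have -> : (fun n => FT n%:R x) = (fun n => \int[mu]_(t in `[0%R, +oo[) f_ n t).
  apply/funext => n; rewrite /FT/Rintegral; congr fine.
  rewrite [RHS]integral_mkcond [LHS]integral_mkcond; apply: eq_integral => t _.
  rewrite /f_ !patchE !indicE !mem_setE !in_itv/= andbT.
  by case: (0 <= t) => //=; case: (t <= _); rewrite ?mulr1 ?mulr0.
apply: (@dominated_cvg_Rintegral _ _ f_ (gcos x) (@gauss_fun R) _ _ _ _ _ _).1.
- exact: measurable_itv.
- move=> n; apply: measurable_funM.
    by apply: measurable_funTS; exact: measurable_gcos.
  by apply: measurable_funTS; exact: measurable_indic.
- by apply: measurable_funTS; exact: measurable_gcos.
- move=> t; rewrite /= in_itv/= andbT => t0; apply: cvg_near_cst.
  near=> n; rewrite /f_ indicE mem_set ?mulr1//= in_itv/= t0.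
  by near: n; exact: nbhs_infty_ger.
- exact: integrableS integrableT_gauss.
- move=> n t _; rewrite /f_ /= normrM.
  by rewrite -[leRHS]mulr1 ler_pM ?gcos_le// indicE; case: (_ \in _); rewrite ?normr1 ?normr0.
Unshelve. all: by end_near. Qed.

Lemma cvg_gauss_funn : gauss_fun n%:R @[n --> \oo] --> (0 : R).
Proof. by have /cvg_pinftyP := @cvg_gauss_fun R; apply; exact: cvgr_idn. Qed.

(** Let T tend to infinity in [FT_bound]; the value at x = 0 is the half-line Gaussian integral. *)
Lemma Rintegral_gcos x :
  \int[mu]_(t in `[0, +oo[) gcos x t = Num.sqrt pi / 2 * expR (- (x ^+ 2 / 4)).
Proof.
have F0 : \int[mu]_(t in `[0, +oo[) gcos 0 t = Num.sqrt pi / 2.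
  rewrite /Rintegral -[RHS]/(fine _%:E) -integral0y_gauss; congr fine.
  by apply: eq_integral => t _; rewrite /gcos mul0r cos0 mulr1.
have h1 : (FT n%:R x * expR (x ^+ 2 / 4) - FT n%:R 0) @[n --> \oo] --> (0 : R).
  apply/norm_cvg0P.
  apply: (@squeeze_cvgr _ _ _ _ (cst 0) (fun n => `|x| * (expR (x ^+ 2 / 4) * gauss_fun n%:R))).
  - near=> n; rewrite normr_ge0/= FT_bound//.
    by near: n; exact: nbhs_infty_gtr.
  - exact: cvg_cst.
  - rewrite -(mulr0 `|x|) -(mulr0 (expR (x ^+ 2 / 4))).
    by apply: cvgMl_tmp; apply: cvgMl_tmp; exact: cvg_gauss_funn.
have h2 : (FT n%:R x * expR (x ^+ 2 / 4) - FT n%:R 0) @[n --> \oo] -->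
    \int[mu]_(t in `[0, +oo[) gcos x t * expR (x ^+ 2 / 4) - \int[mu]_(t in `[0, +oo[) gcos 0 t.
  by apply: cvgB; [apply: cvgMr_tmp|]; exact: cvg_FT.
have hE : \int[mu]_(t in `[0, +oo[) gcos x t * expR (x ^+ 2 / 4) -
    \int[mu]_(t in `[0, +oo[) gcos 0 t = 0.
  have e1 := cvg_lim (@Rhausdorff R) h1.
  by rewrite -(cvg_lim (@Rhausdorff R) h2) e1.
move: hE; rewrite F0 => /eqP; rewrite subr_eq0 => /eqP <-.
by rewrite expRN mulfK// gt_eqF// expR_gt0.
Unshelve. all: by end_near. Qed.

End gaussian_fourier.

(** * Local limit theorem *)

Section trigonometric_bounds.
Context {R : realType}.
Implicit Types x y t : R.

Lemma one_sub_cos y : 1 - cos y = 2 * sin (y / 2) ^+ 2.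
Proof.
have -> : cos y = cos ((y / 2) *+ 2) by rewrite -mulr_natr divfK.
by rewrite cos_mulr2n cos2sin2 !mulr2n; ring.
Qed.

Lemma cos_ge y : 1 - y ^+ 2 / 2 <= cos y.
Proof.
have h : sin (y / 2) ^+ 2 <= (y / 2) ^+ 2.
  rewrite -(real_normK (num_real (sin _))) -(real_normK (num_real (y / 2))).
  rewrite lerXn2r ?nnegrE//.
  have := @mvt_le _ sin cos 0 (y / 2) 1 (fun z => is_derive_sin z) (fun z _ => cos_max z).
  by rewrite sin0 !subr0 mul1r.
have := one_sub_cos y; lra.
Qed.

Lemma sin_ge x : 0 <= x -> x - x ^+ 3 / 6 <= sin x.
Proof.
move=> x0.
pose f t := sin t - (t - t ^+ 3 / 6).
pose f' t := cos t - (1 - t ^+ 2 / 2).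
have df t : is_derive t (1 : R) f (f' t).
  have h : is_derive t 1 (fun t : R => t - t ^+ 3 / 6) (1 - t ^+ 2 / 2).
    by apply: is_derive_eq; rewrite /GRing.scale /=; field.
  exact: is_deriveB.
have cF : {within `[0, x], continuous f}.
  by apply: continuous_subspaceT => z; exact: is_derive1_continuous (df z).
have [c /[!in_itv]/= cxy] := MVT_segment x0 (fun z _ => df z) cF.
rewrite {1 2}/f sin0 expr0n/= mul0r !subr0 => h.
have : 0 <= f' c * x by rewrite mulr_ge0// /f' subr_ge0 cos_ge.
by rewrite -h subr_ge0.
Qed.

(** By the half-angle formula, from the square of [sin_ge] at u = y / 2. The restriction on y gives
    u <= 1, which keeps u - u^3 / 6 nonnegative so that squaring preserves the inequality. *)
Lemma cos_le y : `|y| <= 2 -> cos y <= 1 - y ^+ 2 / 2 + y ^+ 4 / 24.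
Proof.
move=> y2.
wlog y0 : y y2 / 0 <= y.
  move=> H; have [/H|/ltW] := leP 0 y; first exact.
  rewrite -oppr_ge0 => /H; rewrite normrN => /(_ y2).
  have -> : (- y) ^+ 4 = y ^+ 4 by ring.
  by rewrite cosN sqrrN.
rewrite ger0_norm// in y2.
have := one_sub_cos y.
have u0 : 0 <= y / 2 by rewrite divr_ge0.
have := sin_ge u0.
set u := y / 2 in u0 *.
have yE : y = 2 * u by rewrite mulrC divfK.
move=> h1 h2.
have u1 : u <= 1 by lra.
have h3 : 0 <= u - u ^+ 3 / 6.
  have : u ^+ 3 <= u by rewrite exprS ler_piMr// exprn_ile1.
  lra.
have h4 : (u - u ^+ 3 / 6) ^+ 2 <= sin u ^+ 2.
  by rewrite lerXn2r// nnegrE (le_trans h3).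
have h5 : u ^+ 2 - u ^+ 4 / 3 <= (u - u ^+ 3 / 6) ^+ 2.
  have -> : (u - u ^+ 3 / 6) ^+ 2 = u ^+ 2 - u ^+ 4 / 3 + (u ^+ 3 / 6) ^+ 2 by field.
  by rewrite lerDl sqr_ge0.
have -> : y ^+ 2 = 4 * u ^+ 2 by rewrite yE; ring.
have -> : y ^+ 4 = 16 * u ^+ 4 by rewrite yE; ring.
lra.
Qed.

(** Concavity: the mean slope of sine on [0, x] is cos c, that on [x, pi / 2] is cos e with c <= e,
    and cosine decreases. *)
Lemma jordan_sin x : 0 <= x <= pi / 2 -> 2 * x / pi <= sin x.
Proof.
move=> /andP[x0 xp].
have p0 := pi_gt0 R.
have cs (a b : R) : {within `[a, b], continuous (@sin R)}.
  exact/continuous_subspaceT/continuous_sin.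
have [c /[!in_itv]/=/andP[c0 cx]] := MVT_segment x0 (fun z _ => is_derive_sin z) (cs 0 x).
rewrite sin0 !subr0 => h1.
have [e /[!in_itv]/=/andP[ex ep]] := MVT_segment xp (fun z _ => is_derive_sin z) (cs x (pi / 2)).
rewrite sin_pihalf => h2.
have cec : cos e <= cos c.
  have [->//|ec] := eqVneq c e; rewrite ltW// ltr_cos ?in_itv/=.
  - by rewrite lt_neqAle ec (le_trans cx ex).
  - by rewrite c0 /=; lra.
  - by apply/andP; split; lra.
rewrite ler_pdivrMr//.
have h3 : cos e * (pi / 2 - x) * x <= cos c * (pi / 2 - x) * x.
  by rewrite ler_wpM2r// ler_wpM2r// subr_ge0.
have : x * (1 - sin x) <= cos c * x * (pi / 2 - x) by rewrite h2; lra.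
rewrite -h1; lra.
Qed.

End trigonometric_bounds.

(** * Characteristic function of the centred uniform law *)

Section dirichlet_kernel.
Context {R : realType}.
Implicit Types (t : R) (m : nat).

(* The mean of the uniform law on {1, ..., m}. *)
Definition mid m : R := m.+1%:R / 2.

(* The characteristic function of the centred uniform law, real by symmetry. *)
Definition chr m t : R := m%:R^-1 * \sum_(j < m) cos ((j.+1%:R - mid m) * t).

Lemma mid_rev m (j : 'I_m) : (rev_ord j).+1%:R - mid m = - (j.+1%:R - mid m).
Proof.
rewrite /mid /= subnSK// natrB ?(ltnW (ltn_ord j))//.
by rewrite -!natr1; field.
Qed.

(** Averaging a cosine over one uniform step multiplies it by [chr] and shifts its phase by the
    mean; the sine part cancels under the reversal of {1, ..., m}. *)
Lemma conv_cos m (y t : R) :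
  m%:R^-1 * \sum_(j < m) cos ((y + j.+1%:R) * t) = chr m t * cos ((y + mid m) * t).
Proof.
have s0 : \sum_(j < m) sin ((j.+1%:R - mid m) * t) = 0.
  set S := \sum_(j < m) _.
  suff : S = - S by lra.
  rewrite {1}/S (reindex_inj rev_ord_inj) -sumrN; apply: eq_bigr => j _.
  by rewrite mid_rev mulNr sinN.
rewrite /chr -mulrA; congr (_ * _).
transitivity (\sum_(j < m) (cos ((y + mid m) * t) * cos ((j.+1%:R - mid m) * t) -
    sin ((y + mid m) * t) * sin ((j.+1%:R - mid m) * t))).
  by apply: eq_bigr => j _; rewrite -cosD; congr cos; ring.
by rewrite big_split/= sumrN -!mulr_sumr s0 mulr0 subr0 mulrC.
Qed.

Lemma sum_sqr_mid m : \sum_(j < m) (j.+1%:R - mid m) ^+ 2 = m%:R * (m%:R ^+ 2 - 1) / 12 :> R.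
Proof.
have h k (a : R) : \sum_(j < k) (j.+1%:R - a) ^+ 2 =
    k%:R * (k%:R + 1) * (2 * k%:R + 1) / 6 - a * k%:R * (k%:R + 1) + k%:R * a ^+ 2.
  elim: k => [|k IH]; first by rewrite big_ord0; field.
  by rewrite big_ord_recr/= IH -natr1; field.
by rewrite h /mid -natr1; field.
Qed.

Lemma norm_mid m (j : 'I_m) : `|j.+1%:R - mid m| <= m%:R / 2 :> R.
Proof.
have h : j.+1%:R <= m%:R :> R by rewrite ler_nat.
have h1 : 1 <= j.+1%:R :> R by rewrite ler1n.
by rewrite /mid ler_norml -[m.+1%:R]natr1; apply/andP; split; lra.
Qed.

Lemma chr_ge m t : (0 < m)%N -> 1 - (m%:R * t) ^+ 2 / 24 <= chr m t.
Proof.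
move=> m0; have m0' : 0 < m%:R :> R by rewrite ltr0n.
rewrite /chr ler_pdivlMl//.
apply: (@le_trans _ _ (\sum_(j < m) (1 - ((j.+1%:R - mid m) * t) ^+ 2 / 2))).
  rewrite big_split/= sumr_const card_ord sumrN -mulr_suml.
  under eq_bigr do rewrite exprMn.
  rewrite -mulr_suml sum_sqr_mid.
  have := sqr_ge0 t; set t2 := t ^+ 2; rewrite exprMn -/t2 => ht.
  have := mulr_ge0 (ltW m0') ht; set M := m%:R; lra.
by apply: ler_sum => j _; exact: cos_ge.
Qed.

Lemma chr_le m t : (0 < m)%N -> m%:R * `|t| <= 4 ->
  chr m t <= 1 - (m%:R ^+ 2 - 1) * t ^+ 2 / 24 + (m%:R * t) ^+ 4 / 384.
Proof.
move=> m0 mt; have m0' : 0 < m%:R :> R by rewrite ltr0n.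
rewrite /chr ler_pdivrMl//.
have yb (j : 'I_m) : `|(j.+1%:R - mid m) * t| <= m%:R * `|t| / 2.
  by rewrite normrM mulrAC ler_wpM2r// norm_mid.
apply: (@le_trans _ _ (\sum_(j < m) (1 - ((j.+1%:R - mid m) * t) ^+ 2 / 2 + (m%:R * t) ^+ 4 / 384))).
  apply: ler_sum => j _; apply: (le_trans (cos_le _)).
    by apply: (le_trans (yb j)); lra.
  rewrite lerD2l.
  have : ((j.+1%:R - mid m) * t) ^+ 4 <= (m%:R * t / 2) ^+ 4.
    rewrite -[4%N]/(2 * 2)%N !exprM lerXn2r ?nnegrE ?sqr_ge0//.
    rewrite -(real_normK (num_real (_ * t))) -(real_normK (num_real (_ / 2))) lerXn2r ?nnegrE//.
    by rewrite (le_trans (yb j))// !normrM normfV (ger0_norm (ltW m0')) [`|2|]ger0_norm.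
  by rewrite expr_div_n => h; lra.
rewrite 2!big_split/= !sumr_const card_ord sumrN -mulr_suml.
under eq_bigr do rewrite exprMn.
rewrite -mulr_suml sum_sqr_mid.
set X := (m%:R * t) ^+ 4; rewrite -(mulr_natl (X / 384) m).
by rewrite le_eqVlt; apply/predU1P; left; field.
Qed.

(** Decay away from the origin: multiplied by 2 sin (t / 2) the cosine sum telescopes to 2 sin (m t
    / 2), and Jordan's inequality bounds sin (t / 2) below by t / pi. *)
Lemma norm_chr_le m t : (0 < m)%N -> 0 < t <= pi -> `|chr m t| <= pi / (m%:R * t).
Proof.
move=> m0 /andP[t0 tp]; have m0' : 0 < m%:R :> R by rewrite ltr0n.
have p0 := pi_gt0 R.
have tele : 2 * sin (t / 2) * \sum_(j < m) cos ((j.+1%:R - mid m) * t) = 2 * sin (m%:R * t / 2).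
  rewrite mulr_sumr.
  pose a (j : nat) := sin ((j%:R + 1 / 2 - mid m) * t).
  rewrite (eq_bigr (fun j : 'I_m => a j.+1 - a j)); last first.
    move=> j _; rewrite /a.
    have -> : (j.+1%:R + 1 / 2 - mid m) * t = (j.+1%:R - mid m) * t + t / 2 by field.
    have -> : (j%:R + 1 / 2 - mid m) * t = (j.+1%:R - mid m) * t - t / 2 by rewrite -natr1; field.
    by rewrite sinD sinB; ring.
  rewrite -(big_mkord xpredT (fun j => a j.+1 - a j)) telescope_sumr// /a.
  have -> : (m%:R + 1 / 2 - mid m) * t = m%:R * t / 2 by rewrite /mid -natr1; field.
  have -> : (0%:R + 1 / 2 - mid m) * t = - (m%:R * t / 2) by rewrite /mid -natr1; field.
  by rewrite sinN; ring.
have s1 : t / pi <= sin (t / 2).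
  have -> : t / pi = 2 * (t / 2) / pi by rewrite [2 * _]mulrC divfK.
  apply: jordan_sin; apply/andP; split; lra.
have tp0 : 0 < t / pi by rewrite divr_gt0.
have S0 : 0 < sin (t / 2) by exact: lt_le_trans s1.
set S := \sum_(j < m) _ in tele.
have SE : S = sin (m%:R * t / 2) / sin (t / 2).
  by apply: (mulfI (_ : 2 * sin (t / 2) != 0)); [rewrite gt_eqF// mulr_gt0|rewrite tele; field; rewrite gt_eqF].
rewrite /chr -/S SE normrM normfV (gtr0_norm m0') normrM normfV (gtr0_norm S0).
have -> : pi / (m%:R * t) = m%:R^-1 * (pi / t) by rewrite invfM mulrCA.
rewrite ler_pM2l ?invr_gt0//.
rewrite -[leRHS]mul1r ler_pM ?invr_ge0 ?(ltW S0) ?sin_max//.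
by rewrite -[leRHS]invrK lef_pV2 ?posrE// invfM invrK ?[_^-1 * t]mulrC// mulr_gt0// invr_gt0.
Qed.

End dirichlet_kernel.

(** * Point probabilities as cosine integrals *)

Section fourier_inversion.
Context {R : realType}.
Local Notation mu := (@lebesgue_measure R).
Implicit Types (t : R) (m k z s : nat).

(* conv m g z = E g(z + X) with X uniform on {1, ..., m}; hence upmf m k s is the
   probability that k independent such variables sum to s. *)
Definition conv m (g : nat -> R) : nat -> R :=
  fun z => m%:R^-1 * \sum_(j < m) g (z + j.+1)%N.

Definition upmf m k s : R := iter k (conv m) (fun z => (z == s)%:R) 0%N.

Lemma sin_natpi k : sin (k%:R * pi) = 0 :> R.
Proof.
elim: k => [|k IH]; first by rewrite mul0r sin0.
by rewrite -natr1 mulrDl mul1r sinDpi IH oppr0.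
Qed.

Lemma sin_subpi z s : sin ((z%:R - s%:R) * pi) = 0 :> R.
Proof. by rewrite mulrBl sinB !sin_natpi mulr0 mul0r subr0. Qed.

Lemma Rintegral_cos z s :
  \int[mu]_(t in `[0, pi]) cos ((z%:R - s%:R) * t) = pi * (z == s)%:R.
Proof.
have p0 := pi_gt0 R.
have [->|zs] := eqVneq z s.
  under eq_Rintegral do rewrite subrr mul0r cos0.
  by rewrite Rintegral_cst//= lebesgue_measure_itv/= lte_fin p0 -EFinB subr0 mul1r mulr1.
set a := z%:R - s%:R.
have a0 : a != 0 by rewrite subr_eq0 eqr_nat.
have dF t : is_derive t (1 : R) (fun t => sin (a * t) / a) (cos (a * t)).
  have h := @is_derive1_comp _ sin (fun y : R => a * y) t (cos (a * t)) a
    (is_derive_sin _) (is_derive_mull _ _).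
  have := is_deriveM h (is_derive_cst a^-1 t 1).
  by move=> /is_derive_eq; apply; rewrite /GRing.scale /=; field.
have cF t : {for t, continuous (fun t => sin (a * t) / a)}.
  exact: is_derive1_continuous (dF t).
rewrite /Rintegral (@continuous_FTC2 R (fun t => cos (a * t))
  (fun t => sin (a * t) / a) 0 pi p0).
- by rewrite mulr0 sin0 mul0r sube0 /= sin_subpi mul0r mulr0.
- by apply: continuous_subspaceT; exact: continuous_cosM.
- split.
  + by move=> t _; have [] := dF t.
  + by apply: cvg_at_right_filter; exact: (cF 0).
  + by apply: cvg_at_left_filter; exact: cF.
- by move=> t _; rewrite derive1E; have [_ ->] := dF t.
Qed.

Lemma continuous_sum (I : Type) (r : seq I) (F : I -> R -> R) :
  (forall i, continuous (F i)) -> continuous (fun t => \sum_(i <- r) F i t).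
Proof.
move=> cF; elim: r => [|i r IH] t.
  by under eq_fun do rewrite big_nil; exact: cvg_cst.
rewrite (_ : (fun t => _) = (fun t => F i t + \sum_(j <- r) F j t)); last first.
  by apply/funext => y; rewrite big_cons.
by apply: cvgD; [exact: cF|exact: IH].
Qed.

Lemma continuous_chr m : continuous (@chr R m).
Proof.
move=> t; apply: cvgM; first exact: cvg_cst.
by apply: continuous_sum => j; exact: continuous_cosM.
Qed.

Lemma continuous_chrX_cos m k (a : R) : continuous (fun t => chr m t ^+ k * cos (a * t)).
Proof.
move=> t; apply: cvgM; last exact: continuous_cosM.
have := @continuous_comp _ _ _ (@chr R m) (fun x => x ^+ k) t.
by apply; [exact: continuous_chr|exact: exprn_continuous].
Qed.

Lemma Rintegral_sum (I : eqType) (r : seq I) (F : I -> R -> R) (b : R) :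
  (forall i, continuous (F i)) ->
  \int[mu]_(t in `[0, b]) (\sum_(i <- r) F i t) =
  \sum_(i <- r) \int[mu]_(t in `[0, b]) F i t.
Proof.
move=> cF; elim: r => [|i r IH].
  rewrite big_nil; under eq_Rintegral do rewrite big_nil.
  by rewrite /Rintegral integral0.
rewrite big_cons -IH -RintegralD//.
- by apply: eq_Rintegral => t _; rewrite big_cons.
- exact: continuous_integrable_itv.
- by apply: continuous_integrable_itv; exact: continuous_sum.
Qed.

(** Induction on k, for all starting points z: the base case is orthogonality of cosines on [0, pi],
    and each further convolution contributes a factor [chr] by [conv_cos]. *)
Lemma iter_conv_Rintegral m k z s :
  iter k (conv m) (fun z => (z == s)%:R) z =
  pi^-1 * \int[mu]_(t in `[0, pi]) (chr m t ^+ k * cos ((z%:R + k%:R * mid m - s%:R) * t)).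
Proof.
have p0 := pi_gt0 R.
elim: k z => [|k IH] z.
  under eq_Rintegral do rewrite expr0 mul1r mul0r addr0.
  by rewrite Rintegral_cos mulrA mulVf ?mul1r// gt_eqF.
rewrite iterS /conv; under eq_bigr do rewrite IH.
rewrite -mulr_sumr mulrCA; congr (_ * _).
rewrite -Rintegral_sum; last by move=> i; exact: continuous_chrX_cos.
rewrite -RintegralZl//; last first.
  apply: continuous_integrable_itv; apply: continuous_sum => i.
  exact: continuous_chrX_cos.
apply: eq_Rintegral => t _; rewrite -mulr_sumr mulrCA exprSr -mulrA; congr (_ * _).
have -> : z%:R + k.+1%:R * mid m - s%:R = (z%:R + k%:R * mid m - s%:R) + mid m :> R.
  by rewrite -[k.+1%:R]natr1; ring.
rewrite -conv_cos; congr (_ * _); apply: eq_bigr => j _; congr (cos (_ * _)).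
by rewrite natrD; ring.
Qed.

Lemma Rintegral_scale (G : R -> R) (b c : R) : 0 < c -> 0 <= b -> continuous G ->
  \int[mu]_(t in `[0, b]) G t = c^-1 * \int[mu]_(t in `[0, c * b]) G (t / c).
Proof.
move=> c0 b0 cG.
have dF t : is_derive t (1 : R) (fun y : R => y * c^-1) c^-1 by exact: is_derive_mulr.
have F'E : (fun y : R => y * c^-1)^`()%classic = (fun=> c^-1).
  by apply/funext => t; rewrite derive1E; have [_ ->] := dF t.
have cF t : {for t, continuous (fun y : R => y * c^-1)}.
  exact: is_derive1_continuous (dF t).
have cGc : continuous (fun t : R => G (t / c)).
  move=> t; apply: (@continuous_comp _ _ _ (fun y : R => y / c) G); last exact: cG.
  exact: cF.
have cb0 : 0 <= c * b by rewrite mulr_ge0// ltW.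
have := @integration_by_substitution_increasing R (fun y : R => y * c^-1) G 0 (c * b) cb0.
rewrite F'E mul0r mulrAC divff ?gt_eqF// mul1r => h.
rewrite /Rintegral h.
- rewrite -[RHS]/(c^-1 * Rintegral mu `[0, c * b] (fun t => G (t / c))) -RintegralZl//.
    by rewrite /Rintegral; congr fine; apply: eq_integral => t _; rewrite /= mulrC.
  exact: continuous_integrable_itv.
- by move=> x y _ _ xy; rewrite ltr_pM2r// invr_gt0.
- by move=> t _; exact: cvg_cst.
- exact: is_cvg_cst.
- exact: is_cvg_cst.
- split.
  + by move=> t _; have [] := dF t.
  + by apply: cvg_at_right_filter; exact: (cF 0).
  + by apply: cvg_at_left_filter; exact: cF.
- exact: continuous_subspaceT.
Qed.

(* A sum of k uniform variables has variance close to k m^2 / 12, so that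
   chr m (t / scl m k) ^+ k tends to expR (- t ^+ 2). *)
Definition scl m k : R := m%:R * Num.sqrt (k%:R / 24).

Definition hker m k t : R :=
  chr m (t / scl m k) ^+ k * \1_(`[0, scl m k * pi]) t.

Lemma upmf_Rintegral m k s : (0 < m)%N -> (0 < k)%N ->
  scl m k * upmf m k s =
  pi^-1 * \int[mu]_(t in `[0, +oo[)
    (hker m k t * cos ((k%:R * mid m - s%:R) / scl m k * t)).
Proof.
move=> m0 k0; set c := scl m k.
have c0 : 0 < c by rewrite mulr_gt0 ?sqrtr_gt0 ?divr_gt0 ?ltr0n.
rewrite /upmf iter_conv_Rintegral (Rintegral_scale c0 (pi_ge0 R)); last exact: continuous_chrX_cos.
rewrite add0r mulrCA mulVKf ?gt_eqF//; congr (_ * _).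
rewrite /Rintegral; congr fine; rewrite [LHS]integral_mkcond [RHS]integral_mkcond.
apply: eq_integral => t _; rewrite !patchE /hker !indicE !mem_setE !in_itv/= andbT -/c.
case: (0 <= t) => //=; case: (t <= _) => /=; rewrite ?mulr0 ?mul0r//.
by rewrite mulr1 [_ / c * t]mulrAC mulrA.
Qed.

End fourier_inversion.

(** * Local limit theorem, uniform in the number of terms, the range and the point *)

Section local_limit.
Context {R : realType}.
Local Notation mu := (@lebesgue_measure R).
Implicit Types (t : R) (m k s : nat).

Lemma integrable_oneDsqrV :
  mu.-integrable `[0, +oo[ (EFin \o (fun t : R => (oneDsqr t)^-1)).
Proof.
have mf : measurable_fun (`[0%R, +oo[%classic : set R) (fun t : R => (oneDsqr t)^-1).
  apply: measurable_funTS; apply: continuous_measurable_fun.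
  exact: continuous_oneDsqrV.
apply/integrableP; split; first exact/measurable_EFinP.
rewrite (_ : (\int[mu]_(x in _) _)%E = (pi / 2)%:E) ?ltry// -integral0y_oneDsqr.
by apply: eq_integral => t _ /=; rewrite ger0_norm// invr_ge0 (le_trans _ (oneDsqr_ge1 _)).
Qed.

Lemma bernoulli_ineq (x : R) k : 0 <= x -> 1 + k%:R * x <= (1 + x) ^+ k.
Proof.
move=> x0; elim: k => [|k IH]; first by rewrite mul0r addr0 expr0.
rewrite exprS; apply: (@le_trans _ _ ((1 + x) * (1 + k%:R * x))).
  rewrite -natr1; have : 0 <= k%:R * (x * x) by rewrite !mulr_ge0.
  lra.
by rewrite ler_wpM2l// addr_ge0.
Qed.

(** Bernoulli's inequality for 1 / r. It lets a geometric decay in k absorb a factor k. *)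
Lemma natmul_expr_le (r : R) k : 0 < r < 1 -> k%:R * r ^+ k <= r / (1 - r).
Proof.
move=> /andP[r0 r1].
have d0 : 0 <= r^-1 - 1 by rewrite subr_ge0 -[leLHS]invr1 lef_pV2 ?posrE// ltW.
have := bernoulli_ineq k d0; rewrite [in leRHS]addrC subrK exprVn => h.
have rk : 0 < r ^+ k by rewrite exprn_gt0.
have {}h : (k%:R * (r^-1 - 1)) * r ^+ k <= 1.
  rewrite -[leRHS](mulVf (lt0r_neq0 rk)) ler_wpM2r ?(ltW rk)//; lra.
rewrite ler_pdivlMr ?subr_gt0// -[leRHS](mulr1 r).
have -> : k%:R * r ^+ k * (1 - r) = r * (k%:R * (r^-1 - 1) * r ^+ k).
  by field; rewrite gt_eqF.
by rewrite ler_wpM2l// ltW.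
Qed.

(** Weaker than [chr_le] near 0 but free of a quartic error, so it gives Gaussian decay on the whole
    range m |t| <= 4. The constant 48 has two sources: y^2 / 2 - y^4 / 24 >= y^2 / 3 for |y| <= 2,
    and m^2 - 1 >= 3 m^2 / 4 for m >= 2; for m = 1 there is no decay at all. *)
Lemma chr_le_quad m t : (1 < m)%N -> m%:R * `|t| <= 4 ->
  chr m t <= 1 - (m%:R * t) ^+ 2 / 48.
Proof.
move=> m1 mt; have m0' : 0 < m%:R :> R by rewrite ltr0n ltnW.
apply: (@le_trans _ _ (1 - (m%:R ^+ 2 - 1) * t ^+ 2 / 36)); last first.
  have m2 : 4 <= m%:R ^+ 2 :> R by rewrite -natrX ler_nat (leq_exp2r 2 m (e := 2)).
  have : 0 <= (m%:R ^+ 2 - 4) * t ^+ 2 by rewrite mulr_ge0 ?sqr_ge0 ?subr_ge0.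
  by rewrite exprMn; lra.
rewrite /chr ler_pdivrMl//.
have yb (j : 'I_m) : `|(j.+1%:R - mid m) * t| <= 2.
  apply: (@le_trans _ _ (m%:R * `|t| / 2)); last by lra.
  by rewrite normrM mulrAC ler_wpM2r// norm_mid.
apply: (@le_trans _ _ (\sum_(j < m) (1 - ((j.+1%:R - mid m) * t) ^+ 2 / 3))).
  apply: ler_sum => j _; apply: (le_trans (cos_le (yb j))).
  have := yb j; set y := _ * t => hy.
  have y4 : y ^+ 2 <= 4.
    rewrite -(real_normK (num_real y)) (_ : 4 = 2 ^+ 2); last by rewrite -natrX.
    by rewrite lerXn2r ?nnegrE.
  have : 0 <= y ^+ 2 * (4 - y ^+ 2) by rewrite mulr_ge0 ?sqr_ge0 ?subr_ge0.
  have -> : y ^+ 4 = y ^+ 2 * y ^+ 2 by ring.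
  lra.
rewrite big_split/= !sumr_const card_ord sumrN -mulr_suml.
under eq_bigr do rewrite exprMn.
rewrite -mulr_suml sum_sqr_mid.
by rewrite le_eqVlt; apply/predU1P; left; field.
Qed.

Lemma scl_gt0 m k : (0 < m)%N -> (0 < k)%N -> 0 < scl m k :> R.
Proof. by move=> m0 k0; rewrite mulr_gt0 ?sqrtr_gt0 ?divr_gt0 ?ltr0n. Qed.

Lemma scl_sqr m k t : (0 < m)%N -> (0 < k)%N ->
  (m%:R * (t / scl m k)) ^+ 2 = 24 * t ^+ 2 / k%:R.
Proof.
move=> m0 k0; rewrite /scl !exprMn exprVn exprMn sqr_sqrtr ?divr_ge0//.
by field; rewrite !pnatr_eq0 -!lt0n k0 m0.
Qed.

Lemma expR_mulNn (x : R) k : x < 1 -> 0 <= x ->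
  expR (- (k%:R * x / (1 - x))) <= (1 - x) ^+ k <= expR (- (k%:R * x)).
Proof.
move=> x1 x0; have y0 : 0 < 1 - x by rewrite subr_gt0.
apply/andP; split.
  rewrite -mulrA -mulrN mulrC expRM_natr lerXn2r ?nnegrE ?expR_ge0 ?(ltW y0)//.
  rewrite expRN -[leRHS]invrK lef_pV2 ?posrE ?expR_gt0 ?invr_gt0//.
  apply: le_trans (expR_ge1Dx _).
  by rewrite le_eqVlt; apply/predU1P; left; field; rewrite gt_eqF.
rewrite -mulrN mulrC expRM_natr lerXn2r ?nnegrE ?expR_ge0 ?(ltW y0)//.
by rewrite expR_ge1Dx.
Qed.

(** For m th <= 4, [chr_le_quad] gives a bound expR (- t^2 / 2), at most 2 / (1 + t^2). Beyond that,
    [norm_chr_le] combines an algebraic decay in t with a geometric decay in k. Past the cut-off of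
    [hker] the function is 0. *)
Lemma hker_dominated : exists C : R, forall m k t,
  (1 < m)%N -> (1 < k)%N -> 0 <= t -> `|hker m k t| <= C * (oneDsqr t)^-1.
Proof.
(* The value of the bound in [norm_chr_le] at m th = 4; it is below 1 because pi < 4. *)
pose r : R := pi / 4.
have p0 := pi_gt0 R.
have r0 : 0 < r by rewrite divr_gt0.
have r1 : r < 1 by rewrite ltr_pdivrMr// mul1r; have := pihalf_lt2 R; lra.
exists (2 + 2 * pi ^+ 2 / 24 * (r / (1 - r) / r ^+ 2)) => m k t m1 k1 t0.
have m0 := ltnW m1; have k0 := ltnW k1.
have c0 := scl_gt0 m0 k0.
have d0 : 0 < (1 + t ^+ 2) by rewrite ltr_pwDl ?sqr_ge0.
have rr : 0 < r / (1 - r) / r ^+ 2 by rewrite !divr_gt0 ?exprn_gt0 ?subr_gt0.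
have kk : 0 < pi ^+ 2 / 24 * (r / (1 - r) / r ^+ 2).
  by apply: mulr_gt0 rr; rewrite divr_gt0 ?exprn_gt0.
rewrite /hker normrM normrX indicE mem_setE in_itv/= t0/=.
have [tc|tc] := leP t (scl m k * pi); last first.
  rewrite normr0 mulr0 mulr_ge0 ?invr_ge0 ?(ltW d0)//.
  lra.
rewrite normr1 mulr1.
set th := t / scl m k.
have th0 : 0 <= th by rewrite divr_ge0// ltW.
have thpi : th <= pi by rewrite ler_pdivrMr// mulrC.
have w2 : (m%:R * th) ^+ 2 = 24 * t ^+ 2 / k%:R by exact: scl_sqr.
have k0' : 0 < k%:R :> R by rewrite ltr0n.
have [wle|wgt] := leP (m%:R * th) 4.
  have wa : m%:R * `|th| <= 4 by rewrite ger0_norm.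
  have ub := chr_le_quad m1 wa.
  have lb := chr_ge th m0.
  have w16 : (m%:R * th) ^+ 2 <= 16.
    rewrite (_ : 16 = 4 ^+ 2); last by rewrite -natrX.
    by rewrite lerXn2r ?nnegrE// mulr_ge0.
  have ch0 : 0 <= chr m th by lra.
  rewrite ger0_norm//.
  apply: (@le_trans _ _ (expR (- (t ^+ 2 / 2)))).
    apply: (@le_trans _ _ ((1 - (m%:R * th) ^+ 2 / 48) ^+ k)).
      by rewrite lerXn2r ?nnegrE// (le_trans ch0).
    have x1 : (m%:R * th) ^+ 2 / 48 < 1 by lra.
    have x0 : 0 <= (m%:R * th) ^+ 2 / 48 by rewrite divr_ge0 ?sqr_ge0.
    have /andP[_] := expR_mulNn k x1 x0.
    move=> /le_trans; apply; rewrite ler_expR w2.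
    by rewrite le_eqVlt; apply/predU1P; left; field; rewrite gt_eqF.
  rewrite expRN.
  apply: (@le_trans _ _ (2 * (1 + t ^+ 2)^-1)); last first.
    by rewrite ler_wpM2r ?invr_ge0 ?(ltW d0)// lerDl; lra.
  rewrite -[leRHS]invrK lef_pV2 ?posrE ?expR_gt0 ?invr_gt0 ?mulr_gt0 ?invr_gt0//.
  rewrite invfM invrK; apply: le_trans (expR_ge1Dx _); lra.
have th_gt0 : 0 < th.
  rewrite lt_neqAle th0 andbT; apply/eqP => E; move: wgt; rewrite -E mulr0; lra.
have t_gt0 : 0 < t by move: th_gt0; rewrite /th pmulr_lgt0 ?invr_gt0.
have h1 : `|chr m th| <= pi / (m%:R * th) by apply: norm_chr_le => //; rewrite th_gt0.
have w0 : 0 < m%:R * th by lra.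
have h2 : `|chr m th| <= r.
  by apply: (le_trans h1); rewrite ler_pM2l// lef_pV2 ?posrE// ltW.
have w16 : 16 < (m%:R * th) ^+ 2.
  rewrite (_ : 16 = 4 ^+ 2); last by rewrite -natrX.
  by rewrite ltrXn2r ?nnegrE// ltW.
have t1 : 1 <= t ^+ 2.
  move: w16; rewrite w2 ltr_pdivlMr//.
  have : 2 <= k%:R :> R by rewrite ler_nat.
  lra.
(* Two of the k factors are bounded by pi / (m th), which yields a multiple of k / t^2; the other k
   - 2 factors are at most r each and absorb the k. *)
rewrite -(subnKC k1) exprD.
apply: (@le_trans _ _ (pi ^+ 2 * (k%:R / (24 * t ^+ 2)) * r ^+ (k - 2))).
  rewrite ler_pM ?exprn_ge0//; last by rewrite lerXn2r ?nnegrE ?(ltW r0).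
  apply: (@le_trans _ _ ((pi / (m%:R * th)) ^+ 2)).
    by rewrite lerXn2r ?nnegrE// divr_ge0 ?(ltW p0)// ltW.
  by rewrite expr_div_n w2 ler_wpM2l ?sqr_ge0// invf_div.
have h3 : k%:R * r ^+ (k - 2) <= r / (1 - r) / r ^+ 2.
  rewrite ler_pdivlMr ?exprn_gt0// -mulrA -exprD subnK//.
  by apply: natmul_expr_le; rewrite r0.
have -> : pi ^+ 2 * (k%:R / (24 * t ^+ 2)) * r ^+ (k - 2) =
  (pi ^+ 2 / 24 * (k%:R * r ^+ (k - 2))) * (t ^+ 2)^-1.
  by field; rewrite gt_eqF.
set B := r / (1 - r) / r ^+ 2 in h3 rr kk *.
have t2 : 0 < t ^+ 2 by rewrite (lt_le_trans _ t1).
apply: (@le_trans _ _ (pi ^+ 2 / 24 * B * (2 * (1 + t ^+ 2)^-1))).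
  rewrite ler_pM// ?invr_ge0 ?(ltW t2)//.
  - by rewrite mulr_ge0 ?divr_ge0 ?sqr_ge0// mulr_ge0// exprn_ge0// ltW.
  - by rewrite ler_wpM2l// divr_ge0 ?sqr_ge0.
  - by rewrite ler_pdivlMr// mulrC ler_pdivrMr//; lra.
rewrite mulrA ler_wpM2r ?invr_ge0 ?(ltW d0)//.
lra.
Qed.

Lemma measurable_hker m k : measurable_fun setT (@hker R m k).
Proof.
apply: measurable_funM; last exact: measurable_indic.
apply: continuous_measurable_fun => t.
have h := @continuous_comp _ _ _ (fun y : R => chr m (y / scl m k)) (fun x => x ^+ k) t.
apply: h; last exact: exprn_continuous.
apply: (@continuous_comp _ _ _ (fun y : R => y / scl m k) (@chr R m)); last exact: continuous_chr.
exact: is_derive1_continuous (is_derive_mulr _ _).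
Qed.

Section limit.
Variables (m_ k_ : nat -> nat).
Hypothesis m_gt : forall i : nat, (i.+1 < m_ i)%N.
Hypothesis k_gt : forall i : nat, (i.+1 < k_ i)%N.

Lemma cvg_natV (n_ : nat -> nat) : (forall i : nat, (i.+1 < n_ i)%N) ->
  (n_ i)%:R^-1 @[i --> \oo] --> (0 : R).
Proof.
move=> n_gt; apply: (@squeeze_cvgr _ _ _ _ (cst 0) (@harmonic R)).
- near=> i; rewrite /= invr_ge0 ler0n/=.
  by rewrite lef_pV2 ?posrE ?ltr0n ?(leq_ltn_trans _ (n_gt i))// ler_nat ltnW.
- exact: cvg_cst.
- exact: cvg_harmonic.
Unshelve. all: by end_near. Qed.

(** k (1 - chr) is squeezed to t^2: the quartic error of [chr_le], multiplied by k, is O(1 / k), and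
    m^2 - 1 differs from m^2 by a relative error 1 / m^2. Then [expR_mulNn] turns this into the
    limit of the k-th power. *)
Lemma cvg_hker t : 0 <= t -> hker (m_ i) (k_ i) t @[i --> \oo] --> gauss_fun t.
Proof.
move=> t0.
have m0 i : (0 < m_ i)%N by rewrite (leq_ltn_trans _ (m_gt i)).
have k0 i : (0 < k_ i)%N by rewrite (leq_ltn_trans _ (k_gt i)).
have c0 i : 0 < scl (m_ i) (k_ i) :> R by exact: scl_gt0.
have mV := cvg_natV m_gt; have kV := cvg_natV k_gt.
pose th i := t / scl (m_ i) (k_ i).
have w2 i : ((m_ i)%:R * th i) ^+ 2 = 24 * t ^+ 2 / (k_ i)%:R by exact: scl_sqr.
pose x i := 1 - chr (m_ i) (th i).
have small (e : R) : 0 < e -> \forall i \near \oo, 24 * t ^+ 2 / (k_ i)%:R <= e.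
  move=> e0.
  have : 24 * t ^+ 2 / (k_ i)%:R @[i --> \oo] --> (0 : R).
    by rewrite -(mulr0 (24 * t ^+ 2)); apply: cvgMl_tmp.
  move=> /cvgrPdist_le /(_ _ e0); apply: filterS => i.
  by rewrite sub0r normrN; apply: le_trans; exact: ler_norm.
have wsmall : \forall i \near \oo, (m_ i)%:R * `|th i| <= 1.
  have := small 1 ltr01; apply: filterS => i; rewrite -w2 => h.
  have th0 : 0 <= th i by rewrite divr_ge0// ltW.
  by rewrite ger0_norm//; move: h; rewrite expr_le1// mulr_ge0.
have kx : (k_ i)%:R * x i @[i --> \oo] --> t ^+ 2.
  apply: (@squeeze_cvgr _ _ _ _
    (fun i => t ^+ 2 * (1 - (m_ i)%:R^-1 * (m_ i)%:R^-1) - 3 / 2 * t ^+ 4 * (k_ i)%:R^-1)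
    (fun=> t ^+ 2)).
  - near=> i.
    have wi : (m_ i)%:R * `|th i| <= 1 by near: i.
    have K0 : 0 < (k_ i)%:R :> R by rewrite ltr0n.
    have M0 : 0 < (m_ i)%:R :> R by rewrite ltr0n.
    have lb := chr_ge (th i) (m0 i).
    have wi4 : (m_ i)%:R * `|th i| <= 4 by lra.
    have ub := chr_le (m0 i) wi4.
    have e4 : ((m_ i)%:R * th i) ^+ 4 = (24 * t ^+ 2 / (k_ i)%:R) ^+ 2.
      by rewrite -w2 -exprM.
    have e2 : ((m_ i)%:R ^+ 2 - 1) * th i ^+ 2 =
        24 * t ^+ 2 / (k_ i)%:R * (1 - (m_ i)%:R^-1 * (m_ i)%:R^-1).
      by rewrite -w2; field; rewrite gt_eqF.
    rewrite /x; apply/andP; split.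
      have : t ^+ 2 * (1 - (m_ i)%:R^-1 * (m_ i)%:R^-1) - 3 / 2 * t ^+ 4 * (k_ i)%:R^-1 =
        (k_ i)%:R * (((m_ i)%:R ^+ 2 - 1) * th i ^+ 2 / 24 - ((m_ i)%:R * th i) ^+ 4 / 384).
        by rewrite e2 e4; field; rewrite !gt_eqF.
      move=> ->; rewrite ler_pM2l//; lra.
    rewrite mulrC -ler_pdivlMr//; move: lb; rewrite w2; lra.
  - rewrite -[X in _ --> X]subr0 -[X in _ --> X - _](mulr1 (t ^+ 2)).
    rewrite -[X in _ --> _ - X](mulr0 (3 / 2 * t ^+ 4)).
    apply: cvgB; apply: cvgMl_tmp => //.
    rewrite -[X in _ --> X]subr0 -[X in _ --> _ - X](mulr0 0).
    by apply: cvgB; [exact: cvg_cst|exact: cvgM].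
  - exact: cvg_cst.
have xE i : x i = (k_ i)%:R * x i * (k_ i)%:R^-1.
  by rewrite mulrAC divff ?mul1r// pnatr_eq0 -lt0n.
have x0 : x i @[i --> \oo] --> (0 : R).
  rewrite (_ : x = fun i => (k_ i)%:R * x i * (k_ i)%:R^-1); last by apply/funext.
  by rewrite -(mulr0 (t ^+ 2)); apply: cvgM.
have x_ge0 : \forall i \near \oo, 0 <= x i.
  near=> i.
  have wi : (m_ i)%:R * `|th i| <= 4 by apply: (@le_trans _ _ 1); [near: i|lra].
  have m1 : (1 < m_ i)%N by rewrite (leq_trans _ (m_gt i)).
  have := chr_le_quad m1 wi; rewrite /x.
  have := sqr_ge0 ((m_ i)%:R * th i); lra.
(* The cut-off in [hker] is eventually inactive, since th <= m th <= 1 < pi. *)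
apply: (@cvg_trans _ ((1 - x i) ^+ (k_ i) @[i --> \oo])).
  apply: near_eq_cvg; near=> i.
  rewrite /hker indicE mem_set ?mulr1; first by rewrite /x opprB addrCA subrr addr0.
  rewrite /= in_itv/= t0/=.
  have wi : (m_ i)%:R * `|th i| <= 1 by near: i.
  have th0 : 0 <= th i by rewrite divr_ge0// ltW.
  have M1 : 1 <= (m_ i)%:R :> R by rewrite ler1n.
  have thle : th i <= 1.
    by rewrite (le_trans _ wi)// ger0_norm// ler_peMl.
  rewrite mulrC -ler_pdivrMr//; apply: (le_trans thle).
  have := pi_ge2 R; lra.
have cE (u : nat -> R) (a : R) : u i @[i --> \oo] --> a -> expR (- u i) @[i --> \oo] --> expR (- a).
  by move=> ua; apply: continuous_cvg; [exact: continuous_expR|exact: cvgN].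
apply: (@squeeze_cvgr _ _ _ _ (fun i => expR (- ((k_ i)%:R * x i / (1 - x i))))
   (fun i => expR (- ((k_ i)%:R * x i)))).
- near=> i; apply: expR_mulNn; last by near: i.
  have : `|0 - x i| <= 1 / 2 by near: i; move/cvgrPdist_le : x0; apply; lra.
  by rewrite sub0r normrN ler_norml => /andP[]; lra.
- apply: cE; rewrite -[X in _ --> X]divr1.
  apply: cvgM => //; apply: cvgV; first exact: oner_neq0.
  by rewrite -[X in _ --> X](subr0 1); apply: cvgB => //; exact: cvg_cst.
- exact: cE.
Unshelve. all: by end_near. Qed.

Lemma cvg_Rintegral_hker :
  \int[mu]_(t in `[0, +oo[) `|hker (m_ i) (k_ i) t - gauss_fun t| @[i --> \oo] --> (0 : R).
Proof.
have [C hC] := hker_dominated.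
apply: (@dominated_cvg_Rintegral _ _ (fun i => hker (m_ i) (k_ i)) (@gauss_fun R)
  (fun t => C * (oneDsqr t)^-1) _ _ _ _ _ _).2.
- exact: measurable_itv.
- by move=> i; apply: measurable_funTS; exact: measurable_hker.
- by apply: measurable_funTS; exact: measurable_gauss_fun.
- by move=> t; rewrite /= in_itv/= andbT; exact: cvg_hker.
- rewrite (_ : EFin \o _ = (fun t : R => (C%:E * (oneDsqr t)^-1%:E)%E))//.
  by apply: integrableZl => //; exact: integrable_oneDsqrV.
- move=> i t; rewrite /= in_itv/= andbT => t0; apply: hC => //.
    by rewrite (leq_trans _ (m_gt i)).
  by rewrite (leq_trans _ (k_gt i)).
Qed.

End limit.

(** Uniformity in the pair (m, k) out of a statement on sequences: failure at every threshold would,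
    by choice, give a sequence of pairs with both entries unbounded that violates
    [cvg_Rintegral_hker]. *)
Lemma hker_L1 (e : R) : 0 < e -> exists K, forall m k, (K < m)%N -> (K < k)%N ->
  \int[mu]_(t in `[0, +oo[) `|hker m k t - gauss_fun t| <= e.
Proof.
move=> e0; apply: contrapT => H.
have {}H K : exists p : nat * nat, [/\ (K.+1 < p.1)%N, (K.+1 < p.2)%N &
    e < \int[mu]_(t in `[0, +oo[) `|hker p.1 p.2 t - gauss_fun t|].
  apply: contrapT => H'; apply: H; exists K.+1 => m k Km Kk.
  rewrite leNgt; apply/negP => h; apply: H'; exists (m, k); split => //.
have [f hf] := choice H.
have m_gt i : (i.+1 < (f i).1)%N by have [] := hf i.
have k_gt i : (i.+1 < (f i).2)%N by have [] := hf i.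
have := @cvg_Rintegral_hker (fun i => (f i).1) (fun i => (f i).2) m_gt k_gt.
move=> /cvgrPdist_le /(_ _ e0)[N _ /(_ N (leqnn N))].
rewrite /= sub0r normrN => /(le_trans (ler_norm _)).
by rewrite leNgt; have [_ _ ->] := hf N.
Qed.

(** The point s enters the integral only through a cosine bounded by 1, so L1 closeness of [hker] to
    the Gaussian bounds the error uniformly in s. *)
Lemma local_limit (e : R) : 0 < e -> exists K, forall m k s, (K < m)%N -> (K < k)%N ->
  `|scl m k * upmf m k s -
    (2 * Num.sqrt pi)^-1 * expR (- (((k%:R * mid m - s%:R) / scl m k) ^+ 2 / 4))| <= e.
Proof.
move=> e0; have p0 := pi_gt0 R.
have [K hK] := hker_L1 (mulr_gt0 e0 p0).
have [C hC] := hker_dominated.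
exists K.+1 => m k s Km Kk.
have m1 : (1 < m)%N by rewrite (leq_trans _ Km).
have k1 : (1 < k)%N by rewrite (leq_trans _ Kk).
rewrite upmf_Rintegral ?(ltnW m1) ?(ltnW k1)//.
set a := _ / scl m k.
have -> : (2 * Num.sqrt pi)^-1 * expR (- (a ^+ 2 / 4)) =
    pi^-1 * \int[mu]_(t in `[0, +oo[) gcos a t.
  rewrite Rintegral_gcos mulrA; congr (_ * _).
  rewrite -[in X in X^-1 * _](sqr_sqrtr (ltW p0)).
  by field; rewrite gt_eqF// sqrtr_gt0.
have ih : mu.-integrable `[0, +oo[ (EFin \o (hker m k)).
  apply: (@le_integrable _ _ _ mu _ _ _ (fun t : R => (C%:E * (oneDsqr t)^-1%:E)%E)) => //.
  - by apply/measurable_EFinP; apply: measurable_funTS; exact: measurable_hker.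
  - move=> t; rewrite /= in_itv/= andbT => t0; rewrite lee_fin.
    by apply: le_trans (ler_norm _); exact: hC.
  - by apply: integrableZl => //; exact: integrable_oneDsqrV.
have ig : mu.-integrable `[0, +oo[ (EFin \o (@gauss_fun R)).
  exact: integrableS integrableT_gauss.
have mc : measurable_fun (`[0%R, +oo[%classic : set R) (fun t => cos (a * t)).
  by apply: measurable_funTS; apply: continuous_measurable_fun; exact: continuous_cosM.
have le_cos (f : R -> R) : mu.-integrable `[0, +oo[ (EFin \o f) ->
    mu.-integrable `[0, +oo[ (EFin \o (fun t => f t * cos (a * t))).
  move=> intf; apply: (@le_integrable _ _ _ mu _ _ _ (EFin \o f)) => //.
    apply/measurable_EFinP/measurable_funM => //.
    by apply/measurable_EFinP; case/integrableP : intf.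
  by move=> t _ /=; rewrite lee_fin normrM -[leRHS]mulr1 ler_wpM2l// cos_max.
rewrite -mulrBr -RintegralB//; [|exact: le_cos|exact: le_cos].
rewrite normrM normfV (gtr0_norm p0) mulrC ler_pdivrMr//.
apply: le_trans (hK m k (ltnW Km) (ltnW Kk)).
have id : mu.-integrable `[0, +oo[ (EFin \o (fun t => hker m k t - gauss_fun t)).
  rewrite (_ : EFin \o _ = (fun t => ((hker m k t)%:E - (gauss_fun t)%:E)%E))//.
  exact: integrableB.
apply: (@le_trans _ _ (\int[mu]_(t in `[0, +oo[) `|(hker m k t - gauss_fun t) * cos (a * t)|)).
  rewrite (@eq_Rintegral _ _ _ mu _ (fun t => (hker m k t - gauss_fun t) * cos (a * t))).
    by apply: le_normr_Rintegral => //; exact: le_cos.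
  by move=> t _; rewrite mulrBl.
apply: le_Rintegral => //.
- rewrite (_ : EFin \o _ = (fun t => `|((hker m k t - gauss_fun t) * cos (a * t))%:E|%E))//.
  by apply: integrable_abse; exact: le_cos.
- rewrite (_ : EFin \o _ = (fun t => `|(hker m k t - gauss_fun t)%:E|%E))//.
  exact: integrable_abse.
- by move=> t _; rewrite normrM -[leRHS]mulr1 ler_wpM2l// cos_max.
Qed.

End local_limit.

(** * Lindeberg replacement *)

Section exponential_expansions.
Context {R : realType}.
Implicit Types x y z q a b e : R.

(** From expR z (1 - z) <= 1 one gets expR z - 1 - z <= z (expR z - 1). *)
Lemma expR_taylor1 z : `|expR z - 1 - z| <= z ^+ 2 * expR `|z|.
Proof.
have h0 := expR_ge1Dx z.
rewrite ger0_norm; last by lra.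
have h1 := expR_ge1Dx (- z).
have E : expR z * expR (- z) = 1 by rewrite expRxMexpNx_1.
have h2 : expR z * (1 - z) <= 1 by rewrite -[leRHS]E ler_wpM2l ?expR_ge0.
apply: (@le_trans _ _ (z * (expR z - 1))); first by lra.
have [z0|z0] := leP 0 z.
  rewrite ger0_norm// expr2 -mulrA ler_wpM2l//; lra.
rewrite ltr0_norm//.
apply: (@le_trans _ _ (z ^+ 2)).
  have : 0 <= (- z) * (expR z - 1 - z) by rewrite mulr_ge0 //; lra.
  lra.
rewrite ler_peMr ?sqr_ge0//; apply: (le_trans _ (expR_ge1Dx _)); lra.
Qed.

(** The derivative of the second-order remainder is the first-order remainder, bounded by
    [expR_taylor1]. *)
Lemma expR_taylor2 z : `|expR z - 1 - z - z ^+ 2 / 2| <= `|z| ^+ 3 * expR `|z|.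
Proof.
pose f y := expR y - 1 - y - y ^+ 2 / 2.
have df y : is_derive y (1 : R) f (expR y - 1 - y).
  have h : is_derive y 1 (fun y : R => 1 + y + y ^+ 2 / 2) (1 + y).
    by apply: is_derive_eq; rewrite /GRing.scale /=; field.
  have := is_deriveB (is_derive_expR y) h.
  have -> : expR - (fun y : R => 1 + y + y ^+ 2 / 2) = f.
    apply/funext => u; rewrite /f; change (expR u - (1 + u + u ^+ 2 / 2) = expR u - 1 - u - u ^+ 2 / 2); ring.
  by move=> /is_derive_eq; apply; ring.
have := @mvt_le _ f _ 0 z (z ^+ 2 * expR `|z|) df.
have f0 : f 0 = 0 by rewrite /f expR0 expr0n/= mul0r; ring.
rewrite f0 !subr0.
have -> : `|z| ^+ 3 * expR `|z| = z ^+ 2 * expR `|z| * `|z|.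
  by rewrite -(real_normK (num_real z)); ring.
apply=> y hy.
have yz : `|y| <= `|z|.
  move: hy; rewrite ge_min le_max => h.
  by have := ltrgt0P z; case=> [z0|z0|z0]; have := ltrgt0P y; case=> [y0|y0|y0]; move: h; lra.
apply: (le_trans (expR_taylor1 y)).
rewrite ler_pM ?sqr_ge0 ?expR_ge0 ?ler_expR//.
by rewrite -(real_normK (num_real y)) -(real_normK (num_real z)) lerXn2r ?nnegrE.
Qed.

Lemma cube_le_expR x : 0 <= x -> x ^+ 3 <= 6 * expR x.
Proof.
by move=> x0; have := @expR_ge1Dxn _ x 2 x0; rewrite (_ : 3`!%:R = 6)//; lra.
Qed.

Lemma sqr_le_expR x : 0 <= x -> x ^+ 2 <= 2 * expR x.
Proof.
by move=> x0; have := @expR_ge1Dxn _ x 1 x0; rewrite (_ : 2`!%:R = 2)//; lra.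
Qed.

(* The Cauchy-Schwarz bound b^2 <= q a lets the Gaussian factor expR (- q)
   absorb every power of the linear term b. *)
Lemma gauss_shift C : 0 <= C -> exists2 K : R, 0 < K & forall q a b e,
  0 <= q -> 0 <= a <= C -> b ^+ 2 <= q * a -> 0 <= e <= 1 ->
  `|expR (- q) * (expR (- (2 * e * b) - e ^+ 2 * a) -
      (1 - 2 * e * b - e ^+ 2 * a + 2 * e ^+ 2 * b ^+ 2))| <= K * e ^+ 3.
Proof.
move=> C0; exists (6 * expR (6 * C) + 2 * C * expR (3 * C) + C ^+ 2 + 1).
  have := expR_gt0 (6 * C); have := mulr_ge0 C0 (expR_ge0 (3 * C)).
  have := sqr_ge0 C; lra.
move=> q a b e q0 /andP[a0 aC] bqa /andP[e0 e1].
have b2 : 2 * `|b| <= q / 2 + 2 * a.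
  rewrite -(@ler_pXn2r _ 2)// ?nnegrE; try lra.
    have := sqr_ge0 (q / 2 - 2 * a); rewrite exprMn real_normK ?num_real//; lra.
  by rewrite mulr_ge0.
set z := - (2 * e * b) - e ^+ 2 * a.
(* Only half of q appears: 2 Y = q + 6 C, so expR (- q) compensates two factors expR Y, one from the
   Taylor remainder and one from bounding Y^3. *)
pose Y := q / 2 + 3 * C.
have Y0 : 0 <= Y by rewrite /Y; lra.
have ee : e ^+ 2 <= e by rewrite expr2 ler_piMr.
have zY : `|z| <= e * Y.
  apply: (le_trans (ler_normB _ _)).
  rewrite normrN !normrM [`|2|]ger0_norm// !(ger0_norm e0) !(ger0_norm a0).
  have h1 : e * (2 * `|b|) <= e * (q / 2 + 2 * a) by rewrite ler_wpM2l.
  have h2 : e ^+ 2 * a <= e * a by rewrite ler_wpM2r.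
  have h3 : e * a <= e * C by rewrite ler_wpM2l.
  rewrite /Y; lra.
have zY' : `|z| <= Y by rewrite (le_trans zY)// ler_piMl.
(* The part of z^2 / 2 beyond 2 e^2 b^2 is of order e^3 and joins the error. *)
have -> : expR z - (1 - 2 * e * b - e ^+ 2 * a + 2 * e ^+ 2 * b ^+ 2) =
   (expR z - 1 - z - z ^+ 2 / 2) + (2 * e ^+ 3 * (a * b) + e ^+ 4 * a ^+ 2 / 2).
  by rewrite /z; field.
have q1 : expR (- q) <= 1 by rewrite -expR0 ler_expR oppr_le0.
rewrite mulrDr (le_trans (ler_normD _ _))//.
have P1 : `|expR (- q) * (expR z - 1 - z - z ^+ 2 / 2)| <= 6 * expR (6 * C) * e ^+ 3.
  rewrite normrM (ger0_norm (expR_ge0 _)).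
  apply: (@le_trans _ _ (expR (- q) * ((e * Y) ^+ 3 * expR Y))).
    rewrite ler_wpM2l ?expR_ge0// (le_trans (expR_taylor2 z))//.
    rewrite ler_pM ?exprn_ge0 ?expR_ge0 ?ler_expR//.
    by rewrite lerXn2r ?nnegrE ?mulr_ge0.
  have h : Y ^+ 3 * (expR Y * expR (- q)) <= 6 * expR Y * (expR Y * expR (- q)).
    by rewrite ler_wpM2r ?mulr_ge0 ?expR_ge0// cube_le_expR.
  have E : expR Y * (expR Y * expR (- q)) = expR (6 * C).
    by rewrite -!expRD; congr expR; rewrite /Y; field.
  have {}h : Y ^+ 3 * (expR Y * expR (- q)) <= 6 * expR (6 * C) by move: h; rewrite -[leRHS]mulrA E.
  have := ler_wpM2r (exprn_ge0 3 e0) h; rewrite exprMn; lra.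
have P2 : `|expR (- q) * (2 * e ^+ 3 * (a * b) + e ^+ 4 * a ^+ 2 / 2)| <=
    (2 * C * expR (3 * C) + C ^+ 2) * e ^+ 3.
  have e3 : 0 <= e ^+ 3 by exact: exprn_ge0.
  rewrite normrM (ger0_norm (expR_ge0 _)).
  have h1 : `|2 * e ^+ 3 * (a * b) + e ^+ 4 * a ^+ 2 / 2| <= e ^+ 3 * (2 * (a * `|b|) + a ^+ 2).
    apply: (le_trans (ler_normD _ _)).
    rewrite !normrM normfV [`|2|]ger0_norm// !(ger0_norm e0) !(ger0_norm a0).
    have : e ^+ 4 <= e ^+ 3 by rewrite exprSr ler_piMr.
    move=> h; have := ler_wpM2r (sqr_ge0 a) h.
    have := mulr_ge0 (exprn_ge0 4 e0) (sqr_ge0 a).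
    lra.
  apply: (@le_trans _ _ (expR (- q) * (e ^+ 3 * (2 * (a * `|b|) + a ^+ 2)))).
    by rewrite ler_wpM2l ?expR_ge0.
  have ab : a * `|b| <= C * Y.
    by rewrite ler_pM// /Y; lra.
  have aa : a ^+ 2 <= C ^+ 2 by rewrite lerXn2r ?nnegrE.
  have qY : expR (- q) * Y <= expR (3 * C).
    apply: (@le_trans _ _ (expR (- q) * expR Y)).
      by rewrite ler_wpM2l ?expR_ge0// (le_trans _ (expR_ge1Dx _))// lerDr.
    by rewrite -expRD ler_expR /Y; lra.
  rewrite [X in _ <= X]mulrC mulrCA ler_wpM2l//.
  rewrite mulrDr lerD//.
    apply: (@le_trans _ _ (2 * C * (expR (- q) * Y))); last by rewrite ler_wpM2l ?mulr_ge0.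
    have := ler_wpM2l (expR_ge0 (- q)) ab; lra.
  by rewrite (le_trans _ aa)// ler_piMl ?sqr_ge0.
have := exprn_ge0 3 e0; lra.
Qed.

Lemma ln_taylor1 x : 0 <= x -> `|ln (1 + x) - x| <= x ^+ 2.
Proof.
move=> x0; have h1 : ln (1 + x) <= x by apply: le_ln1Dx; lra.
rewrite ler0_norm ?subr_le0// opprB.
have y0 : 0 < 1 + x by lra.
have h2 : x / (1 + x) <= ln (1 + x).
  have h : ln (1 + (- x / (1 + x))) <= - x / (1 + x).
    by apply: le_ln1Dx; rewrite mulNr ltrN2 ltr_pdivrMr//; lra.
  have E : 1 + (- x / (1 + x)) = (1 + x)^-1 by field; rewrite gt_eqF.
  by move: h; rewrite E lnV ?posrE// mulNr lerN2.
have : x - x ^+ 2 <= x / (1 + x).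
  rewrite ler_pdivlMr//; have := exprn_ge0 3 x0; lra.
lra.
Qed.

(* A Gaussian in two orthogonal blocks: [al] and [be] are half the dimensions of
   the blocks, [l1] and [l2] the variances, [U] and [V] the squared norms of the
   projections. *)
Definition heat (al be l1 l2 U V : R) : R := expR (- (al * ln l1 + be * ln l2 + U / l1 + V / l2)).

(** A first-order expansion in time whose error is uniform in U and V. The exponent changes by at
    most X W, with X = B de <= 1 / 2, whereas [heat] itself is at most expR (al + be) expR (- W);
    this decay absorbs expR (W / 2) and the powers of W. *)
Lemma heat_step (al be B : R) : 0 <= al -> 0 <= be -> 0 <= B ->
  exists2 K : R, 0 < K & forall l1 l2 k1 k2 U V de : R,
    1 <= l1 -> 1 <= l2 -> 0 <= k1 <= B -> 0 <= k2 <= B -> 0 <= U -> 0 <= V ->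
    0 <= de -> B * de <= 1 / 2 ->
  `|heat al be (l1 + de * k1) (l2 + de * k2) U V -
    heat al be l1 l2 U V * (1 + de * (k1 / l1 * (U / l1 - al) + k2 / l2 * (V / l2 - be)))|
  <= K * de ^+ 2.
Proof.
move=> al0 be0 B0; exists (9 * B ^+ 2 * expR (al + be) + 1).
  by have := mulr_ge0 (sqr_ge0 B) (expR_ge0 (al + be)); lra.
move=> l1 l2 k1 k2 U V de l11 l21 /andP[k10 k1B] /andP[k20 k2B] U0 V0 de0 Bde.
have l10 : 0 < l1 by lra.
have l20 : 0 < l2 by lra.
pose X := B * de.
have X0 : 0 <= X by rewrite mulr_ge0.
have thP l k : 1 <= l -> 0 <= k <= B -> 0 <= de * k / l <= X.
  move=> hl /andP[hk0 hkB]; apply/andP; split.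
    by rewrite !mulr_ge0// invr_ge0; lra.
  rewrite ler_pdivrMr; last by lra.
  apply: (@le_trans _ _ X); first by rewrite /X mulrC ler_wpM2r.
  by rewrite ler_peMr.
have /andP[t10 t1X] : 0 <= de * k1 / l1 <= X by apply: thP => //; rewrite k10.
have /andP[t20 t2X] : 0 <= de * k2 / l2 <= X by apply: thP => //; rewrite k20.
set th1 := de * k1 / l1 in t10 t1X; set th2 := de * k2 / l2 in t20 t2X.
pose U' := U / l1; pose V' := V / l2.
have U'0 : 0 <= U' by rewrite divr_ge0// ltW.
have V'0 : 0 <= V' by rewrite divr_ge0// ltW.
pose W := al + be + U' + V'.
have W0 : 0 <= W by rewrite /W; lra.
have blk a u th : 0 <= a -> 0 <= u -> 0 <= th <= X ->
    `|(- (a * ln (1 + th)) + u * (th / (1 + th))) - th * (u - a)| <= X ^+ 2 * (a + u) /\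
    `|- (a * ln (1 + th)) + u * (th / (1 + th))| <= X * (a + u).
  move=> a0 u0 /andP[h0 hX].
  have hl := ln_taylor1 h0.
  have h1 : 0 < 1 + th by lra.
  have th2X : th ^+ 2 <= X ^+ 2 by rewrite lerXn2r ?nnegrE.
  have l0 : 0 <= ln (1 + th) by rewrite ln_ge0// lerDl.
  have lth : ln (1 + th) <= th by apply: le_ln1Dx; lra.
  have E : th / (1 + th) - th = - (th ^+ 2 / (1 + th)) by field; rewrite gt_eqF.
  have v0 : 0 <= th / (1 + th) by rewrite divr_ge0// ltW.
  have v1 : th / (1 + th) <= th by rewrite ler_pdivrMr// ler_peMr//; lra.
  split.
    have -> : (- (a * ln (1 + th)) + u * (th / (1 + th))) - th * (u - a) =
       - (a * (ln (1 + th) - th)) + u * (th / (1 + th) - th) by ring.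
    apply: (le_trans (ler_normD _ _)).
    rewrite normrN !normrM (ger0_norm a0) (ger0_norm u0) E normrN.
    have h2 : `|th ^+ 2 / (1 + th)| <= X ^+ 2.
      rewrite ger0_norm ?divr_ge0 ?sqr_ge0 ?(ltW h1)// ler_pdivrMr//.
      by rewrite (le_trans th2X)// ler_peMr ?sqr_ge0// lerDl.
    have := ler_wpM2l a0 (le_trans hl th2X); have := ler_wpM2l u0 h2; lra.
  apply: (le_trans (ler_normD _ _)).
  rewrite normrN (normrM a) (normrM u) (ger0_norm a0) (ger0_norm u0) (ger0_norm l0) (ger0_norm v0).
  by have := ler_wpM2l a0 (le_trans lth hX); have := ler_wpM2l u0 (le_trans v1 hX); lra.
have [A1 A2] := blk al U' th1 al0 U'0 (introT andP (conj t10 t1X)).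
have [B1 B2] := blk be V' th2 be0 V'0 (introT andP (conj t20 t2X)).
set z1 := - (al * ln (1 + th1)) + _ in A1 A2.
set z2 := - (be * ln (1 + th2)) + _ in B1 B2.
pose z := z1 + z2.
have zW : `|z| <= X * W.
  by rewrite (le_trans (ler_normD _ _))// /W; lra.
have lnE l k : 0 < l -> 0 <= de * k / l -> ln (l + de * k) = ln l + ln (1 + de * k / l).
  move=> hl hk; rewrite -lnM ?posrE//; last by lra.
  by congr ln; field; rewrite gt_eqF.
have divE l k u : 0 < l -> 0 <= de * k / l ->
    - (u / (l + de * k)) = - (u / l) + u / l * ((de * k / l) / (1 + de * k / l)).
  move=> hl hk.
  have h : 0 < l + de * k.
    by have -> : l + de * k = l * (1 + de * k / l) by [field; rewrite gt_eqF|]; rewrite mulr_gt0//; lra.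
  have -> : 1 + de * k / l = (l + de * k) / l by field; rewrite gt_eqF.
  by field; rewrite !lt0r_neq0.
have HE : heat al be (l1 + de * k1) (l2 + de * k2) U V = heat al be l1 l2 U V * expR z.
  rewrite /heat -expRD; congr expR.
  rewrite !lnE// /z /z1 /z2 !opprD !divE// -/th1 -/th2 -/U' -/V'; ring.
have -> : de * (k1 / l1 * (U / l1 - al) + k2 / l2 * (V / l2 - be)) =
    th1 * (U' - al) + th2 * (V' - be) by rewrite /th1 /th2 /U' /V'; ring.
rewrite HE -mulrBr normrM (ger0_norm (expR_ge0 _)).
have hub : heat al be l1 l2 U V <= expR (al + be) * expR (- W).
  rewrite -expRD ler_expR /W.
  have h1 : 0 <= al * ln l1 by rewrite mulr_ge0// ln_ge0.
  have h2 : 0 <= be * ln l2 by rewrite mulr_ge0// ln_ge0.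
  rewrite -/U' -/V'; lra.
have key : `|expR z - (1 + (th1 * (U' - al) + th2 * (V' - be)))| <= X ^+ 2 * (W ^+ 2 * expR (W / 2) + W).
  have -> : expR z - (1 + (th1 * (U' - al) + th2 * (V' - be))) =
     (expR z - 1 - z) + ((z1 - th1 * (U' - al)) + (z2 - th2 * (V' - be))) by rewrite /z; ring.
  rewrite (le_trans (ler_normD _ _))// [leRHS]mulrDr lerD//.
    apply: (le_trans (expR_taylor1 z)); rewrite mulrA ler_pM ?sqr_ge0 ?expR_ge0//.
      by rewrite -exprMn -(real_normK (num_real z)) lerXn2r ?nnegrE ?mulr_ge0.
    rewrite ler_expR (le_trans zW)// mulrC ler_wpM2l//; rewrite /X; lra.
  by rewrite (le_trans (ler_normD _ _))// /W; lra.
(* 8 comes from (W / 2)^2 <= 2 expR (W / 2), and 1 from W <= expR W. *)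
have expW : expR (- W) * (W ^+ 2 * expR (W / 2) + W) <= 9.
  have hW2 : 0 <= W / 2 by lra.
  have h1 := sqr_le_expR hW2.
  have h2 : expR (- W) * (expR (W / 2) * expR (W / 2)) = 1.
    by rewrite -!expRD -[RHS]expR0; congr expR; field.
  have h3 : expR (- W) * W <= 1.
    have h : expR (- W) * expR W = 1 by rewrite -expRD -[RHS]expR0; congr expR; ring.
    rewrite -[leRHS]h ler_wpM2l ?expR_ge0//; have := expR_ge1Dx W; lra.
  have h4 : expR (- W) * (W ^+ 2 * expR (W / 2)) <= 8 * (expR (- W) * (expR (W / 2) * expR (W / 2))).
    have := ler_wpM2r (mulr_ge0 (expR_ge0 (- W)) (expR_ge0 (W / 2))) h1.
    rewrite exprMn; lra.
  rewrite mulrDr; move: h4; rewrite h2; lra.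
apply: (@le_trans _ _ ((expR (al + be) * expR (- W)) * (X ^+ 2 * (W ^+ 2 * expR (W / 2) + W)))).
  by rewrite ler_pM ?expR_ge0.
have e0 : 0 <= expR (al + be) * X ^+ 2 by rewrite mulr_ge0 ?expR_ge0 ?sqr_ge0.
have := ler_wpM2l e0 expW.
have := sqr_ge0 de.
have -> : X ^+ 2 = B ^+ 2 * de ^+ 2 by rewrite exprMn.
lra.
Qed.

End exponential_expansions.

Section finite_function_sums.

Definition consf (T : Type) n (t : T) (g : {ffun 'I_n -> T}) : {ffun 'I_n.+1 -> T} :=
  [ffun i => if unlift ord0 i is Some j then g j else t].

Lemma consf0 (T : Type) n (t : T) (g : {ffun 'I_n -> T}) : consf t g ord0 = t.
Proof. by rewrite ffunE unlift_none. Qed.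

Lemma consfS (T : Type) n (t : T) (g : {ffun 'I_n -> T}) (j : 'I_n) : consf t g (lift ord0 j) = g j.
Proof. by rewrite ffunE liftK. Qed.

Lemma sum_ffunS (V : nmodType) (T : finType) n (F : {ffun 'I_n.+1 -> T} -> V) :
  \sum_f F f = \sum_t \sum_(g : {ffun 'I_n -> T}) F (consf t g).
Proof.
rewrite pair_big/= (reindex (fun p : T * {ffun 'I_n -> T} => consf p.1 p.2))//=.
exists (fun f => (f ord0, [ffun i => f (lift ord0 i)])) => [[t g]|f] _ /=.
  by rewrite consf0; congr pair; apply/ffunP => i; rewrite ffunE consfS.
apply/ffunP => i; rewrite ffunE; case: unliftP => [j ->|->]//.
by rewrite ffunE.
Qed.

Lemma sum_ffun0 (V : nmodType) (T : finType) (F : {ffun 'I_0 -> T} -> V) (f0 : {ffun 'I_0 -> T}) :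
  \sum_f F f = F f0.
Proof.
rewrite (bigD1 f0)//= big1 ?addr0// => f /eqP[]; apply/ffunP => -[].
by [].
Qed.

End finite_function_sums.

Section telescoping.
Context {R : realType} (I : Type) (T : finType).
Hypothesis T0 : (0 < #|T|)%N.

Definition mean (F : T -> R) : R := #|T|%:R^-1 * \sum_t F t.

Lemma mean_norm_le (F : T -> R) (e : R) : (forall t, `|F t| <= e) -> `|mean F| <= e.
Proof.
move=> Fe; rewrite /mean normrM ger0_norm ?invr_ge0//.
rewrite ler_pdivrMl ?ltr0n//; apply: (le_trans (ler_norm_sum _ _ _)).
by apply: (le_trans (ler_sum _ (fun t _ => Fe t))); rewrite sumr_const mulr_natl.
Qed.

Lemma meanB (F G : T -> R) : mean (fun t => F t - G t) = mean F - mean G.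
Proof. by rewrite /mean sumrB mulrBr. Qed.

(** Lindeberg's scheme: [H j] is the test function after j ticks of the flow, and one random step is
    traded for one tick at cost e. The starting point y is arbitrary because the induction moves it
    along the first step. *)
Lemma telescoping_walk (w : T -> I -> R) (H : nat -> (I -> R) -> R) (e : R) n :
  (forall j y, (j < n)%N -> `|mean (fun t => H j (y + w t)) - H j.+1 y| <= e) ->
  forall y, `|#|T|%:R ^- n * \sum_(f : {ffun 'I_n -> T}) H 0%N (y + \sum_i w (f i)) - H n y|
     <= n%:R * e.
Proof.
elim: n => [|n IH] He y.
  have /card_gt0P[t _] := T0.
  rewrite (sum_ffun0 _ [ffun=> t]) big_ord0 addr0 expr0 invr1 mul1r subrr normr0 mul0r//.
rewrite sum_ffunS.
set B := H n.+1 y.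
pose D t := #|T|%:R ^- n * \sum_(g : {ffun 'I_n -> T}) H 0%N (y + w t + \sum_i w (g i)).
have -> : #|T|%:R ^- n.+1 * \sum_t \sum_(g : {ffun 'I_n -> T}) H 0%N (y + \sum_i w (consf t g i)) =
    mean D.
  rewrite exprS invfM -mulrA mulr_sumr; congr (_ * _); apply: eq_bigr => t _.
  rewrite /D; congr (_ * _); apply: eq_bigr => g _; congr (H _ _).
  rewrite big_ord_recl consf0 addrA; congr (_ + _); apply: eq_bigr => i _.
  by rewrite consfS.
have -> : mean D - B = mean (fun t => D t - H n (y + w t)) + (mean (fun t => H n (y + w t)) - B).
  by rewrite meanB; ring.
rewrite (le_trans (ler_normD _ _))// -natr1 mulrDl mul1r lerD// ?He//.
apply: mean_norm_le => t; apply: IH => j z jn; apply: He.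
exact: ltnW.
Qed.

End telescoping.

Section cauchy_schwarz.
Context {R : realType}.

(** Cauchy-Schwarz in the form delivered by [q2_shift]. For C > 0 evaluate at the minimum - B / C; C
    < 0 is impossible for large s; C = 0 forces B = 0. *)
Lemma discriminant_le (A B C : R) :
  (forall s, 0 <= A + 2 * s * B + s ^+ 2 * C) -> B ^+ 2 <= A * C.
Proof.
move=> h; have A0 := h 0; rewrite expr0n/= mulr0 !mul0r !addr0 in A0.
have [C0|C0|C0] := ltrgt0P C.
- have := h (- (B / C)).
  have -> : A + 2 * (- (B / C)) * B + (- (B / C)) ^+ 2 * C = (A * C - B ^+ 2) / C.
    by field; rewrite gt_eqF.
  by rewrite pmulr_lge0 ?invr_gt0// subr_ge0.
- exfalso.
  have := h ((`|B| + A + 1) / (- C) + 1); set s := _ + 1.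
  have C0' : 0 < - C by rewrite oppr_gt0.
  have s1 : 1 <= s by rewrite /s lerDr divr_ge0 ?(ltW C0')//; have := normr_ge0 B; lra.
  have h1 := h (- s).
  have : 0 <= 2 * A + 2 * (s ^+ 2 * C) by move: h1; rewrite sqrrN; move: (h s); lra.
  have : s ^+ 2 * C <= s * C by rewrite ler_wnM2r ?(ltW C0)// expr2 ler_peMr//; lra.
  have : s * C = - (`|B| + A + 1) + C by rewrite /s; field; rewrite lt_eqF.
  have := normr_ge0 B; lra.
- have [->|B0] := eqVneq B 0; first by rewrite expr0n/= C0 mulr0.
  have := h (- ((A + 1) / (2 * B))); rewrite C0.
  have -> : A + 2 * (- ((A + 1) / (2 * B))) * B + (- ((A + 1) / (2 * B))) ^+ 2 * 0 = -1 by field.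
  by rewrite oppr_ge0 ler10.
Qed.

End cauchy_schwarz.

(** * Quadratic forms and covariance of one step *)

Section lindeberg.
Context {R : realType}.
Variable d : nat.
Hypothesis d0 : (0 < d)%N.
Local Notation I := 'I_d.
Implicit Types y w : I -> R.

Local Notation dR := (d%:R : R).

(* [perp] and [para] are the squared norms of the components of y orthogonal and
   parallel to (1, ..., 1); [qb] is the bilinear form of [q2]. *)
Definition tot y : R := \sum_a y a.
Definition ctr y a : R := y a - tot y / dR.
Definition qb (l1 l2 : R) y w : R :=
  \sum_a (ctr y a / l1 + tot y / dR / l2) * ctr w a + tot y * tot w / dR / l2.
Definition perp y : R := \sum_a ctr y a ^+ 2.
Definition para y : R := tot y ^+ 2 / dR.
Definition q2 (l1 l2 : R) y : R := perp y / l1 + para y / l2.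

Lemma d_gt0 : 0 < dR. Proof. by rewrite ltr0n. Qed.

Lemma sum_ctr y : \sum_a ctr y a = 0.
Proof.
rewrite /ctr sumrB sumr_const card_ord -[_ *+ d]mulr_natr divfK ?subrr//.
exact: lt0r_neq0 d_gt0.
Qed.

Lemma qbE l1 l2 y w :
  qb l1 l2 y w = (\sum_a ctr y a * ctr w a) / l1 + tot y * tot w / dR / l2.
Proof.
rewrite /qb; congr (_ + _); under eq_bigr do rewrite mulrDl.
rewrite big_split/= -[X in _ + X]mulr_sumr sum_ctr mulr0 addr0 mulr_suml.
by apply: eq_bigr => a _; rewrite mulrAC.
Qed.

Lemma tot_shift y w (e : R) : tot (fun a => y a + e * w a) = tot y + e * tot w.
Proof. by rewrite /tot big_split/= mulr_sumr. Qed.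

Lemma ctr_shift y w (e : R) a : ctr (fun a => y a + e * w a) a = ctr y a + e * ctr w a.
Proof. by rewrite /ctr tot_shift; ring. Qed.

Lemma q2_shift l1 l2 y w (e : R) : q2 l1 l2 (fun a => y a + e * w a) =
  q2 l1 l2 y + 2 * e * qb l1 l2 y w + e ^+ 2 * q2 l1 l2 w.
Proof.
rewrite qbE /q2 /para tot_shift /perp.
have -> : \sum_a ctr (fun a => y a + e * w a) a ^+ 2 =
    \sum_a ctr y a ^+ 2 + 2 * e * \sum_a ctr y a * ctr w a + e ^+ 2 * \sum_a ctr w a ^+ 2.
  rewrite !mulr_sumr -!big_split/=; apply: eq_bigr => a _.
  by rewrite ctr_shift; ring.
by ring.
Qed.

Lemma q2_ge0 l1 l2 y : 0 < l1 -> 0 < l2 -> 0 <= q2 l1 l2 y.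
Proof.
move=> l10 l20; apply: addr_ge0; rewrite divr_ge0 ?(ltW l10) ?(ltW l20)//.
  by apply: sumr_ge0 => a _; exact: sqr_ge0.
by rewrite divr_ge0 ?sqr_ge0.
Qed.

Lemma qb_le l1 l2 y w : 0 < l1 -> 0 < l2 ->
  qb l1 l2 y w ^+ 2 <= q2 l1 l2 y * q2 l1 l2 w.
Proof.
by move=> l10 l20; apply: discriminant_le => s; rewrite -q2_shift q2_ge0.
Qed.

Variable m : nat.
Hypothesis m0 : (0 < m)%N.

(** [pm] and [r2] are the first and second moments of X / m, for X uniform on {1, ..., m}. *)
Definition pm : R := mid m / m%:R.
Definition r2 : R := cM R m.
Local Notation nuR := (d.+1%:R : R).

(* The contribution to M^-1 (S - n_a (M+1)/2), a = 1, ..., d, of an index with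
   colour [t.1] and value [t.2 + 1]. *)
Definition wstep (t : 'I_d.+1 * 'I_m) : I -> R := fun a =>
  if t.1 == ord0 then t.2.+1%:R / m%:R else - (pm * (t.1 == lift ord0 a)%:R).

Lemma mean_pair (F : 'I_d.+1 * 'I_m -> R) :
  mean F = nuR^-1 * (m%:R^-1 * \sum_(x < m) F (ord0, x)) +
    nuR^-1 * \sum_(a < d) m%:R^-1 * \sum_(x < m) F (lift ord0 a, x).
Proof.
rewrite /mean card_prod !card_ord natrM invfM -mulrA -mulrDr; congr (_ * _).
rewrite -mulr_sumr -mulrDr; congr (_ * _).
rewrite (eq_bigr (fun p => F (p.1, p.2))); last by case.
by rewrite -(pair_bigA _ (fun b x => F (b, x)))/= big_ord_recl.
Qed.

Lemma mean_uniform1 : m%:R^-1 * \sum_(x < m) (x.+1%:R / m%:R) = pm.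
Proof.
have h k : \sum_(x < k) x.+1%:R = k%:R * (k%:R + 1) / 2 :> R.
  by elim: k => [|k IH]; [rewrite big_ord0; field|rewrite big_ord_recr/= IH -natr1; field].
rewrite -mulr_suml h /pm /mid -natr1; field.
by rewrite lt0r_neq0// ltr0n.
Qed.

Lemma mean_uniform2 : m%:R^-1 * \sum_(x < m) (x.+1%:R / m%:R) ^+ 2 = r2.
Proof.
under eq_bigr do rewrite expr_div_n.
rewrite -mulr_suml /r2 /cM big_add1/= big_mkord.
by rewrite mulrA mulrC.
Qed.

Lemma mean_cst (C : R) : m%:R^-1 * \sum_(x < m) C = C.
Proof.
rewrite sumr_const card_ord -[C *+ m]mulr_natl mulKf//.
by rewrite lt0r_neq0// ltr0n.
Qed.

Lemma tot_step0 x : tot (wstep (ord0, x)) = dR * (x.+1%:R / m%:R).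
Proof. by rewrite /tot /wstep /= sumr_const card_ord -(mulr_natl (x.+1%:R / m%:R) d). Qed.

Lemma ctr_step0 x a : ctr (wstep (ord0, x)) a = 0.
Proof.
rewrite /ctr tot_step0 /wstep/= [dR * _]mulrC mulfK ?subrr//.
exact: lt0r_neq0 d_gt0.
Qed.

Lemma wstepS b x a : wstep (lift ord0 b, x) a = - (pm * (b == a)%:R).
Proof. by rewrite /wstep /= (inj_eq lift_inj). Qed.

Lemma tot_stepS b x : tot (wstep (lift ord0 b, x)) = - pm.
Proof.
rewrite /tot; under eq_bigr do rewrite wstepS.
rewrite (bigD1 b)//= eqxx mulr1 big1 ?addr0// => a /negbTE ab.
by rewrite eq_sym ab mulr0 oppr0.
Qed.

Lemma ctr_stepS b x a : ctr (wstep (lift ord0 b, x)) a = - pm * ((b == a)%:R - dR^-1).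
Proof. by rewrite /ctr tot_stepS wstepS; ring. Qed.

Lemma qb_step0 l1 l2 y x : qb l1 l2 y (wstep (ord0, x)) = tot y / l2 * (x.+1%:R / m%:R).
Proof.
rewrite qbE tot_step0 big1 => [|a _]; last by rewrite ctr_step0 mulr0.
have := lt0r_neq0 d_gt0; set z := x.+1%:R / m%:R => h.
rewrite mul0r add0r; set D := dR in h *; have -> : tot y * (D * z) / D = tot y * z by field.
by rewrite mulrAC.
Qed.

Lemma qb_stepS l1 l2 y b x :
  qb l1 l2 y (wstep (lift ord0 b, x)) = - pm * (ctr y b / l1 + tot y / dR / l2).
Proof.
rewrite qbE tot_stepS.
have -> : \sum_a ctr y a * ctr (wstep (lift ord0 b, x)) a = - pm * ctr y b.
  under eq_bigr do rewrite ctr_stepS mulrCA.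
  rewrite -mulr_sumr; congr (_ * _).
  under eq_bigr do rewrite mulrBr.
  rewrite sumrB -mulr_suml sum_ctr mul0r subr0 (bigD1 b)//= eqxx mulr1 big1 ?addr0//.
  by move=> a /negbTE; rewrite eq_sym => ->; rewrite mulr0.
by ring.
Qed.

Lemma q2_step0 l1 l2 x : q2 l1 l2 (wstep (ord0, x)) = dR / l2 * (x.+1%:R / m%:R) ^+ 2.
Proof.
rewrite /q2 /perp /para tot_step0 big1 => [|a _]; last by rewrite ctr_step0 expr0n.
have := lt0r_neq0 d_gt0; set z := x.+1%:R / m%:R => h.
rewrite mul0r add0r; set D := dR in h *; have -> : (D * z) ^+ 2 / D = D * z ^+ 2 by field.
by rewrite mulrAC.
Qed.

Lemma q2_stepS l1 l2 b x :
  q2 l1 l2 (wstep (lift ord0 b, x)) = pm ^+ 2 * ((1 - dR^-1) / l1 + dR^-1 / l2).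
Proof.
rewrite /q2 /para tot_stepS /perp.
have -> : \sum_a ctr (wstep (lift ord0 b, x)) a ^+ 2 = pm ^+ 2 * (1 - dR^-1).
  under eq_bigr do rewrite ctr_stepS exprMn sqrrN.
  rewrite -mulr_sumr; congr (_ * _).
  have -> : \sum_a ((b == a)%:R - dR^-1) ^+ 2 = \sum_(a < d) ((1 - 2 * dR^-1) * (b == a)%:R + dR^-1 ^+ 2) :> R.
    by apply: eq_bigr => a _; case: (b == a) => /=; rewrite ?mulr1n ?mulr0n; ring.
  rewrite big_split/= -mulr_sumr sumr_const card_ord (bigD1 b)//= eqxx big1 ?addr0.
    rewrite -(mulr_natl (d%:R^-1 ^+ 2) d) /= mulr1n; field; exact: lt0r_neq0 d_gt0.
  by move=> a /negbTE; rewrite eq_sym => ->.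
by rewrite sqrrN; ring.
Qed.

(** The step is centred: colour 0 contributes [pm] times tot y / l2, and the other d colours
    together cancel exactly that, the [ctr] parts summing to 0. *)
Lemma mean_qb l1 l2 y : mean (fun t => qb l1 l2 y (wstep t)) = 0.
Proof.
rewrite mean_pair -mulrDr.
under eq_bigr do rewrite qb_step0.
rewrite -mulr_sumr mulrCA mean_uniform1.
under eq_bigr do (under eq_bigr do rewrite qb_stepS; rewrite mean_cst).
rewrite -mulr_sumr big_split/= -mulr_suml sum_ctr mul0r add0r sumr_const card_ord.
rewrite -[_ *+ d]mulr_natl; apply/eqP; rewrite mulf_eq0; apply/orP; right; apply/eqP.
have := lt0r_neq0 d_gt0; set D := dR => h.
have -> : D * (tot y / D / l2) = tot y / l2.
  by rewrite !mulrA [D * _]mulrC mulfK.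
by ring.
Qed.

Lemma mean_q2 l1 l2 : mean (fun t => q2 l1 l2 (wstep t)) =
  nuR^-1 * ((dR * r2 + pm ^+ 2) / l2 + pm ^+ 2 * (dR - 1) / l1).
Proof.
rewrite mean_pair -mulrDr; congr (_ * _).
under eq_bigr do rewrite q2_step0.
rewrite -mulr_sumr mulrCA mean_uniform2.
under eq_bigr do (under eq_bigr do rewrite q2_stepS; rewrite mean_cst).
rewrite sumr_const card_ord -(mulr_natl (pm ^+ 2 * _) d).
have := lt0r_neq0 d_gt0; set D := dR => h.
have -> : D * (pm ^+ 2 * ((1 - D^-1) / l1 + D^-1 / l2)) = pm ^+ 2 * (D - 1) / l1 + pm ^+ 2 / l2.
  rewrite mulrCA mulrDr [D * (_ / l1)]mulrA mulrBr mulr1 divff//.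
  by rewrite [D * (_ / l2)]mulrA divff//; ring.
by ring.
Qed.

(** The covariance of the step is diagonal in the splitting into [perp] and [para]. Its eigenvalues
    times 12 nu are the growth rates of [lam1] and [lam2]. *)
Lemma mean_qb2 l1 l2 y : mean (fun t => qb l1 l2 y (wstep t) ^+ 2) =
  nuR^-1 * ((dR * r2 + pm ^+ 2) / l2 * (para y / l2) + pm ^+ 2 / l1 * (perp y / l1)).
Proof.
rewrite mean_pair -mulrDr; congr (_ * _).
under eq_bigr do rewrite qb_step0 exprMn.
rewrite -mulr_sumr mulrCA mean_uniform2.
under eq_bigr do (under eq_bigr do rewrite qb_stepS exprMn sqrrN; rewrite mean_cst).
rewrite -mulr_sumr.
have := lt0r_neq0 d_gt0; set D := dR => h.
have -> : \sum_(a < d) (ctr y a / l1 + tot y / D / l2) ^+ 2 =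
   perp y / l1 ^+ 2 + tot y ^+ 2 / D / l2 ^+ 2.
  have -> : \sum_(a < d) (ctr y a / l1 + tot y / D / l2) ^+ 2 =
    \sum_(a < d) (ctr y a ^+ 2 / l1 ^+ 2 + 2 * (tot y / D / l2 / l1) * ctr y a + (tot y / D / l2) ^+ 2).
    by apply: eq_bigr => a _; rewrite -!exprVn; ring.
  rewrite !big_split/= -mulr_suml -mulr_sumr sum_ctr mulr0 addr0 sumr_const card_ord.
  congr (_ + _); rewrite -[_ *+ d]mulr_natl -/D -!exprVn !exprMn.
  have -> : D * (tot y ^+ 2 * D^-1 ^+ 2 * l2^-1 ^+ 2) = tot y ^+ 2 * (D * D^-1) * D^-1 * l2^-1 ^+ 2 by ring.
  by rewrite divff// mulr1.
rewrite /para -/D -!exprVn exprMn.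
have E : D * D^-1 = 1 by rewrite divff.
have -> : (tot y) ^+ 2 * l2^-1 ^+ 2 * r2 = D * D^-1 * ((tot y) ^+ 2 * l2^-1 ^+ 2 * r2) by rewrite E mul1r.
by ring.
Qed.

Lemma mean_lin (X p1 p2 p3 : R) (b a bb : 'I_d.+1 * 'I_m -> R) :
  mean (fun t => X * (1 - p1 * b t - p2 * a t + p3 * bb t)) =
  X * (1 - p1 * mean b - p2 * mean a + p3 * mean bb).
Proof.
rewrite /mean; set N := (#|_|)%:R.
have N0 : N != 0 by rewrite pnatr_eq0 card_prod !card_ord muln_eq0 negb_or /= -lt0n m0.
rewrite -mulr_sumr big_split/= !sumrB -!mulr_sumr.
have -> : \sum_(i : 'I_d.+1 * 'I_m) (1 : R) = N by rewrite sumr_const.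
by field.
Qed.

Lemma pm_bounds : 0 <= pm <= 1.
Proof.
have M1 : 1 <= m%:R :> R by rewrite ler1n.
rewrite /pm /mid -natr1; apply/andP; split.
  by rewrite !divr_ge0// addr_ge0.
by rewrite ler_pdivrMr; lra.
Qed.

Lemma r2_bounds : 0 <= r2 <= 1.
Proof.
rewrite -mean_uniform2; have M0 : 0 < m%:R :> R by rewrite ltr0n.
have h (x : 'I_m) : 0 <= (x.+1%:R / m%:R : R) <= 1.
  by rewrite divr_ge0//= ler_pdivrMr// mul1r ler_nat.
apply/andP; split.
  by rewrite mulr_ge0 ?invr_ge0 ?(ltW M0)// sumr_ge0// => x _; exact: sqr_ge0.
rewrite ler_pdivrMl// mulr1 -[X in _ <= X%:R]card_ord -sumr_const.
by apply: ler_sum => x _; have /andP[? ?] := h x; rewrite exprn_ile1.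
Qed.

(* hk tau y is the expectation of expR (- 6 nu |y + sqrt tau G|^2), where G is a
   centred Gaussian vector with the covariance of [wstep]: that covariance is
   (d r2 + pm^2) / nu along (1, ..., 1) and pm^2 / nu on its complement. *)
Definition lam1 (tau : R) : R := 1 + tau * (12 * pm ^+ 2).
Definition lam2 (tau : R) : R := 1 + tau * (12 * (dR * r2 + pm ^+ 2)).

Definition hk (tau : R) y : R :=
  heat ((dR - 1) / 2) (1 / 2) (lam1 tau) (lam2 tau) (6 * nuR * perp y) (6 * nuR * para y).

Lemma hkE tau y : hk tau y =
  expR (- ((dR - 1) / 2 * ln (lam1 tau) + 1 / 2 * ln (lam2 tau))) *
  expR (- (6 * nuR * q2 (lam1 tau) (lam2 tau) y)).
Proof. by rewrite /hk /heat -expRD /q2; congr expR; ring. Qed.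

End lindeberg.

(** * Comparison of the walk with the heat flow *)

Section lindeberg_limit.
Context {R : realType}.
Variable d : nat.
Hypothesis d0 : (0 < d)%N.
Local Notation nuR := (d.+1%:R : R).
Local Notation dR := (d%:R : R).

(** A random step (by [gauss_shift]) and a tick of length e^2 (by [heat_step]) have the same
    expansion up to second order in e, because mean and covariance agree; the discrepancy is O(e^3),
    uniformly in m, the time and the point. *)
Lemma lindeberg_step : exists2 K : R, 0 < K & forall m (e tau : R) (y : 'I_d -> R),
  (0 < m)%N -> 0 <= e <= 1 -> 0 <= tau -> 12 * nuR * e ^+ 2 <= 1 / 2 ->
  `|mean (fun t => hk m tau (fun a => y a + e * @wstep R d m t a)) - hk m (tau + e ^+ 2) y|
  <= K * e ^+ 3.
Proof.
have D1 : 1 <= dR by rewrite ler1n.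
have nuE : nuR = dR + 1 by rewrite -natr1.
(* d + 2 bounds [q2] of a single step when both variances are at least 1, see [q2w]. *)
have C0 : 0 <= 6 * nuR * (dR + 2) by rewrite !mulr_ge0//; lra.
have [K1 K10 H1] := @gauss_shift R _ C0.
have al0 : 0 <= (dR - 1) / 2 by lra.
have be0 : 0 <= 1 / 2 :> R by lra.
(* 12 nu dominates both growth rates, since [pm] and [r2] lie in [0, 1]. *)
have B0 : 0 <= 12 * nuR by rewrite nuE; lra.
have [K2 K20 H2] := heat_step al0 be0 B0.
exists (K1 + K2); first by rewrite addr_gt0.
move=> m e tau y m0 /andP[e0 e1] tau0 Be.
have /andP[p0 p1] : 0 <= (pm m : R) <= 1 by apply: pm_bounds.
have /andP[r0 r1] : 0 <= (r2 m : R) <= 1 by apply: r2_bounds.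
set p := pm m in p0 p1; set r := r2 m in r0 r1.
have pp0 : 0 <= p ^+ 2 by exact: sqr_ge0.
have pp1 : p ^+ 2 <= 1 by rewrite exprn_ile1.
have dr0 : 0 <= dR * r by rewrite mulr_ge0.
have dr1 : dR * r <= dR by rewrite ler_piMr.
have l11 : 1 <= lam1 m tau by rewrite /lam1 lerDl mulr_ge0// mulr_ge0.
have l21 : 1 <= lam2 d m tau by rewrite /lam2 lerDl mulr_ge0// mulr_ge0// addr_ge0.
set l1 := lam1 m tau in l11 *; set l2 := lam2 d m tau in l21 *.
have l10 : 0 < l1 by lra.
have l20 : 0 < l2 by lra.
have cn0 : 0 <= 6 * nuR by rewrite nuE; lra.
have dV0 : 0 <= dR^-1 by rewrite invr_ge0; lra.
have dV1 : dR^-1 <= 1 by rewrite invf_le1//; lra.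
have l1V : l1^-1 <= 1 by rewrite invf_le1.
have l2V : l2^-1 <= 1 by rewrite invf_le1.
have l1V0 : 0 <= l1^-1 by rewrite invr_ge0 ltW.
have l2V0 : 0 <= l2^-1 by rewrite invr_ge0 ltW.
pose A := expR (- ((dR - 1) / 2 * ln l1 + 1 / 2 * ln l2)).
have A0 : 0 <= A by exact: expR_ge0.
have A1 : A <= 1.
  rewrite -[leRHS]expR0 ler_expR oppr_le0 addr_ge0// mulr_ge0// ln_ge0//; lra.
pose q := 6 * nuR * q2 l1 l2 y.
pose a t := 6 * nuR * q2 l1 l2 (@wstep R d m t).
pose b t := 6 * nuR * qb l1 l2 y (@wstep R d m t).
have q0 : 0 <= q by rewrite mulr_ge0// q2_ge0.
have q2w t : q2 l1 l2 (@wstep R d m t) <= dR + 2.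
  case: t => c x; case: (unliftP ord0 c) => [c' ->|->].
    rewrite q2_stepS// -/p.
    have h1 : (1 - dR^-1) / l1 <= 1 by rewrite mulr_ile1//; lra.
    have h2 : dR^-1 / l2 <= 1 by rewrite mulr_ile1.
    apply: (@le_trans _ _ 2); last by lra.
    apply: (@le_trans _ _ (1 * 2)); last by lra.
    rewrite ler_pM//; last by lra.
    rewrite addr_ge0// mulr_ge0//; lra.
  rewrite q2_step0//.
  have M0 : 0 < m%:R :> R by rewrite ltr0n.
  have x1 : x.+1%:R / m%:R <= 1 :> R by rewrite ler_pdivrMr// mul1r ler_nat.
  apply: (@le_trans _ _ (dR * 1 * 1)); last by lra.
  rewrite ler_pM ?mulr_ge0 ?sqr_ge0//; first by rewrite ler_wpM2l.
  by rewrite exprn_ile1// divr_ge0// ltW.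
have aC t : 0 <= a t <= 6 * nuR * (dR + 2).
  by rewrite mulr_ge0 ?q2_ge0//= ler_wpM2l.
have bqa t : b t ^+ 2 <= q * a t.
  rewrite /b /q /a exprMn.
  have -> : 6 * nuR * q2 l1 l2 y * (6 * nuR * q2 l1 l2 (wstep t)) =
    (6 * nuR) ^+ 2 * (q2 l1 l2 y * q2 l1 l2 (wstep t)) by ring.
  by rewrite ler_wpM2l ?sqr_ge0// qb_le.
pose G t := A * expR (- q) * (1 - 2 * e * b t - e ^+ 2 * a t + 2 * e ^+ 2 * b t ^+ 2).
have HG t : `|hk m tau (fun c => y c + e * @wstep R d m t c) - G t| <= K1 * e ^+ 3.
  have -> : hk m tau (fun c => y c + e * @wstep R d m t c) =
      A * (expR (- q) * expR (- (2 * e * b t) - e ^+ 2 * a t)).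
    rewrite hkE -/l1 -/l2 -/A q2_shift// -expRD; congr (_ * expR _).
    by rewrite /q /a /b; ring.
  have -> : G t = A * (expR (- q) * (1 - 2 * e * b t - e ^+ 2 * a t + 2 * e ^+ 2 * b t ^+ 2)).
    by rewrite /G -mulrA.
  rewrite -!mulrBr normrM (ger0_norm A0).
  have := H1 q (a t) (b t) e q0 (aC t) (bqa t) (introT andP (conj e0 e1)).
  by move=> h; apply: le_trans h; rewrite ler_piMl.
have T0 : (0 < #|{: 'I_d.+1 * 'I_m}|)%N by rewrite card_prod !card_ord muln_gt0.
(* The linear term averages to 0, and the second-order terms regroup into the time derivative
   appearing in [heat_step]. *)
have mG : mean G = hk m tau y * (1 + e ^+ 2 *
   (12 * p ^+ 2 / l1 * (6 * nuR * perp y / l1 - (dR - 1) / 2) +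
    12 * (dR * r + p ^+ 2) / l2 * (6 * nuR * para y / l2 - 1 / 2))).
  rewrite /G (mean_lin m0 (A * expR (- q)) (2 * e) (e ^+ 2) (2 * e ^+ 2) b a (fun t => b t ^+ 2)).
  have -> : mean b = 0.
    transitivity (6 * nuR * mean (fun t => qb l1 l2 y (@wstep R d m t))).
      by rewrite /mean /b -mulr_sumr mulrCA.
    by rewrite mean_qb// mulr0.
  have -> : mean a = 6 * ((dR * r + p ^+ 2) / l2 + p ^+ 2 * (dR - 1) / l1).
    transitivity (6 * nuR * mean (fun t => q2 l1 l2 (@wstep R d m t))).
      by rewrite /mean /a -mulr_sumr mulrCA.
    by rewrite mean_q2// -mulrA mulVKf// pnatr_eq0.
  have -> : mean (fun t => b t ^+ 2) =
      6 * (6 * nuR) * ((dR * r + p ^+ 2) / l2 * (para y / l2) + p ^+ 2 / l1 * (perp y / l1)).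
    transitivity ((6 * nuR) ^+ 2 * mean (fun t => qb l1 l2 y (@wstep R d m t) ^+ 2)).
      rewrite /mean /b [RHS]mulrCA [in RHS]mulr_sumr; congr (_ * _).
      by apply: eq_bigr => t _; rewrite exprMn.
    rewrite mean_qb2//.
    have N0 : nuR != 0 by rewrite pnatr_eq0.
    have E : nuR * nuR^-1 = 1 by rewrite divff.
    rewrite -/r -/p; set X := (dR * r + _) / _ * _ + _.
    have -> : (6 * nuR) ^+ 2 * (nuR^-1 * X) = 6 * (6 * nuR) * (nuR * nuR^-1 * X) by ring.
    by rewrite E mul1r.
  rewrite hkE -/l1 -/l2 -/A -/q mulr0 subr0; congr (_ * _).
  by field; rewrite !lt0r_neq0.
have -> : mean (fun t => hk m tau (fun c => y c + e * @wstep R d m t c)) - hk m (tau + e ^+ 2) y =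
   mean (fun t => hk m tau (fun c => y c + e * @wstep R d m t c) - G t) -
   (hk m (tau + e ^+ 2) y - mean G).
  by rewrite meanB [in RHS]opprB [RHS]addrA subrK.
rewrite (le_trans (ler_normB _ _))// mulrDl lerD//.
  exact: mean_norm_le.
apply: (@le_trans _ _ (K2 * (e ^+ 2) ^+ 2)); last first.
  have -> : (e ^+ 2) ^+ 2 = e ^+ 3 * e by ring.
  by rewrite ler_wpM2l ?(ltW K20)// ler_piMr// exprn_ge0.
have k1P : 0 <= 12 * p ^+ 2 <= 12 * nuR by rewrite nuE; apply/andP; split; lra.
have k2P : 0 <= 12 * (dR * r + p ^+ 2) <= 12 * nuR by rewrite nuE; apply/andP; split; lra.
have U0 : 0 <= 6 * nuR * perp y.
  by rewrite mulr_ge0// sumr_ge0// => ? _; exact: sqr_ge0.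
have V0 : 0 <= 6 * nuR * para y.
  by rewrite mulr_ge0// divr_ge0 ?sqr_ge0.
have := H2 l1 l2 _ _ _ _ (e ^+ 2) l11 l21 k1P k2P U0 V0 (sqr_ge0 e) Be.
rewrite mG /hk -/l1 -/l2.
have -> : lam1 m (tau + e ^+ 2) = l1 + e ^+ 2 * (12 * p ^+ 2) by rewrite /l1 /lam1 -/p; ring.
have -> : lam2 d m (tau + e ^+ 2) = l2 + e ^+ 2 * (12 * (dR * r + p ^+ 2)).
  by rewrite /l2 /lam2 -/p -/r; ring.
by [].
Qed.

Lemma perpDpara (y : 'I_d -> R) : perp y + para y = \sum_a y a ^+ 2.
Proof.
have D0 : dR != 0 by rewrite pnatr_eq0 -lt0n.
rewrite /perp /para.
have -> : \sum_a ctr y a ^+ 2 = \sum_a (y a ^+ 2 - 2 * (tot y / dR) * y a + (tot y / dR) ^+ 2).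
  by apply: eq_bigr => a _; rewrite /ctr; ring.
rewrite big_split/= sumrB -mulr_sumr -/(tot y) sumr_const card_ord.
by rewrite -(mulr_natl ((tot y / dR) ^+ 2) d); field.
Qed.

Definition walk_avg m n : R := #|{: 'I_d.+1 * 'I_m}|%:R ^- n *
  \sum_(f : {ffun 'I_n -> 'I_d.+1 * 'I_m})
     expR (- (6 * nuR * \sum_a ((\sum_i wstep (f i) a) / Num.sqrt n%:R) ^+ 2)).

(** With e = n^(-1/2) the flow runs from time 0, where [hk] is the test function, to time 1, and the
    n errors K e^3 add up to K / sqrt n. The bound on n is the condition 12 nu e^2 <= 1 / 2 of a
    single step. *)
Lemma lindeberg_walk : exists2 K : R, 0 < K & forall m n, (0 < m)%N -> (24 * d.+1 <= n)%N ->
  `|walk_avg m n - hk m 1 (0 : 'I_d -> R)| <= K / Num.sqrt n%:R.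
Proof.
have [K K0 hK] := lindeberg_step; exists K => // m n m0 hn.
have n0 : (0 < n)%N by rewrite (leq_trans _ hn).
have N0 : 0 < n%:R :> R by rewrite ltr0n.
pose e : R := (Num.sqrt n%:R)^-1.
have e0 : 0 < e by rewrite invr_gt0 sqrtr_gt0.
have e2 : e ^+ 2 = n%:R^-1 by rewrite exprVn sqr_sqrtr// ltW.
have e1 : e <= 1.
  rewrite -(@expr_le1 _ 2)// ?(ltW e0)// e2 invf_le1// ler1n//.
have Be : 12 * nuR * e ^+ 2 <= 1 / 2.
  rewrite e2 ler_pdivrMr// mulrAC -mulrA.
  have : (24 * d.+1)%:R <= n%:R :> R by rewrite ler_nat.
  rewrite natrM; lra.
have T0 : (0 < #|{: 'I_d.+1 * 'I_m}|)%N by rewrite card_prod !card_ord muln_gt0.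
pose w (t : 'I_d.+1 * 'I_m) (a : 'I_d) : R := e * wstep t a.
pose H (j : nat) (y : 'I_d -> R) := hk m (j%:R * e ^+ 2) y.
have step j y : (j < n)%N -> `|mean (fun t => H j (y + w t)) - H j.+1 y| <= K * e ^+ 3.
  move=> jn; have := hK m e (j%:R * e ^+ 2) y m0.
  rewrite (ltW e0) e1 => /(_ isT)/(_ _ Be).
  have -> : j%:R * e ^+ 2 + e ^+ 2 = j.+1%:R * e ^+ 2 by rewrite -natr1 mulrDl mul1r.
  by apply; rewrite mulr_ge0 ?sqr_ge0.
have := telescoping_walk T0 step 0.
have -> : n%:R * (K * e ^+ 3) = K / Num.sqrt n%:R.
  have -> : n%:R * (K * e ^+ 3) = K * e * (n%:R * e ^+ 2) by ring.
  by rewrite e2 divff ?mulr1// gt_eqF.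
have E1 : n%:R * e ^+ 2 = 1 by rewrite e2 divff// gt_eqF.
have -> : H n (0 : 'I_d -> R) = hk m 1 (0 : 'I_d -> R) by rewrite /H /= E1.
have -> // : #|{: 'I_d.+1 * 'I_m}|%:R ^- n *
   \sum_(f : {ffun 'I_n -> 'I_d.+1 * 'I_m}) H 0%N (0 + \sum_i w (f i)) = walk_avg m n.
rewrite /walk_avg; congr (_ * _); apply: eq_bigr => f _.
rewrite add0r /H mul0r hkE /lam1 /lam2 !mul0r addr0 ln1 !mulr0 addr0 oppr0 expR0 mul1r.
rewrite /q2 !divr1 perpDpara; congr (expR (- (_ * _))).
apply: eq_bigr => a _; rewrite fct_sumE; congr (_ ^+ 2).
by rewrite /w -mulr_sumr mulrC.
Qed.

Lemma cME (m : nat) : (0 < m)%N -> cM R m = 1 / 3 + 1 / 2 * m%:R^-1 + 1 / 6 * m%:R^-1 ^+ 2.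
Proof.
move=> m0; have M0 : m%:R != 0 :> R by rewrite pnatr_eq0 -lt0n.
have h k : \sum_(1 <= i < k.+1) i%:R ^+ 2 = k%:R * (k%:R + 1) * (2 * k%:R + 1) / 6 :> R.
  elim: k => [|k IH]; first by rewrite big_geq//; field.
  by rewrite big_nat_recr//= IH -natr1; field.
by rewrite /cM h; field.
Qed.

Lemma cvg_natrV : (m%:R^-1 : R) @[m --> \oo] --> (0 : R).
Proof. by rewrite -(@cvg_shiftS _ (fun m => m%:R^-1 : R)); exact: cvg_harmonic. Qed.

(** [pm] tends to 1 / 2 and [r2] to 1 / 3, so at time 1 the variances tend to 1 + 12 / 4 = 4 and 1 +
    12 (d / 3 + 1 / 4) = 4 nu. *)
Lemma cvg_hk : hk m 1 (0 : 'I_d -> R) @[m --> \oo] -->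
  expR (- ((dR - 1) / 2 * ln 4 + 1 / 2 * ln (4 * nuR))).
Proof.
have iV := cvg_natrV.
have cp : pm m @[m --> \oo] --> (1 / 2 : R).
  have c1 : (1 / 2 + 1 / 2 * m%:R^-1 : R) @[m --> \oo] --> (1 / 2 + 1 / 2 * 0 : R).
    by apply: cvgD; [exact: cvg_cst|exact: cvgMl_tmp].
  rewrite mulr0 addr0 in c1; apply: cvg_trans c1; apply: near_eq_cvg; near=> m.
  have M0 : m%:R != 0 :> R by rewrite pnatr_eq0 -lt0n; near: m; exact: nbhs_infty_gt.
  by rewrite /pm /mid -natr1; field.
have cp2 : pm m ^+ 2 @[m --> \oo] --> (1 / 4 : R).
  rewrite (_ : (1 / 4 : R) = (1 / 2) ^+ 2); last by field.
  by rewrite expr2; apply: cvgM.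
have cr : r2 m @[m --> \oo] --> (1 / 3 : R).
  have c1 : (1 / 3 + 1 / 2 * m%:R^-1 + 1 / 6 * m%:R^-1 ^+ 2 : R) @[m --> \oo] -->
      (1 / 3 + 1 / 2 * 0 + 1 / 6 * (0 ^+ 2) : R).
    apply: cvgD; first by apply: cvgD; [exact: cvg_cst|exact: cvgMl_tmp].
    by apply: cvgMl_tmp; rewrite expr2; apply: cvgM.
  rewrite expr0n/= !mulr0 !addr0 in c1; apply: cvg_trans c1; apply: near_eq_cvg; near=> m.
  by rewrite /r2 cME//; near: m; exact: nbhs_infty_gt.
have hkz m : hk m 1 (0 : 'I_d -> R) = expR (- ((dR - 1) / 2 * ln (lam1 m 1) + 1 / 2 * ln (lam2 d m 1))).
  rewrite hkE; set q := q2 _ _ _; have -> : q = 0; last by rewrite mulr0 oppr0 expR0 mulr1.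
  have t0 : tot (0 : 'I_d -> R) = 0 by rewrite /tot big1.
  rewrite /q /q2 /para t0 expr0n/= !mul0r addr0 /perp big1 ?mul0r// => a _.
  by rewrite /ctr t0 mul0r subr0 expr0n.
under eq_fun do rewrite hkz.
apply: continuous_cvg; first exact: continuous_expR.
apply: cvgN; apply: cvgD; apply: cvgMl_tmp; apply: continuous_cvg.
- exact: continuous_ln.
- rewrite /lam1 (_ : 4 = 1 + 1 * (12 * (1 / 4)) :> R); last by field.
  by apply: cvgD; [exact: cvg_cst|apply: cvgMl_tmp; exact: cvgMl_tmp].
- by apply: continuous_ln; rewrite mulr_gt0.
- rewrite /lam2 (_ : 4 * nuR = 1 + 1 * (12 * (dR * (1 / 3) + 1 / 4)) :> R); last first.
    by rewrite -natr1; field.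
  apply: cvgD; [exact: cvg_cst|apply: cvgMl_tmp; apply: cvgMl_tmp].
  by apply: cvgD => //; exact: cvgMl_tmp.
Unshelve. all: by end_near. Qed.

Lemma lindeberg_limit (e : R) : 0 < e -> exists K, forall m n, (K < m)%N -> (K < n)%N ->
  `|walk_avg m n - expR (- ((dR - 1) / 2 * ln 4 + 1 / 2 * ln (4 * nuR)))| <= e.
Proof.
move=> e0; have [K K0 hK] := lindeberg_walk.
have e2 : 0 < e / 2 by rewrite divr_gt0.
have /cvgrPdist_le /(_ _ e2)[N1 _ h1] := cvg_hk.
have [N2 _ h2] : \forall n \near \oo, 2 * K / e <= Num.sqrt n%:R.
  near=> n; have h : (2 * K / e) ^+ 2 <= n%:R by near: n; exact: nbhs_infty_ger.
  have h0 : 0 <= 2 * K / e by rewrite divr_ge0 ?(ltW e0)// mulr_ge0// ltW.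
  by rewrite -(ger0_norm h0) -sqrtr_sqr ler_wsqrtr.
exists (maxn N1 (maxn N2 (24 * d.+1))) => m n.
rewrite !gtn_max => /andP[m1 /andP[_ _]] /andP[_ /andP[n2 n3]].
have := h1 m (ltnW m1); have := h2 n (ltnW n2) => /=.
have := hK m n (leq_ltn_trans (leq0n _) m1) (ltnW n3).
set A := walk_avg m n; set B := hk m 1 0; set L := expR _ => ha hb hc.
have s0 : 0 < Num.sqrt n%:R :> R by rewrite sqrtr_gt0 ltr0n (leq_ltn_trans _ n3).
have ks : K / Num.sqrt n%:R <= e / 2.
  by move: hb; rewrite !ler_pdivrMr//; lra.
have -> : A - L = (A - B) - (L - B) by ring.
rewrite (le_trans (ler_normB _ _))//; lra.
Unshelve. all: by end_near. Qed.

End lindeberg_limit.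

(** * Colour classes with equal sums *)

Section colourings.
Context {R : realType}.
Variables (d n m : nat).
Implicit Types (c : {ffun 'I_n -> 'I_d.+1}) (x : {ffun 'I_n -> 'I_m}).

Definition csize c a : nat := (\sum_(i < n | c i == a) 1)%N.
Definition csum c x a : nat := (\sum_(i < n | c i == a) (x i).+1)%N.
Definition balanced c x : bool := [forall a, csum c x a == csum c x ord0].

End colourings.

(** * Independence of the classes and conditioning on colour 0 *)

Section factorization.
Context {R : realType}.
Variable m : nat.
Hypothesis m0 : (0 < m)%N.

Lemma iter_conv_cst k (C : R) z : iter k (conv m) (fun=> C) z = C.
Proof.
elim: k z => // k IH z; rewrite iterS /conv.
under eq_bigr do rewrite IH.
by rewrite sumr_const card_ord -(mulr_natl C m) mulKf// pnatr_eq0 -lt0n.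
Qed.

Lemma iter_conv_shift k (g : nat -> R) z :
  m%:R^-1 * \sum_(j < m) iter k (conv m) g (z + j.+1)%N = iter k.+1 (conv m) g z.
Proof. by []. Qed.

Lemma csizeS d n (b : 'I_d.+1) (c : {ffun 'I_n -> 'I_d.+1}) a :
  csize (consf b c) a = ((b == a) + csize c a)%N.
Proof.
rewrite /csize big_mkcond big_ord_recl consf0 [X in (_ + X)%N = _]/= [in RHS]big_mkcond/=.
rewrite (_ : (if b == a then 1 else 0)%N = (b == a)); last by case: ifP.
by congr (_ + _)%N; apply: eq_bigr => i _; rewrite consfS.
Qed.

Lemma csumS d n (b : 'I_d.+1) (c : {ffun 'I_n -> 'I_d.+1}) (j : 'I_m) x a :
  csum (consf b c) (consf j x) a = ((b == a) * j.+1 + csum c x a)%N.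
Proof.
rewrite /csum big_mkcond big_ord_recl !consf0 [in RHS]big_mkcond/=.
congr addn; first by case: ifP => _; rewrite ?mul1n ?mul0n.
by apply: eq_bigr => i _; rewrite !consfS.
Qed.

Lemma consf_eta (T : Type) n (f : {ffun 'I_n.+1 -> T}) :
  f = consf (f ord0) [ffun i => f (lift ord0 i)].
Proof.
apply/ffunP => i; rewrite ffunE; case: unliftP => [j ->|->]//.
by rewrite ffunE.
Qed.

(** Induction on n: the first index adds its value to the offset [z] of its own class only, which is
    one application of [conv] in that factor. *)
Lemma factorization d n (c : {ffun 'I_n -> 'I_d.+1}) (g : 'I_d.+1 -> nat -> R) (z : 'I_d.+1 -> nat) :
  m%:R ^- n * \sum_(x : {ffun 'I_n -> 'I_m}) \prod_a g a (z a + csum c x a)%N =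
  \prod_a iter (csize c a) (conv m) (g a) (z a).
Proof.
elim: n c z => [|n IH] c z.
  rewrite (sum_ffun0 _ [ffun=> Ordinal m0]) expr0 invr1 mul1r.
  by apply: eq_bigr => a _; rewrite /csum /csize !big_ord0 addn0.
rewrite (consf_eta c); set b := c ord0; set c' := [ffun i => _].
rewrite sum_ffunS exprS invfM -mulrA mulr_sumr.
have -> : \sum_(j < m) m%:R ^- n * \sum_(x : {ffun 'I_n -> 'I_m})
      \prod_a g a (z a + csum (consf b c') (consf j x) a)%N =
    \sum_(j < m) \prod_a iter (csize c' a) (conv m) (g a) (z a + (b == a) * j.+1)%N.
  apply: eq_bigr => j _; rewrite -(IH c' (fun a => z a + (b == a) * j.+1)%N).
  congr (_ * _); apply: eq_bigr => x _; apply: eq_bigr => a _.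
  by rewrite csumS addnA.
rewrite (bigD1 b)//= csizeS eqxx add1n -iter_conv_shift -mulrA; congr (_ * _).
rewrite mulr_suml; apply: eq_bigr => j _.
rewrite (bigD1 b)//= eqxx mul1n; congr (_ * _); apply: eq_bigr => a.
by rewrite csizeS eq_sym => /negbTE ->; rewrite mul0n addn0.
Qed.

Lemma upmf_ge0 k s : 0 <= upmf m k s :> R.
Proof.
rewrite /upmf; move: 0%N; elim: k => [|k IH] z /=; first exact: ler0n.
by rewrite /conv mulr_ge0 ?invr_ge0// sumr_ge0.
Qed.

Lemma iter_conv_le k (g h : nat -> R) z : (forall z, g z <= h z) ->
  iter k (conv m) g z <= iter k (conv m) h z.
Proof.
move=> gh; elim: k z => // k IH z; rewrite !iterS /conv.
by rewrite ler_wpM2l ?invr_ge0// ler_sum.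
Qed.

(** Whatever the sum of the other k - 1 variables, at most one value of the remaining variable
    completes it to s; [iterSr] isolates that variable. *)
Lemma upmf_le k s : (0 < k)%N -> upmf m k s <= m%:R^-1 :> R.
Proof.
case: k => // k _; rewrite /upmf iterSr.
rewrite -[leRHS](iter_conv_cst k m%:R^-1 0); apply: iter_conv_le => z.
rewrite /conv ler_piMr ?invr_ge0//.
have [h|h] := boolP [exists j : 'I_m, (z + j.+1)%N == s]; last first.
  rewrite big1// => j _; case: eqP => // E; case/negP: h.
  by apply/existsP; exists j; apply/eqP.
have /existsP[j /eqP js] := h.
rewrite (bigD1 j)//= js eqxx big1 ?addr0// => i ij.
case: eqP => // E; move: ij; rewrite -val_eqE/=; move: js; rewrite -E.
by move=> /addnI [->]; rewrite eqxx.
Qed.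

Lemma csum_le d n (c : {ffun 'I_n -> 'I_d.+1}) (x : {ffun 'I_n -> 'I_m}) a :
  (csum c x a <= n * m)%N.
Proof.
apply: (@leq_trans (\sum_(i < n) m)); last by rewrite sum_nat_const card_ord.
rewrite /csum big_mkcond; by apply: leq_sum => i _; case: ifP => // _.
Qed.

Definition balanced_prob d n (c : {ffun 'I_n -> 'I_d.+1}) : R :=
  m%:R ^- n * \sum_(x : {ffun 'I_n -> 'I_m}) (balanced c x)%:R.

Lemma prodr_natb (I : finType) (P : pred I) :
  \prod_i (P i)%:R = [forall i, P i]%:R :> R.
Proof.
have [/forallP h|/forallPn[i /negbTE h]] := boolP [forall i, P i].
  by rewrite big1// => i _; rewrite h.
by rewrite (bigD1 i)//= h mul0r.
Qed.

Lemma balanced_probE d n (c : {ffun 'I_n -> 'I_d.+1}) :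
  balanced_prob c = m%:R ^- n * \sum_(x : {ffun 'I_n -> 'I_m})
    \prod_(a < d) upmf m (csize c (lift ord0 a)) (csum c x ord0).
Proof.
have sumE (F : nat -> R) (x : {ffun 'I_n -> 'I_m}) :
    F (csum c x ord0) = \sum_(s < (n * m).+1) (csum c x ord0 == s)%:R * F s.
  have h : (csum c x ord0 < (n * m).+1)%N by rewrite ltnS csum_le.
  rewrite (bigD1 (Ordinal h))//= eqxx mul1r big1 ?addr0// => s.
  by rewrite -val_eqE/= eq_sym => /negbTE ->; rewrite mul0r.
pose g (s : nat) (a : 'I_d.+1) (z : nat) : R := (z == s)%:R.
(* [factorization] is used twice. Replacing the functions of the other classes by constants leaves
   the product of probabilities unchanged, and read backwards the formula becomes an average over x
   in which only class 0 is still random. *)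
pose g' (s : nat) (a : 'I_d.+1) (z : nat) : R :=
  if a == ord0 then (z == s)%:R else upmf m (csize c a) s.
transitivity (\sum_(s < (n * m).+1) \prod_a upmf m (csize c a) s : R).
  transitivity (\sum_(s < (n * m).+1) m%:R ^- n * \sum_(x : {ffun 'I_n -> 'I_m})
       \prod_a g s a (0 + csum c x a)%N).
    rewrite /balanced_prob -mulr_sumr exchange_big/=; congr (_ * _).
    apply: eq_bigr => x _.
    rewrite (_ : (balanced c x)%:R = \prod_a (csum c x a == csum c x ord0)%:R); last first.
      by rewrite prodr_natb.
    rewrite (sumE (fun s => \prod_a (csum c x a == s)%:R)); apply: eq_bigr => s _.
    change ((csum c x ord0 == s)%:R * \prod_a (csum c x a == s)%:R =
      \prod_(a < d.+1) (csum c x a == s)%:R :> R).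
    by rewrite big_ord_recl; case: eqP => _; rewrite ?mul0r ?mul1r.
  by apply: eq_bigr => s _; rewrite factorization.
transitivity (\sum_(s < (n * m).+1) m%:R ^- n * \sum_(x : {ffun 'I_n -> 'I_m})
       \prod_a g' s a (0 + csum c x a)%N).
  apply: eq_bigr => s _; rewrite factorization.
  rewrite !big_ord_recl; congr (_ * _); apply: eq_bigr => a _.
  by rewrite /g' /= iter_conv_cst.
rewrite -mulr_sumr exchange_big/=; congr (_ * _).
apply: eq_bigr => x _; rewrite (sumE (fun s => \prod_(a < d) upmf m (csize c (lift ord0 a)) s)).
by apply: eq_bigr => s _; rewrite big_ord_recl /g'/= add0n.
Qed.

Lemma prodr_le_expr (I : finType) (F : I -> R) (C : R) :
  (forall i, 0 <= F i <= C) -> \prod_i F i <= C ^+ #|I|.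
Proof.
move=> h; rewrite -[leRHS]prodr_const; apply: ler_prod => i _; exact: h.
Qed.

Lemma balanced_prob_ge0 d n (c : {ffun 'I_n -> 'I_d.+1}) : 0 <= balanced_prob c.
Proof. by rewrite mulr_ge0 ?invr_ge0 ?exprn_ge0// sumr_ge0. Qed.

(** If every class is non-empty, each of the d factors is at most 1 / m. An empty class has sum 0,
    whereas the class of the first index has positive sum, so balance is then impossible. *)
Lemma balanced_prob_le d n (c : {ffun 'I_n -> 'I_d.+1}) : (0 < n)%N ->
  balanced_prob c <= m%:R ^- d.
Proof.
move=> n0; have M0 : 0 < m%:R :> R by rewrite ltr0n.
have [/forallP h|/forallPn[a]] := boolP [forall a, (0 < csize c a)%N]; last first.
  rewrite -eqn0Ngt /csize sum_nat_eq0 => /forallP ca0.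
  rewrite /balanced_prob big1 ?mulr0 ?invr_ge0 ?exprn_ge0// => x _.
  have cx0 : csum c x a = 0%N.
    by rewrite /csum big1// => i ci; have := ca0 i; rewrite ci.
  have [/forallP hb|//] := boolP (balanced c x).
  exfalso; pose i0 := Ordinal n0.
  have : csum c x (c i0) = 0%N.
    by rewrite (eqP (hb _)) -(eqP (hb a)).
  by rewrite /csum (bigD1 i0).
rewrite balanced_probE ler_pdivrMl ?exprn_gt0//.
apply: (@le_trans _ _ (\sum_(x : {ffun 'I_n -> 'I_m}) m%:R ^- d)).
  apply: ler_sum => x _; rewrite -[X in _ <= _ ^- X](card_ord d) -exprVn.
  by apply: prodr_le_expr => i; rewrite upmf_ge0 upmf_le.
by rewrite sumr_const card_ffun !card_ord -(mulr_natl (m%:R ^- d) (m ^ n)) natrX.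
Qed.

End factorization.

(** * Class sizes of a typical colouring *)

Section concentration.
Context {R : realType}.

(* Chernoff: bound the exponential moment with [expR z <= 1 + z + 4 z^2]. *)
Lemma chernoff (T : finType) (w : T -> R) n (t : R) : (0 < #|T|)%N ->
  \sum_b w b = 0 -> (forall b, `|w b| <= 1) -> 0 <= t <= 8 ->
  \sum_(c : {ffun 'I_n -> T}) (n%:R * t <= \sum_i w (c i))%R%:R <=
  #|T|%:R ^+ n * expR (- (n%:R * (t ^+ 2 / 16))).
Proof.
move=> T0 w0 w1 /andP[t0 t2].
have T0' : 0 < #|T|%:R :> R by rewrite ltr0n.
(* The minimiser of - l t + 4 l^2, giving the exponent - t^2 / 16; the bound t <= 8 keeps l <= 1,
   where the quadratic estimate of the exponential holds. *)
pose l := t / 8.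
have e4 : expR 1 <= 4 :> R.
  have h1 : 1 / 2 <= expR (- (1 / 2)) :> R by have := expR_ge1Dx (- (1 / 2) : R); lra.
  have h2 : expR (1 / 2) <= 2 :> R.
    have E : expR (1 / 2) * expR (- (1 / 2)) = 1 :> R by rewrite expRxMexpNx_1.
    have := ler_wpM2l (expR_ge0 (1 / 2 : R)) h1; lra.
  have -> : expR 1 = expR (1 / 2) * expR (1 / 2) :> R by rewrite -expRD; congr expR; field.
  by rewrite (_ : 4 = 2 * 2)//; [rewrite ler_pM ?expR_ge0|ring].
have expb (z : R) : `|z| <= 1 -> expR z <= 1 + z + 4 * z ^+ 2.
  move=> z1; have := le_trans (ler_norm _) (expR_taylor1 z).
  have : expR `|z| <= 4 by rewrite (le_trans _ e4)// ler_expR.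
  move=> /(ler_wpM2l (sqr_ge0 z)); lra.
apply: (@le_trans _ _ (\sum_(c : {ffun 'I_n -> T}) expR (l * (\sum_i w (c i)) - l * (n%:R * t)))).
  apply: ler_sum => c _; case: (leP _ (\sum_i w (c i))) => [h|_]; last exact: expR_ge0.
  rewrite -[leLHS]expR0 ler_expR -mulrBr mulr_ge0 ?subr_ge0// divr_ge0//.
have E (c : {ffun 'I_n -> T}) : expR (l * (\sum_i w (c i)) - l * (n%:R * t)) =
    expR (- (l * (n%:R * t))) * \prod_i expR (l * w (c i)).
  by rewrite -expR_sum -expRD mulr_sumr addrC.
under eq_bigr do rewrite E.
rewrite -mulr_sumr -(bigA_distr_bigA (fun (i : 'I_n) b => expR (l * w b))) /=.
rewrite prodr_const card_ord.
have S1 : \sum_b expR (l * w b) <= #|T|%:R * expR (4 * l ^+ 2).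
  apply: (@le_trans _ _ (\sum_b (1 + l * w b + 4 * l ^+ 2))).
    apply: ler_sum => b _.
    have lw : `|l * w b| <= 1.
      rewrite normrM ger0_norm ?divr_ge0// mulr_ile1// ?divr_ge0// /l; lra.
    apply: (le_trans (expb _ lw)); rewrite lerD2l exprMn ler_wpM2l// ler_piMr ?sqr_ge0//.
    by rewrite -(real_normK (num_real (w b))) exprn_ile1.
  have SC (C : R) : \sum_(b : T) C = #|T|%:R * C by rewrite sumr_const mulr_natl.
  rewrite 2!big_split/= -mulr_sumr w0 mulr0 addr0 !SC -mulrDr.
  by rewrite ler_wpM2l ?(ltW T0')// expR_ge1Dx.
apply: (@le_trans _ _ (expR (- (l * (n%:R * t))) * (#|T|%:R * expR (4 * l ^+ 2)) ^+ n)).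
  rewrite ler_wpM2l ?expR_ge0// lerXn2r ?nnegrE ?mulr_ge0 ?expR_ge0//.
  by rewrite sumr_ge0// => b _; exact: expR_ge0.
rewrite exprMn mulrCA -expRM_natr -expRD ler_wpM2l ?exprn_ge0 ?(ltW T0')// ler_expR /l.
by rewrite le_eqVlt; apply/predU1P; left; field.
Qed.

Definition typical d n (e : R) (c : {ffun 'I_n -> 'I_d.+1}) : bool :=
  [forall a, `|(csize c a)%:R * d.+1%:R - n%:R| <= e * n%:R].

Lemma csizeE d n (c : {ffun 'I_n -> 'I_d.+1}) a : (csize c a)%:R = \sum_i (c i == a)%:R :> R.
Proof.
by rewrite /csize big_mkcond natr_sum; apply: eq_bigr => i _; case: (c i == a).
Qed.

(** Union bound over nu colours and two signs, applying [chernoff] to the centred indicator of a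
    colour with t = e / nu. *)
Lemma concentration d n (e : R) : 0 <= e <= 1 ->
  d.+1%:R ^- n * \sum_(c : {ffun 'I_n -> 'I_d.+1}) (~~ typical e c)%:R <=
  2 * d.+1%:R * expR (- (n%:R * ((e / d.+1%:R) ^+ 2 / 16))).
Proof.
move=> /andP[e0 e1]; set nuR := d.+1%:R; set E := expR _.
have nu1 : 1 <= nuR :> R by rewrite ler1n.
have nu0 : 0 < nuR by rewrite ltr0n.
pose w (a b : 'I_d.+1) : R := (b == a)%:R - nuR^-1.
have w0 a : \sum_b w a b = 0.
  rewrite /w sumrB sumr_const card_ord -(mulr_natl nuR^-1 d.+1) divff ?gt_eqF//.
  rewrite (bigD1 a)//= eqxx big1 ?addr0 ?subrr// => b /negbTE ->.
  by [].
have w1 a b : `|w a b| <= 1.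
  have h1 : 0 <= nuR^-1 by rewrite invr_ge0 ltW.
  have h2 : nuR^-1 <= 1 by rewrite invf_le1.
  rewrite /w ler_norml; move: (nuR^-1) h1 h2 => q h1 h2.
  by case: (b == a) => /=; rewrite ?mulr1n ?mulr0n; apply/andP; split; lra.
have wsum a (c : {ffun 'I_n -> 'I_d.+1}) : \sum_i w a (c i) = (csize c a)%:R - n%:R / nuR.
  by rewrite /w sumrB -csizeE sumr_const card_ord -(mulr_natl nuR^-1 n).
have T0 : (0 < #|'I_d.+1|)%N by rewrite card_ord.
have t8 : 0 <= e / nuR <= 8.
  rewrite divr_ge0 ?(ltW nu0)//= ler_pdivrMr//; lra.
have C1 a := @chernoff _ (w a) n (e / nuR) T0 (w0 a) (w1 a) t8.
have nw0 a : \sum_b - w a b = 0 by rewrite sumrN w0 oppr0.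
have nw1 a b : `|- w a b| <= 1 by rewrite normrN.
have C2 a := @chernoff _ (fun b => - w a b) n (e / nuR) T0 (nw0 a) (nw1 a) t8.
rewrite card_ord -/nuR -/E in C1 C2.
rewrite ler_pdivrMl ?exprn_gt0//.
have -> : nuR ^+ n * (2 * nuR * E) = \sum_(a < d.+1) (nuR ^+ n * E + nuR ^+ n * E).
  by rewrite sumr_const card_ord -(mulr_natl _ d.+1) -/nuR; ring.
apply: le_trans (ler_sum _ (fun a _ => lerD (C1 a) (C2 a))).
under [leRHS]eq_bigr do rewrite -big_split/=.
rewrite [leRHS]exchange_big/=; apply: ler_sum => c _.
have ge0 (b1 b2 : bool) : 0 <= b1%:R + b2%:R :> R by rewrite addr_ge0.
case: (boolP (typical e c)) => [_|]; first by rewrite sumr_ge0.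
rewrite negb_forall => /existsP[a]; rewrite -ltNge => ha.
rewrite (bigD1 a)//= -[leLHS]addr0 lerD ?sumr_ge0//.
rewrite sumrN wsum; set x := (csize c a)%:R in ha *.
have xE : x * nuR - n%:R = nuR * (x - n%:R / nuR) by field; rewrite gt_eqF.
have eE : e * n%:R = nuR * (n%:R * (e / nuR)) by field; rewrite gt_eqF.
move: ha; rewrite xE eE normrM (ger0_norm (ltW nu0)) ltr_pM2l// => ha.
have [z0|z0] := leP 0 (x - n%:R / nuR).
  by rewrite ger0_norm// in ha; rewrite (ltW ha) lerDl ler0n.
by rewrite ltr0_norm// in ha; rewrite (ltW ha) lerDr ler0n.
Qed.

Lemma poly_expR_small d (k e : R) : 0 < k -> 0 < e -> exists K, forall n, (K < n)%N ->
  n%:R ^+ d * expR (- (n%:R * k)) <= e.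
Proof.
move=> k0 e0.
have f0 : 0 < (d.+1)`!%:R :> R by rewrite ltr0n fact_gt0.
have [K _ hK] : \forall n \near \oo, (d.+1)`!%:R / (k ^+ d.+1 * e) <= n%:R :> R.
  by near=> n; near: n; exact: nbhs_infty_ger.
exists K => n Kn; have := hK n (ltnW Kn) => /=.
have n0 : 0 < n%:R :> R by rewrite ltr0n (leq_ltn_trans _ Kn).
have nk : 0 <= n%:R * k by rewrite mulr_ge0// ltW.
have h := @expR_ge1Dxn _ (n%:R * k) d nk.
rewrite ler_pdivrMr ?mulr_gt0 ?exprn_gt0// => h2.
rewrite expRN ler_pdivrMr ?expR_gt0//.
have h3 : (n%:R * k) ^+ d.+1 / (d.+1)`!%:R <= expR (n%:R * k) by lra.
apply: le_trans (ler_wpM2l (ltW e0) h3).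
rewrite mulrA ler_pdivlMr// exprMn exprS.
have := ler_wpM2l (exprn_ge0 d (ltW n0)) h2; lra.
Unshelve. all: by end_near. Qed.

End concentration.

Section typical_factor.
Context {R : realType}.

(** Compensates for replacing a class size k by n / nu, with z the ratio of the latter to the
    former. Uniformity in Y comes from Y expR (- Y u) <= 2 for u >= 1 / 2. *)
Lemma gauss_rescale (z Y : R) : 0 <= Y -> 1 / 2 <= z ->
  `|Num.sqrt z * expR (- (Y * z)) - expR (- Y)| <= 3 * `|z - 1|.
Proof.
move=> Y0 z2; have z0 : 0 < z by lra.
have s0 : 0 < Num.sqrt z by rewrite sqrtr_gt0.
have h1 : `|Num.sqrt z - 1| <= `|z - 1|.
  have -> : z - 1 = (Num.sqrt z - 1) * (Num.sqrt z + 1).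
    by rewrite -{1}(sqr_sqrtr (ltW z0)); ring.
  rewrite normrM ler_peMr// ger0_norm; lra.
have h2 : expR (- (Y * z)) <= 1 by rewrite -[leRHS]expR0 ler_expR oppr_le0 mulr_ge0// ltW.
have key (u v : R) : 1 / 2 <= u -> u <= v -> `|expR (- (Y * v)) - expR (- (Y * u))| <= 2 * `|v - u|.
  move=> u2 uv; rewrite distrC ger0_norm; last first.
    by rewrite subr_ge0 ler_expR lerN2 ler_wpM2l.
  have -> : expR (- (Y * v)) = expR (- (Y * u)) * expR (- (Y * (v - u))).
    by rewrite -expRD; congr expR; ring.
  have e1 := expR_ge1Dx (- (Y * (v - u))).
  have e2 : expR (- (Y * u)) * Y <= 2.
    have E : expR (- (Y * u)) * expR (Y * u) = 1 by rewrite -expRD -[RHS]expR0; congr expR; ring.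
    have h3 : Y <= 2 * expR (Y * u).
      have := expR_ge1Dx (Y * u).
      have : Y * (1 / 2) <= Y * u by rewrite ler_wpM2l.
      lra.
    have := ler_wpM2l (expR_ge0 (- (Y * u))) h3; lra.
  have uv0 : 0 <= v - u by lra.
  rewrite ger0_norm//.
  have := ler_wpM2r uv0 e2.
  have := ler_wpM2l (expR_ge0 (- (Y * u))) e1; lra.
have h3 : `|expR (- (Y * z)) - expR (- Y)| <= 2 * `|z - 1|.
  have [z1|z1] := leP 1 z.
    by have := key 1 z _ z1; rewrite mulr1; apply; lra.
  by have := key z 1 z2 (ltW z1); rewrite mulr1 distrC [X in _ <= _ * X]distrC.
have -> : Num.sqrt z * expR (- (Y * z)) - expR (- Y) =
  (Num.sqrt z - 1) * expR (- (Y * z)) + (expR (- (Y * z)) - expR (- Y)) by ring.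
rewrite (le_trans (ler_normD _ _))// normrM (ger0_norm (expR_ge0 _)).
have : `|Num.sqrt z - 1| * expR (- (Y * z)) <= `|z - 1| * 1 by rewrite ler_pM ?expR_ge0.
lra.
Qed.

(** [local_limit] normalises by the true class size; here the normalisation and the Gaussian are
    those of size n / nu, the same for all classes, as the comparison with a single walk
    requires. *)
Lemma typical_factor (nu : nat) (e : R) : (0 < nu)%N -> 0 < e ->
  exists2 de : R, 0 < de <= 1 & exists K, forall m n k s, (K < m)%N -> (K < n)%N ->
  `|k%:R * nu%:R - n%:R| <= de * n%:R ->
  `|m%:R * Num.sqrt n%:R * upmf m k s -
    Num.sqrt (6 * nu%:R / pi) *
    expR (- (6 * nu%:R * ((s%:R - k%:R * mid m) / (m%:R * Num.sqrt n%:R)) ^+ 2))| <= e.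
Proof.
move=> nu0 e0; have N0 : 0 < nu%:R :> R by rewrite ltr0n.
have p0 := pi_gt0 R.
(* Upper bound for the ratio b of m sqrt n to [scl m k]: b^2 = 24 nu z with z <= 2. *)
pose B := Num.sqrt (48 * nu%:R) : R.
have B0 : 0 < B by rewrite sqrtr_gt0 mulr_gt0.
pose r := Num.sqrt (6 * nu%:R / pi) : R.
have r0 : 0 < r by rewrite sqrtr_gt0 divr_gt0// mulr_gt0.
pose e1 := e / 2 / B.
have e10 : 0 < e1 by rewrite !divr_gt0.
have [K1 hK] := local_limit e10.
(* 1 / 2 gives k >= n / (2 nu) and 1 / 2 <= z <= 2; the other term makes r * 3 * 2 de at most e /
   2. *)
pose de := Num.min (1 / 2) (e / 2 / (6 * r)).
have de0 : 0 < de by rewrite lt_min; apply/andP; split; [lra|rewrite !divr_gt0// mulr_gt0].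
have de2 : de <= 1 / 2 by rewrite ge_min lexx.
have der : de <= e / 2 / (6 * r) by rewrite ge_min lexx orbT.
exists de; first by rewrite de0; lra.
(* With k >= n / (2 nu), this forces k > K1. *)
exists (2 * nu * K1.+1)%N => m n k s Km Kn typ.
have Km' : (K1 < m)%N.
  by apply: leq_trans Km; rewrite ltnS (leq_trans (leqnSn _))// leq_pmull// muln_gt0.
have n0 : (0 < n)%N by exact: leq_ltn_trans Kn.
have m0 : (0 < m)%N by exact: leq_ltn_trans Km.
have n0' : 0 < n%:R :> R by rewrite ltr0n.
have m0' : 0 < m%:R :> R by rewrite ltr0n.
have den : de * n%:R <= 1 / 2 * n%:R by rewrite ler_wpM2r// ltW.
move: (typ); rewrite ler_norml => /andP[typ1 typ2].
have kn : n%:R <= 2 * nu%:R * k%:R :> R by lra.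
have Kk : (K1 < k)%N.
  have : (2 * nu * K1.+1 < 2 * nu * k)%N.
    by apply: (leq_trans Kn); rewrite -(ler_nat R) !natrM; lra.
  by rewrite ltn_pmul2l ?muln_gt0//; exact: ltnW.
have k0 : (0 < k)%N by exact: leq_ltn_trans Kk.
have k0' : 0 < k%:R :> R by rewrite ltr0n.
pose z : R := n%:R / (nu%:R * k%:R).
have nk0 : 0 < nu%:R * k%:R :> R by rewrite mulr_gt0.
have z1 : `|z - 1| <= 2 * de.
  have -> : z - 1 = (n%:R - k%:R * nu%:R) / (nu%:R * k%:R) by rewrite /z; field; rewrite !gt_eqF.
  rewrite normrM normfV (gtr0_norm nk0) ler_pdivrMr// distrC (le_trans typ)//.
  have := ler_wpM2l (ltW de0) kn; lra.
have z2 : 1 / 2 <= z by rewrite /z ler_pdivlMr//; lra.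
have zle : z <= 2 by rewrite /z ler_pdivrMr//; lra.
set Y := 6 * nu%:R * _ ^+ 2.
have Y0 : 0 <= Y by rewrite mulr_ge0 ?sqr_ge0// mulr_ge0// ltW.
have sn : Num.sqrt n%:R ^+ 2 = n%:R :> R by rewrite sqr_sqrtr// ltW.
have sn0 : 0 < Num.sqrt n%:R :> R by rewrite sqrtr_gt0.
have c0 : 0 < scl m k :> R by exact: scl_gt0.
pose b := Num.sqrt (24 * nu%:R * z) : R.
have z0 : 0 < z by lra.
have bE : m%:R * Num.sqrt n%:R = b * scl m k.
  rewrite /b /scl mulrCA -sqrtrM; last by rewrite !mulr_ge0// ltW.
  by congr (_ * Num.sqrt _); rewrite /z; field; rewrite !gt_eqF.
have YE : ((k%:R * mid m - s%:R) / scl m k) ^+ 2 / 4 = Y * z.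
  rewrite /Y /z /scl !exprMn !exprVn !exprMn sn sqr_sqrtr; last by rewrite divr_ge0// ltW.
  by field; rewrite !gt_eqF.
have bB : b <= B by rewrite /b /B ler_wsqrtr//; have := ler_wpM2l (ltW N0) zle; lra.
have rE : b * (2 * Num.sqrt pi)^-1 = r * Num.sqrt z.
  have sp0 : 0 < Num.sqrt pi :> R by rewrite sqrtr_gt0.
  rewrite /b /r sqrtrM; last by rewrite mulr_ge0// ltW.
  have -> : 24 * nu%:R = 4 * pi * (6 * nu%:R / pi) :> R.
    have -> : 4 * pi * (6 * nu%:R / pi) = 24 * nu%:R * (pi / pi) :> R by ring.
    by rewrite divff ?mulr1// gt_eqF.
  rewrite sqrtrM; last by rewrite mulr_ge0// ltW.
  rewrite sqrtrM// (_ : 4 = 2 ^+ 2) ?sqrtr_sqr ?ger0_norm//; last by rewrite -natrX.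
  by field; rewrite gt_eqF.
have := hK m k s Km' Kk; rewrite YE => hL.
have b0 : 0 <= b by exact: sqrtr_ge0.
have -> : m%:R * Num.sqrt n%:R * upmf m k s - r * expR (- Y) =
   b * (scl m k * upmf m k s - (2 * Num.sqrt pi)^-1 * expR (- (Y * z))) +
   r * (Num.sqrt z * expR (- (Y * z)) - expR (- Y)).
  by rewrite bE mulrBr [b * (_ * expR _)]mulrA rE; ring.
rewrite (le_trans (ler_normD _ _))// !normrM (ger0_norm b0) (gtr0_norm r0).
have P1 : b * `|scl m k * upmf m k s - (2 * Num.sqrt pi)^-1 * expR (- (Y * z))| <= e / 2.
  have -> : e / 2 = B * e1 by rewrite /e1; field; rewrite gt_eqF.
  by rewrite ler_pM.
have P2 : r * `|Num.sqrt z * expR (- (Y * z)) - expR (- Y)| <= e / 2.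
  apply: (@le_trans _ _ (r * (3 * (2 * de)))).
    rewrite ler_wpM2l ?(ltW r0)// (le_trans (gauss_rescale Y0 z2))//; lra.
  move: der; rewrite ler_pdivlMr ?mulr_gt0//; lra.
lra.
Qed.

End typical_factor.

(** * Average of the balance probability over all colourings *)

Section averaged_probability.
Context {R : realType}.
Variable d : nat.
Hypothesis d0 : (0 < d)%N.
Local Notation nuR := (d.+1%:R : R).
Local Notation dR := (d%:R : R).

Lemma prod_diff_le (k : nat) (a b : 'I_k -> R) (C e : R) : 1 <= C -> 0 <= e ->
  (forall i, `|a i| <= C) -> (forall i, `|b i| <= C) -> (forall i, `|a i - b i| <= e) ->
  `|\prod_i a i - \prod_i b i| <= k%:R * C ^+ k * e.
Proof.
move=> C1 e0; have C0 : 0 <= C by lra.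
elim: k a b => [|k IH] a b aC bC ab; first by rewrite !big_ord0 subrr normr0 !mul0r.
rewrite !big_ord_recl; set A := \prod_(i < k) _; set B := \prod_(i < k) _.
have h : `|A - B| <= k%:R * C ^+ k * e by apply: IH => i.
have hB : `|B| <= C ^+ k.
  rewrite normr_prod -[X in _ ^+ X](card_ord k); apply: prodr_le_expr => i.
  by rewrite normr_ge0 bC.
have -> : a ord0 * A - b ord0 * B = a ord0 * (A - B) + (a ord0 - b ord0) * B by ring.
rewrite (le_trans (ler_normD _ _))// !normrM.
have h1 : `|a ord0| * `|A - B| <= C * (k%:R * C ^+ k * e) by rewrite ler_pM.
have h2 : `|a ord0 - b ord0| * `|B| <= e * C ^+ k by rewrite ler_pM.
have h3 : e * C ^+ k <= e * C ^+ k.+1 by rewrite ler_wpM2l// exprS ler_peMl// exprn_ge0.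
rewrite -[k.+1%:R]natr1 exprS; move: h3; rewrite exprS; lra.
Qed.

Lemma sum_ffun_pair (V : nmodType) (A B : finType) n (F : {ffun 'I_n -> A * B} -> V) :
  \sum_f F f = \sum_(g : {ffun 'I_n -> A}) \sum_(h : {ffun 'I_n -> B}) F [ffun i => (g i, h i)].
Proof.
rewrite pair_big/= (reindex (fun p : {ffun 'I_n -> A} * {ffun 'I_n -> B} => [ffun i => (p.1 i, p.2 i)]))//=.
exists (fun f => ([ffun i => (f i).1], [ffun i => (f i).2])) => [[g h]|f] _ /=.
  by congr pair; apply/ffunP => i; rewrite !ffunE.
by apply/ffunP => i; rewrite !ffunE; case: (f i).
Qed.

Definition gauss_dev m n (c : {ffun 'I_n -> 'I_d.+1}) (x : {ffun 'I_n -> 'I_m}) (a : 'I_d) : R :=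
  ((csum c x ord0)%:R - (csize c (lift ord0 a))%:R * mid m) / (m%:R * Num.sqrt n%:R).

(** Colour 0 contributes its value to every coordinate and another colour subtracts the mean from
    its own coordinate only: the values outside class 0 have already been averaged out by the
    conditioning. *)
Lemma sum_wstep m n (c : {ffun 'I_n -> 'I_d.+1}) (x : {ffun 'I_n -> 'I_m}) (a : 'I_d) :
  \sum_i @wstep R d m ([ffun i => (c i, x i)] i) a =
  ((csum c x ord0)%:R - (csize c (lift ord0 a))%:R * mid m) / m%:R.
Proof.
rewrite csizeE /csum [in RHS]big_mkcond natr_sum mulr_suml -sumrB mulr_suml.
apply: eq_bigr => i _; rewrite ffunE /wstep /=.
have [->|c0] := eqVneq (c i) ord0.
  by rewrite (negbTE (neq_lift _ _)) mul0r subr0.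
by rewrite /pm; ring.
Qed.

Lemma walk_avgE m n : walk_avg d m n = nuR ^- n * \sum_(c : {ffun 'I_n -> 'I_d.+1})
   m%:R ^- n * \sum_(x : {ffun 'I_n -> 'I_m}) \prod_(a < d) expR (- (6 * nuR * gauss_dev c x a ^+ 2)).
Proof.
rewrite /walk_avg sum_ffun_pair card_prod !card_ord natrM exprMn invfM -mulrA; congr (_ * _).
rewrite mulr_sumr; apply: eq_bigr => c _; congr (_ * _); apply: eq_bigr => x _.
rewrite -expR_sum sumrN mulr_sumr; congr (expR (- _)); apply: eq_bigr => a _.
by congr (_ * _ ^+ 2); rewrite sum_wstep /gauss_dev invfM [RHS]mulrA.
Qed.

Definition balanced_avg m n : R := nuR ^- n * \sum_(c : {ffun 'I_n -> 'I_d.+1}) balanced_prob m c.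

(** Three errors of e / 3: typical colourings through [prod_diff_le], atypical ones through a
    polynomial bound times an exponentially small proportion, and the Gaussian average through
    [lindeberg_limit]. *)
Lemma balanced_avg_asymp (e : R) : 0 < e -> exists K, forall m n, (K < m)%N -> (K < n)%N ->
  `|balanced_avg m n * (m%:R * Num.sqrt n%:R) ^+ d -
    Num.sqrt (6 * nuR / pi) ^+ d * expR (- ((dR - 1) / 2 * ln 4 + 1 / 2 * ln (4 * nuR)))| <= e.
Proof.
move=> e0; set r := Num.sqrt (6 * nuR / pi); set L := expR _.
have p0 := pi_gt0 R.
have r0 : 0 < r by rewrite sqrtr_gt0 divr_gt0// mulr_gt0.
have rd0 : 0 < r ^+ d by rewrite exprn_gt0.
(* Bounds both kinds of factor: the Gaussian ones are at most r, the exact ones differ from them by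
   e1 <= 1. *)
pose C := r + 1.
have C1 : 1 <= C by rewrite /C; lra.
have dd0 : 0 < dR * C ^+ d by rewrite mulr_gt0 ?ltr0n// exprn_gt0//; lra.
pose e1 := Num.min 1 (e / 3 / (dR * C ^+ d)).
have e10 : 0 < e1 by rewrite lt_min ltr01/= !divr_gt0.
have e11 : e1 <= 1 by rewrite ge_min lexx.
have e1e : e1 * (dR * C ^+ d) <= e / 3 by rewrite -ler_pdivlMr// ge_min lexx orbT.
have [de /andP[de0 de1] [K1 hK1]] := @typical_factor R d.+1 e1 (ltn0Sn _) e10.
pose ka := (de / nuR) ^+ 2 / 16.
have ka0 : 0 < ka by rewrite divr_gt0// exprn_gt0// divr_gt0.
have e3 : 0 < e / 3 / ((1 + r ^+ d) * (2 * nuR)).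
  by rewrite !divr_gt0// mulr_gt0 ?mulr_gt0//; lra.
have [K2 hK2] := poly_expR_small d ka0 e3.
have e30 : 0 < e / 3 / r ^+ d by rewrite !divr_gt0.
have [K3 hK3] := lindeberg_limit d0 e30.
exists (maxn K1 (maxn K2 K3)) => m n.
rewrite !gtn_max => /andP[m1 /andP[m2 m3]] /andP[n1 /andP[n2 n3]].
have m0 : (0 < m)%N by exact: leq_ltn_trans m1.
have n0 : (0 < n)%N by exact: leq_ltn_trans n1.
have M0 : 0 < m%:R :> R by rewrite ltr0n.
have N1 : 1 <= n%:R :> R by rewrite ler1n.
have nu0 : 0 < nuR ^+ n by rewrite exprn_gt0.
have sn0 : 0 < Num.sqrt n%:R :> R by rewrite sqrtr_gt0 ltr0n.
pose q := m%:R * Num.sqrt n%:R : R.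
have q0 : 0 < q by rewrite mulr_gt0.
pose NE (c : {ffun 'I_n -> 'I_d.+1}) := balanced_prob m c * q ^+ d : R.
pose GE (c : {ffun 'I_n -> 'I_d.+1}) := m%:R ^- n * \sum_(x : {ffun 'I_n -> 'I_m})
   \prod_(a < d) (r * expR (- (6 * nuR * gauss_dev c x a ^+ 2))).
have avgN : balanced_avg m n * q ^+ d = nuR ^- n * \sum_c NE c.
  by rewrite /balanced_avg -mulrA mulr_suml.
have avgG : r ^+ d * walk_avg d m n = nuR ^- n * \sum_c GE c.
  rewrite walk_avgE mulrCA mulr_sumr; congr (_ * _); apply: eq_bigr => c _.
  rewrite mulrCA mulr_sumr; congr (_ * _); apply: eq_bigr => x _.
  by rewrite big_split/= prodr_const card_ord.
have NEE c : NE c = m%:R ^- n * \sum_(x : {ffun 'I_n -> 'I_m})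
   \prod_(a < d) (q * upmf m (csize c (lift ord0 a)) (csum c x ord0)).
  rewrite /NE balanced_probE// -mulrA mulr_suml; congr (_ * _); apply: eq_bigr => x _.
  by rewrite big_split/= prodr_const card_ord mulrC.
have cardx : m%:R ^- n * \sum_(x : {ffun 'I_n -> 'I_m}) (1 : R) = 1.
  by rewrite sumr_const card_ffun !card_ord natrX mulVf// gt_eqF// exprn_gt0.
have avgx (F : {ffun 'I_n -> 'I_m} -> R) (B : R) : (forall x, `|F x| <= B) ->
    `|m%:R ^- n * \sum_x F x| <= B.
  move=> FB; rewrite normrM ger0_norm ?invr_ge0 ?exprn_ge0//.
  apply: (@le_trans _ _ (m%:R ^- n * \sum_(x : {ffun 'I_n -> 'I_m}) B)).
    rewrite ler_wpM2l ?invr_ge0 ?exprn_ge0// (le_trans (ler_norm_sum _ _ _))//.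
    exact: ler_sum.
  have -> : \sum_(x : {ffun 'I_n -> 'I_m}) B = B * \sum_(x : {ffun 'I_n -> 'I_m}) 1.
    by rewrite mulr_sumr; apply: eq_bigr => x _; rewrite mulr1.
  by rewrite mulrCA cardx mulr1.
have gb (c : {ffun 'I_n -> 'I_d.+1}) (x : {ffun 'I_n -> 'I_m}) a :
    0 <= r * expR (- (6 * nuR * gauss_dev c x a ^+ 2)) <= r.
  rewrite mulr_ge0 ?expR_ge0 ?(ltW r0)//= ler_piMr ?(ltW r0)//.
  by rewrite -[leRHS]expR0 ler_expR oppr_le0 mulr_ge0 ?sqr_ge0// mulr_ge0.
have typ c : typical de c -> `|NE c - GE c| <= e / 3.
  move=> /forallP tc; rewrite NEE /GE -mulrBr -sumrB; apply: avgx => x.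
  have F a : `|q * upmf m (csize c (lift ord0 a)) (csum c x ord0) -
       r * expR (- (6 * nuR * gauss_dev c x a ^+ 2))| <= e1.
    exact: hK1 m1 n1 (tc (lift ord0 a)).
  apply: (le_trans _ e1e); rewrite [leRHS]mulrC.
  apply: prod_diff_le => //; first exact: ltW.
  - move=> a; have /andP[g0 g1] := gb c x a; have := F a.
    rewrite ler_distl ger0_norm ?mulr_ge0 ?(ltW q0) ?upmf_ge0// /C => /andP[_ h]; lra.
  - by move=> a; have /andP[g0 g1] := gb c x a; rewrite ger0_norm// /C; lra.
(* A crude bound suffices: after normalisation [balanced_prob_le] gives (sqrt n)^d, which is at most
   n^d. *)
have atyp c : `|NE c - GE c| <= (1 + r ^+ d) * n%:R ^+ d.
  have nd1 : 1 <= n%:R ^+ d :> R by rewrite exprn_ege1.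
  have hN : `|NE c| <= n%:R ^+ d.
    rewrite ger0_norm; last by rewrite mulr_ge0 ?balanced_prob_ge0 ?exprn_ge0 ?(ltW q0).
    rewrite /NE /q exprMn.
    apply: (@le_trans _ _ (m%:R ^- d * (m%:R ^+ d * Num.sqrt n%:R ^+ d))).
      by rewrite ler_wpM2r ?mulr_ge0 ?exprn_ge0 ?(ltW sn0) ?(ltW M0)// balanced_prob_le.
    rewrite mulKf ?gt_eqF ?exprn_gt0// lerXn2r ?nnegrE ?(ltW sn0)//.
    rewrite -[leRHS]sqr_sqrtr// expr2 ler_peMl// ?(ltW sn0)//.
    by rewrite -[leLHS]sqrtr1 ler_wsqrtr.
  have hG : `|GE c| <= r ^+ d.
    apply: avgx => x; rewrite ger0_norm.
      rewrite -[X in _ ^+ X](card_ord d); apply: prodr_le_expr => a; exact: gb.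
    by rewrite prodr_ge0// => a _; have /andP[] := gb c x a.
  rewrite (le_trans (ler_normB _ _))// mulrDl mul1r lerD// (le_trans hG)//.
  by rewrite ler_peMr// ltW.
have diff : `|nuR ^- n * \sum_c NE c - nuR ^- n * \sum_c GE c| <= e / 3 + e / 3.
  rewrite -mulrBr -sumrB normrM ger0_norm ?invr_ge0 ?(ltW nu0)//.
  apply: (@le_trans _ _ (nuR ^- n * \sum_(c : {ffun 'I_n -> 'I_d.+1})
     (e / 3 + (1 + r ^+ d) * n%:R ^+ d * (~~ typical de c)%:R))).
    rewrite ler_wpM2l ?invr_ge0 ?(ltW nu0)// (le_trans (ler_norm_sum _ _ _))//.
    apply: ler_sum => c _; have [tc|tc] := boolP (typical de c).
      by rewrite mulr0 addr0 typ.
    by rewrite mulr1 (le_trans (atyp c))// lerDr divr_ge0// ltW.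
  rewrite big_split/= mulrDr lerD//.
    rewrite sumr_const card_ffun !card_ord -(mulr_natl (e / 3)) natrX mulKf//.
  have de01 : 0 <= de <= 1 by rewrite ltW.
  have hc := concentration d n de01.
  rewrite -mulr_sumr mulrCA.
  have P0 : 0 <= (1 + r ^+ d) * n%:R ^+ d by rewrite mulr_ge0// ?exprn_ge0//; lra.
  apply: (le_trans (ler_wpM2l P0 hc)); rewrite -/ka.
  have := hK2 n n2; rewrite ler_pdivlMr; last by rewrite !mulr_gt0//; lra.
  lra.
have := hK3 m n m3 n3; rewrite -/L => hw.
rewrite -/q avgN.
have -> : nuR ^- n * \sum_c NE c - r ^+ d * L =
  (nuR ^- n * \sum_c NE c - nuR ^- n * \sum_c GE c) + r ^+ d * (walk_avg d m n - L).
  by rewrite -avgG; ring.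
rewrite (le_trans (ler_normD _ _))// normrM (gtr0_norm rd0).
have : r ^+ d * `|walk_avg d m n - L| <= e / 3.
  by rewrite mulrC -ler_pdivlMr.
lra.
Qed.

End averaged_probability.

(** * Perfect partitions and the first moment *)

Section colour_bijection.
Variables (n d : nat).
Hypothesis n0 : (0 < n)%N.

Definition parts_of (c : {ffun 'I_n -> 'I_d.+1}) : d.+1.-tuple {set 'I_n} :=
  [tuple [set i | c i == a]%SET | a < d.+1].

Lemma parts_ofE c a : tnth (parts_of c) a = [set i | c i == a]%SET.
Proof. by rewrite tnth_mktuple. Qed.

Lemma parts_of_inj : injective parts_of.
Proof.
move=> c c' E; apply/ffunP => i.
have : i \in tnth (parts_of c) (c i) by rewrite parts_ofE inE.
by rewrite E parts_ofE inE => /eqP.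
Qed.

Lemma ordered_partition_parts (S : d.+1.-tuple {set 'I_n}) :
  ordered_partition S -> exists c, S = parts_of c.
Proof.
move=> /and3P[_ /forallP disj /eqP cov].
have ex i : {a | i \in tnth S a}.
  apply: sigW; have : i \in (\bigcup_(a < d.+1) tnth S a)%SET by rewrite cov inE.
  by move=> /finset.bigcupP[a _ ia]; exists a.
exists [ffun i => sval (ex i)].
apply: eq_from_tnth => a; rewrite parts_ofE; apply/setP => i; rewrite inE ffunE.
case: (ex i) => b ib /=; have [<-//|ba] := eqVneq b a.
apply/negbTE/negP => ia; have := disj b => /forallP /(_ a); rewrite ba /=.
by move=> /pred0P /(_ i); rewrite /= ib ia.
Qed.

(** For n > 0 and positive values, equal sums force every class to be non-empty, so balanced
    colourings correspond exactly to perfect ordered partitions. *)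
Lemma num_perfect_balanced m (x : {ffun 'I_n -> 'I_m}) :
  num_perfect d.+1 (fun i => (x i).+1) = (\sum_(c : {ffun 'I_n -> 'I_d.+1}) balanced c x)%N.
Proof.
have sumE (c : {ffun 'I_n -> 'I_d.+1}) a :
    (\sum_(j in tnth (parts_of c) a) (x j).+1)%N = csum c x a.
  by rewrite parts_ofE; apply: eq_bigl => i; rewrite inE.
have perfE (c : {ffun 'I_n -> 'I_d.+1}) :
    perfect (fun i => (x i).+1) (parts_of c) = balanced c x.
  apply/forallP/forallP => [h a|h a].
    by have /forallP /(_ ord0) := h a; rewrite !sumE.
  by apply/forallP => b; rewrite !sumE (eqP (h a)) (eqP (h b)).
have opE (c : {ffun 'I_n -> 'I_d.+1}) : balanced c x -> ordered_partition (parts_of c).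
  move=> /forallP bal; apply/and3P; split.
  - apply/forallP => a; apply/eqP => E.
    have ca0 : csum c x a = 0%N by rewrite -sumE E big_set0.
    pose i0 := Ordinal n0.
    have : csum c x (c i0) = 0%N by rewrite (eqP (bal _)) -(eqP (bal a)).
    by rewrite /csum (bigD1 i0).
  - apply/forallP => a; apply/forallP => b; apply/implyP => ab.
    apply/pred0P => i /=; rewrite !parts_ofE !inE.
    by apply/negbTE; apply: contra ab => /andP[/eqP <- /eqP <-].
  - apply/eqP/setP => i; rewrite inE; apply/finset.bigcupP; exists (c i) => //.
    by rewrite parts_ofE inE.
rewrite /num_perfect.
have -> : [set S : d.+1.-tuple {set 'I_n} | ordered_partition S &
      perfect (fun i => (x i).+1) S]%SET =
    [set parts_of c | c in [set c : {ffun 'I_n -> 'I_d.+1} | balanced c x]]%SET.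
  apply/setP => S; rewrite inE; apply/andP/imsetP => [[oS pS]|[c]].
    have [c E] := ordered_partition_parts oS; exists c => //.
    by rewrite inE -perfE -E.
  by rewrite inE => bc ->; rewrite perfE opE.
rewrite card_imset; last exact: parts_of_inj.
rewrite -sum1dep_card big_mkcond; apply: eq_bigr => c _.
by case: balanced.
Qed.

End colour_bijection.

(** * From the random variables to a finite average *)

Section expectation.
Context {dT : measure_display} {T : measurableType dT} {R : realType} (P : probability T R).
Variables (n m : nat) (X : 'I_n -> {RV P >-> nat}).
Hypothesis m0 : (0 < m)%N.
Hypothesis hind : mutually_independent X.
Hypothesis hunif : forall i, uniform_upto m (X i).

Let Xw (w : T) : {ffun 'I_n -> nat} := [ffun i => X i w].

Let A (v : {ffun 'I_n -> nat}) : set T := Xw @^-1` [set v].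

Lemma cylinderE (v : {ffun 'I_n -> nat}) :
  A v = \bigcap_(i in [set` [set: 'I_n]%SET]) (X i @^-1` [set v i]).
Proof.
apply/seteqP; split => w.
  by rewrite /A /Xw /= => <- i _; rewrite /= ffunE.
by move=> h; apply/ffunP => i; rewrite ffunE; apply: h; rewrite /= inE.
Qed.

Lemma measurable_cylinder v : measurable (A v).
Proof.
rewrite cylinderE; apply: fin_bigcap_measurable => // i _.
by rewrite -[X in measurable X]setTI; exact: measurable_funPT.
Qed.

(** The vector takes countably many values, so a preimage is a countable union of cylinders,
    enumerated by [unpickle]. *)
Lemma measurable_fun_vector (F : {ffun 'I_n -> nat} -> R) : measurable_fun setT (F \o Xw).
Proof.
move=> _ Y mY; rewrite setTI.
have -> : (F \o Xw) @^-1` Y = \bigcup_k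
    (if unpickle k is Some v then if `[< Y (F v) >] then A v else set0 else set0).
  apply/seteqP; split => w /=.
    by move=> h; exists (pickle (Xw w)) => //=; rewrite pickleK asboolT.
  move=> [k _]; case: unpickle => // v; case: asboolP => // Yv.
  by rewrite /A /= => ->.
apply: bigcupT_measurable => k; case: unpickle => // v; case: ifP => // _.
exact: measurable_cylinder.
Qed.

Lemma cylinder_prob (x : {ffun 'I_n -> 'I_m}) : P (A [ffun i => (x i).+1]) = (m%:R ^- n)%:E.
Proof.
rewrite cylinderE (hind [set: 'I_n]%SET (A := fun i => [set [ffun i => (x i).+1] i])) //.
rewrite (eq_bigr (fun=> (m%:R^-1)%:E)).
  rewrite prodEFin; congr (_%:E); rewrite prodr_const cardsT card_ord exprVn//.
move=> i _; have := hunif i (x i).+1; rewrite ltn_ord /= /distribution /pushforward => h.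
by rewrite -h ffunE.
Qed.

(** The cylinders over {1, ..., m}^n are disjoint with total probability 1, so their complement is
    negligible; the integrand is constant on each. An ordinal x i of 'I_m encodes the value (x
    i).+1. *)
Lemma expectation_vector (F : {ffun 'I_n -> nat} -> R) : (forall v, 0 <= F v) ->
  (\int[P]_w (F (Xw w))%:E)%E =
  (m%:R ^- n * \sum_(x : {ffun 'I_n -> 'I_m}) F [ffun i => (x i).+1])%:E.
Proof.
move=> F0.
pose E (x : {ffun 'I_n -> 'I_m}) := A [ffun i => (x i).+1].
have mE x : measurable (E x) by exact: measurable_cylinder.
pose s := enum {: {ffun 'I_n -> 'I_m}}.
have tE : trivIset [set` s] E.
  move=> x y _ _ [w [xw yw]]; apply/ffunP => i; apply/val_inj.
  have /ffunP /(_ i) : [ffun i => (x i).+1] = [ffun i => (y i).+1] :> {ffun 'I_n -> nat}.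
    by rewrite -[LHS]xw -[RHS]yw.
  by rewrite !ffunE => -[].
have us : uniq s by exact: enum_uniq.
pose D := \big[setU/set0]_(x <- s) E x.
have mD : measurable D by apply: bigsetU_measurable => x _.
have cardM : m%:R ^- n * \sum_(x : {ffun 'I_n -> 'I_m}) (1 : R) = 1.
  rewrite sumr_const card_ffun !card_ord natrX mulVf//.
  by rewrite expf_neq0// pnatr_eq0 -lt0n.
have sumE (G : {ffun 'I_n -> 'I_m} -> \bar R) : (\sum_(x <- s) G x = \sum_x G x)%E.
  by rewrite /s big_enum.
have PD : P D = 1%E.
  have h := @ge0_integral_bigsetU _ T R P _ E (cst 1%E) s mE us tE.
  have := h (measurable_cst _) (fun _ _ => lee01).
  rewrite -/D integral_cst// mul1e => ->.
  rewrite sumE (eq_bigr (fun=> (m%:R ^- n * 1)%:E)).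
    by rewrite sumEFin -mulr_sumr cardM.
  by move=> x _; rewrite integral_cst// mul1e mulr1; exact: cylinder_prob.
have PN : P (~` D) = 0%E.
  by rewrite probability_setC// PD subee.
have mF := measurable_fun_vector F.
have mFE : measurable_fun setT (fun w => (F (Xw w))%:E) by exact/measurable_EFinP.
rewrite (@ge0_negligible_integral _ _ _ _ _ (~` D)) //; last 2 first.
- exact: measurableC.
- by move=> w _; rewrite lee_fin.
rewrite setTD setCK /D ge0_integral_bigsetU//; last 2 first.
- exact: measurable_funS mFE.
- by move=> w _; rewrite lee_fin.
rewrite sumE mulr_sumr -sumEFin; apply: eq_bigr => x _.
rewrite (eq_integral (fun=> (F [ffun i => (x i).+1])%:E)).
  by rewrite integral_cst//= cylinder_prob -EFinM mulrC.
by move=> w /set_mem Ew; rewrite -[in RHS]Ew.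
Qed.

End expectation.

Lemma expectation_num_perfect (dT : measure_display) (T : measurableType dT)
    (R : realType) (P : probability T R) (d n m : nat) (X : 'I_n -> {RV P >-> nat}) :
  (0 < n)%N -> (0 < m)%N -> mutually_independent X ->
  (forall i, uniform_upto m (X i)) ->
  'E_P[num_perfect_rv d.+1 X]%E = (d.+1%:R ^+ n * balanced_avg d m n)%:E.
Proof.
move=> n0 m0 hind hunif; rewrite unlock.
pose F (v : {ffun 'I_n -> nat}) : R := (num_perfect d.+1 v)%:R.
transitivity (\int[P]_w (F [ffun i => X i w])%:E)%E.
  apply: eq_integral => w _; rewrite /num_perfect_rv /F; congr (_%:R%:E).
  by congr num_perfect; apply/funext => i; rewrite ffunE.
rewrite (expectation_vector m0 hind hunif); last by move=> v; rewrite ler0n.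
congr (_%:E); rewrite /balanced_avg mulVKf ?expf_neq0 ?pnatr_eq0//.
rewrite /balanced_prob -mulr_sumr exchange_big/=; congr (_ * _); apply: eq_bigr => x _.
rewrite /F -natr_sum -num_perfect_balanced//; congr (_%:R).
by congr num_perfect; apply/funext => i; rewrite ffunE.
Qed.

(** * The roots of eta_fun and the main term *)

Section eta_roots.
Variables (R : realType) (nu : nat).
Hypothesis nu4 : (4 <= nu)%N.
Let a : R := nu%:R - 1.
Let nuR : R := nu%:R.

Let nu4R : 4 <= nuR. Proof. by rewrite /nuR ler_nat. Qed.
Let a3 : 3 <= a. Proof. rewrite /a -/nuR; move: nu4R; lra. Qed.

Lemma ln_ltB1 (x : R) : 0 < x -> x != 1 -> ln x < x - 1.
Proof.
move=> x0 x1; have : 1 + ln x < expR (ln x).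
  apply: expR_gt1Dx; apply: contra x1 => /eqP h.
  by rewrite -[x]lnK ?posrE// h expR0.
by rewrite lnK ?posrE//; lra.
Qed.

Lemma ln_leB1 (x : R) : 0 < x -> ln x <= x - 1.
Proof. by move=> x0; have := @le_ln1Dx R (x - 1); rewrite subrKC; apply; lra. Qed.

(** Logarithm of the quotient in [eta_fun]: a convex function, decreasing up to 1 / a and increasing
    afterwards. *)
Definition ln_eta (x : R) : R := a * x - 1 - ln nuR - ln x.

Lemma eta_funE (x : R) : 0 < x -> eta_fun nu x = expR (ln_eta x) - 1.
Proof.
move=> x0; rewrite /eta_fun /ln_eta !expRD !expRN !lnK ?posrE//.
  by rewrite -/a -/nuR !invfM !mulrA; congr (_ - 1); rewrite -!mulrA; congr (_ * _); rewrite mulrCA.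
by move: nu4R; lra.
Qed.

Lemma eta_fun_eq0 (x : R) : 0 < x -> (eta_fun nu x = 0 <-> ln_eta x = 0).
Proof.
move=> x0; rewrite eta_funE//; split=> [h|->]; last by rewrite expR0 subrr.
by apply: expR_inj; rewrite expR0; lra.
Qed.

Let lnD (x y : R) : 0 < x -> x < y -> ln y - ln x < (y - x) / x.
Proof.
move=> x0 xy; have y0 := lt_trans x0 xy.
rewrite -ln_div ?posrE// mulrBl divff ?gt_eqF//; apply: ln_ltB1; first by rewrite divr_gt0.
by rewrite gt_eqF// ltr_pdivlMr// mul1r.
Qed.

Let lnD' (x y : R) : 0 < x -> x < y -> (y - x) / y < ln y - ln x.
Proof.
move=> x0 xy; have y0 := lt_trans x0 xy.
rewrite -ltrN2 opprB -ln_div ?posrE// -mulNr opprB mulrBl divff ?gt_eqF//.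
apply: ln_ltB1; first by rewrite divr_gt0.
by rewrite lt_eqF// ltr_pdivrMr// mul1r.
Qed.

Lemma ln_eta_decr (x y : R) : 0 < x -> x < y -> y <= 1 / a -> ln_eta y < ln_eta x.
Proof.
move=> x0 xy ya; have a0 : 0 < a by move: a3; lra.
have y0 := lt_trans x0 xy.
have h := lnD' x0 xy.
have : a * (y - x) <= (y - x) / y.
  rewrite ler_pdivlMr// mulrAC ler_piMl ?subr_ge0 ?(ltW xy)//.
  by rewrite mulrC -ler_pdivlMr.
rewrite /ln_eta; lra.
Qed.

Lemma ln_eta_incr (x y : R) : 1 / a <= x -> x < y -> ln_eta x < ln_eta y.
Proof.
move=> ax xy; have a0 : 0 < a by move: a3; lra.
have x0 : 0 < x by apply: lt_le_trans ax; rewrite divr_gt0.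
have h := lnD x0 xy.
have : (y - x) / x <= a * (y - x).
  rewrite ler_pdivrMr// mulrAC ler_peMl ?subr_ge0 ?(ltW xy)//.
  by rewrite mulrC -ler_pdivrMr.
rewrite /ln_eta; lra.
Qed.

Lemma continuous_ln_eta (x : R) : 0 < x -> {for x, continuous ln_eta}.
Proof.
move=> x0; apply: cvgB; last exact: continuous_ln.
apply: cvgB; last exact: cvg_cst.
apply: cvgB; last exact: cvg_cst.
by apply: cvgMl_tmp; exact: cvg_id.
Qed.

Lemma within_continuous_ln_eta (x y : R) : 0 < x -> {within `[x, y], continuous ln_eta}.
Proof.
move=> x0; apply: continuous_in_subspaceT => z; rewrite inE/= in_itv/= => /andP[xz _].
by apply: continuous_ln_eta; exact: lt_le_trans xz.
Qed.

Lemma eta_roots : exists eta0 eta1 : R,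
  [/\ 0 < eta0 < 1 / a, 1 / a < eta1 < 2 * ln nuR / a &
      forall eta : R, 0 < eta -> eta_fun nu eta = 0 <-> eta = eta0 \/ eta = eta1].
Proof.
have a0 : 0 < a by move: a3; lra.
have n0 : 0 < nuR by move: nu4R; lra.
have ia0 : 0 < 1 / a by rewrite divr_gt0.
have a1 : a * (1 / a) = 1 by rewrite mul1r mulfV ?gt_eqF.
have lnn : 3 / 4 <= ln nuR.
  have := ln_leB1 (_ : 0 < nuR^-1); rewrite invr_gt0 => /(_ n0); rewrite lnV ?posrE//.
  have : nuR^-1 <= 4^-1 by rewrite lef_pV2 ?posrE//.
  lra.
have gm : ln_eta (1 / a) < 0.
  rewrite /ln_eta a1 div1r lnV ?posrE//.
  have : ln a < ln nuR by rewrite ltr_ln ?posrE// /a -/nuR; lra.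
  lra.
(* x0 = 1 / (e nu) cancels every term of [ln_eta] except a x0 > 0. *)
pose x0 := expR (- (1 + ln nuR)).
have x00 : 0 < x0 by exact: expR_gt0.
have g0 : 0 < ln_eta x0.
  rewrite /ln_eta expRK; have : 0 < a * x0 by rewrite mulr_gt0.
  lra.
have x0a : x0 < 1 / a.
  rewrite /x0 expRN expRD lnK ?posrE// div1r ltf_pV2 ?posrE ?mulr_gt0 ?expR_gt0//.
  have : 1 * nuR <= expR 1 * nuR by rewrite ler_wpM2r ?(ltW n0)// -[leLHS]expR0 ler_expR.
  rewrite /a -/nuR; lra.
pose x1 := 2 * ln nuR / a.
have x1a : 1 / a < x1 by rewrite ltr_pM2r ?invr_gt0//; lra.
have x10 : 0 < x1 by exact: lt_trans x1a.
(* [ln_eta] at x1 is (ln nu - 1 - ln (ln nu)) + (ln a - ln 2): the first part is nonnegative by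
   [ln_leB1], the second positive because a >= 3. *)
have g1 : 0 < ln_eta x1.
  rewrite /ln_eta {1}/x1 mulrC divfK ?gt_eqF//.
  rewrite /x1 ln_div ?posrE ?mulr_gt0//; last lra.
  rewrite lnM ?posrE//; last lra.
  have := ln_leB1 (_ : 0 < ln nuR).
  have h : ln 2 < ln a by rewrite ltr_ln ?posrE//; move: a3; lra.
  have h0 : 0 < ln nuR by lra.
  move=> /(_ h0); lra.
have [c0 c0I gc0] : exists2 c, c \in `[x0, 1 / a] & ln_eta c = 0.
  apply: IVT; [exact: ltW|exact: within_continuous_ln_eta|].
  by rewrite ge_min le_max (ltW gm) (ltW g0) orbT.
have [c1 c1I gc1] : exists2 c, c \in `[1 / a, x1] & ln_eta c = 0.
  apply: IVT; [exact: ltW|exact: within_continuous_ln_eta|].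
  by rewrite ge_min le_max (ltW gm) (ltW g1) orbT.
move: c0I c1I; rewrite !in_itv/= => /andP[xc0 c0a] /andP[ac1 c1x].
have c0l : c0 < 1 / a.
  rewrite lt_neqAle c0a andbT; apply/eqP => E; move: gm; rewrite -E gc0 ltxx//.
have c1l : 1 / a < c1.
  rewrite lt_neqAle ac1 andbT; apply/eqP => E; move: gm; rewrite E gc1 ltxx//.
have c1r : c1 < x1.
  rewrite lt_neqAle c1x andbT; apply/eqP => E; move: g1; rewrite -E gc1 ltxx//.
have c00 : 0 < c0 by exact: lt_le_trans xc0.
exists c0, c1; split; [by rewrite c00|by rewrite c1l|].
move=> eta e0; rewrite eta_fun_eq0//; split=> [ge|[]->//].
have [le|le] := leP eta (1 / a).
- left; have [h|h|//] := ltgtP eta c0.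
    by have := ln_eta_decr e0 h c0a; rewrite ge gc0 ltxx.
  by have := ln_eta_decr c00 h le; rewrite ge gc0 ltxx.
- right; have [h|h|//] := ltgtP eta c1.
    by have := ln_eta_incr (ltW le) h; rewrite ge gc1 ltxx.
  by have := ln_eta_incr ac1 h; rewrite ge gc1 ltxx.
Qed.

End eta_roots.

(** * Ratio of the first moment to the main term *)

Section first_moment.
Variables (R : realType) (d : nat) (M : nat -> nat).
Hypotheses (d2 : (2 <= d)%N) (M0 : forall n, (0 < M n)%N) (Moo : M @ \oo --> \oo).
Local Notation nu := d.+1.
Local Notation dR := (d%:R : R).
Local Notation nuR := (d.+1%:R : R).

Definition first_moment n : R := nuR ^+ n * balanced_avg d (M n) n.

Lemma cM_bound m : (0 < m)%N -> `|cM R m - 1 / 3| <= 2 / 3 / m%:R.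
Proof.
move=> m0; have M1 : 1 <= m%:R :> R by rewrite ler1n.
have i0 : 0 <= (m%:R : R)^-1 by rewrite invr_ge0; lra.
have i1 : (m%:R : R)^-1 <= 1 by rewrite invf_le1//; lra.
rewrite (cME m0) ger0_norm; last by have := sqr_ge0 (m%:R^-1 : R); move: i0; lra.
have : (m%:R : R)^-1 ^+ 2 <= m%:R^-1 by rewrite expr2 ler_piMr.
lra.
Qed.

Let d0 : (0 < d)%N. Proof. exact: leq_trans d2. Qed.

Let M0R n : 0 < (M n)%:R :> R. Proof. by rewrite ltr0n. Qed.

Lemma cvg_MV : ((M n)%:R^-1 : R) @[n --> \oo] --> (0 : R).
Proof. exact: (cvg_comp M (fun m => m%:R^-1) Moo (@cvg_natrV R)). Qed.

Lemma cvg_cM : cM R (M n) @[n --> \oo] --> (1 / 3 : R).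
Proof.
have h : (2 / 3 * (M n)%:R^-1 : R) @[n --> \oo] --> (0 : R).
  by rewrite -[X in _ --> X](mulr0 (2 / 3)); apply: cvgMl_tmp; exact: cvg_MV.
apply/cvgrPdist_le => e e0; have /cvgrPdist_le /(_ e e0) := h.
apply: filterS => n; rewrite sub0r normrN ger0_norm ?mulr_ge0 ?invr_ge0 ?(ltW (M0R n))// => hn.
by rewrite distrC; apply: le_trans (cM_bound (M0 n)) hn.
Qed.

Lemma cM_gt0 m : (0 < m)%N -> 0 < cM R m.
Proof.
move=> m0; rewrite (cME m0).
have i0 : 0 <= (m%:R : R)^-1 by rewrite invr_ge0.
by have := sqr_ge0 (m%:R^-1 : R); lra.
Qed.

Lemma cM_le m : (0 < m)%N -> cM R m <= 1.
Proof. 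
move=> m0; have := cM_bound m0; have M1 : 1 <= m%:R :> R by rewrite ler1n.
have i1 : (m%:R : R)^-1 <= 1 by rewrite invf_le1//; lra.
by rewrite ler_norml => /andP[_]; lra.
Qed.

Lemma variance_gt0 n : 0 < 2 * pi * nuR * cM R (M n).
Proof.
have c0 := cM_gt0 (M0 n); have p0 := pi_gt0 R; have n0 : 0 < nuR by rewrite ltr0n.
by apply: mulr_gt0 => //; apply: mulr_gt0 => //; apply: mulr_gt0.
Qed.

Lemma main_termE n : main_term R nu (M n) n =
  nuR ^+ n / ((M n)%:R * Num.sqrt n%:R) ^+ d *
  (nuR `^ (nuR - 3 / 2) / Num.sqrt (2 * pi * nuR * cM R (M n)) ^+ d).
Proof.
have q0 := ltW (variance_gt0 n).
have e : (nuR - 1) / 2 = 2^-1 * dR by rewrite -natr1 addrK mulrC.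
have p : (2 * pi * nuR * cM R (M n) * n%:R) `^ ((nuR - 1) / 2) =
    Num.sqrt (2 * pi * nuR * cM R (M n)) ^+ d * Num.sqrt n%:R ^+ d.
  rewrite e powRrM powR_mulrn ?powR_ge0// powR12_sqrt; last by rewrite mulr_ge0.
  by rewrite sqrtrM// exprMn.
rewrite /main_term /= p [((M n)%:R * _) ^+ d]exprMn.
generalize (Num.sqrt (2 * pi * nuR * cM R (M n)) ^+ d) => x.
by rewrite !invfM; ring.
Qed.

(** The square roots multiply to 2 nu, and (2 nu)^d times 2^(-d) nu^(-1/2) is nu^(nu - 3/2) since d
    = nu - 1. *)
Lemma main_constant :
  Num.sqrt (6 * nuR / pi) ^+ d * expR (- ((dR - 1) / 2 * ln 4 + 1 / 2 * ln (4 * nuR))) *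
  (Num.sqrt (2 * pi * nuR * (1 / 3)) ^+ d / nuR `^ (nuR - 3 / 2)) = 1.
Proof.
have p0 := pi_gt0 R; have n0 : 0 < nuR by rewrite ltr0n.
have -> : Num.sqrt (6 * nuR / pi) ^+ d * expR (- ((dR - 1) / 2 * ln 4 + 1 / 2 * ln (4 * nuR))) *
  (Num.sqrt (2 * pi * nuR * (1 / 3)) ^+ d / nuR `^ (nuR - 3 / 2)) =
  (Num.sqrt (6 * nuR / pi) * Num.sqrt (2 * pi * nuR * (1 / 3))) ^+ d *
  expR (- ((dR - 1) / 2 * ln 4 + 1 / 2 * ln (4 * nuR))) / nuR `^ (nuR - 3 / 2).
  by rewrite exprMn; ring.
rewrite -sqrtrM; last by rewrite divr_ge0 ?mulr_ge0// ltW.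
have -> : 6 * nuR / pi * (2 * pi * nuR * (1 / 3)) = (2 * nuR) ^+ 2.
  by move: (lt0r_neq0 p0); generalize (pi : R) => p pn; field.
rewrite sqrtr_sqr ger0_norm ?mulr_ge0//.
have -> : (2 * nuR) ^+ d = expR (dR * ln (2 * nuR)).
  by rewrite expRM_natl lnK ?posrE ?mulr_gt0.
rewrite /powR gt_eqF// -expRN -!expRD -[RHS]expR0; congr expR.
have -> : (4 : R) = 2 ^+ 2 by ring.
have l2 : ln (2 ^+ 2) = ln 2 + ln 2 :> R by rewrite lnXn.
have l2n : ln (2 * nuR) = ln 2 + ln nuR by rewrite lnM ?posrE.
have l4n : ln (2 ^+ 2 * nuR) = ln (2 ^+ 2) + ln nuR by rewrite lnM ?posrE ?exprn_gt0.
by rewrite l4n l2 l2n -natr1; field.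
Qed.

Lemma main_term_gt0 n : (0 < n)%N -> 0 < main_term R nu (M n) n.
Proof.
move=> n0; rewrite main_termE mulr_gt0 ?divr_gt0 ?exprn_gt0 ?mulr_gt0 ?powR_gt0//.
  by rewrite sqrtr_gt0 ltr0n.
by rewrite sqrtr_gt0 variance_gt0.
Qed.

Lemma cvg_balanced_avg :
  (balanced_avg d (M n) n * ((M n)%:R * Num.sqrt n%:R) ^+ d : R) @[n --> \oo] -->
  (Num.sqrt (6 * nuR / pi) ^+ d * expR (- ((dR - 1) / 2 * ln 4 + 1 / 2 * ln (4 * nuR))) : R).
Proof.
apply/cvgrPdist_le => e e0; have [K hK] := balanced_avg_asymp d0 e0.
have h1 : \forall n \near \oo, (K < M n)%N by exact: Moo (nbhs_infty_gt K).
near=> n; rewrite distrC; apply: hK; last by near: n; exact: nbhs_infty_gt.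
by near: n.
Unshelve. all: by end_near. Qed.

Lemma first_moment_ratio :
  (first_moment n / main_term R nu (M n) n : R) @[n --> \oo] --> (1 : R).
Proof.
rewrite -main_constant.
have hs : (Num.sqrt (2 * pi * nuR * cM R (M n)) : R) @[n --> \oo] -->
    (Num.sqrt (2 * pi * nuR * (1 / 3)) : R).
  apply: (continuous_cvg _ (@sqrt_continuous R _)).
  by apply: cvgMl_tmp; exact: cvg_cM.
have he : (Num.sqrt (2 * pi * nuR * cM R (M n)) ^+ d : R) @[n --> \oo] -->
    (Num.sqrt (2 * pi * nuR * (1 / 3)) ^+ d : R).
  by apply: (continuous_cvg _ (@exprn_continuous R d _)).
have h := cvgM cvg_balanced_avg (cvgMr_tmp (b := (nuR `^ (nuR - 3 / 2))^-1) he).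
apply: (cvg_trans _ (h _ _)); apply: near_eq_cvg; near=> n.
have n0 : (0 < n)%N by near: n; exact: nbhs_infty_gt.
have nn : nuR ^+ n != 0 by rewrite expf_neq0// pnatr_eq0.
rewrite /= main_termE /first_moment !invfM !invrK.
rewrite -[LHS](mulVKf nn); ring.
Unshelve. all: by end_near. Qed.

End first_moment.

Section thresholds.
Variables (R : realType).

(** A strict inequality for the limit, finite or not, leaves a real margin q, which becomes an
    exponential gain in the growth estimates. *)
Lemma near_lt_ereal (u : nat -> R) (L : \bar R) (b : R) :
  (u n)%:E @[n --> \oo] --> L -> (L < b%:E)%E ->
  exists2 q, q < b & \forall n \near \oo, u n < q.
Proof.
move=> uL Lb; have [q Lq qb] : exists2 q : R, (L < q%:E)%E & q < b.
  case: L Lb {uL} => [r| |] //; rewrite ?lte_fin => rb.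
    by exists ((r + b) / 2); rewrite ?lte_fin; lra.
  by exists (b - 1); [exact: ltNyr|lra].
have h : \forall n \near \oo, ((u n)%:E < q%:E)%E by exact: uL _ (open_ereal_lt' Lq).
by exists q => //; apply: filterS h => n; rewrite lte_fin.
Qed.

Lemma near_gt_ereal (u : nat -> R) (L : \bar R) (b : R) :
  (u n)%:E @[n --> \oo] --> L -> (b%:E < L)%E ->
  exists2 q, b < q & \forall n \near \oo, q < u n.
Proof.
move=> uL Lb; have [q Lq qb] : exists2 q : R, (q%:E < L)%E & b < q.
  case: L Lb {uL} => [r| |] //; rewrite ?lte_fin => rb.
    by exists ((r + b) / 2); rewrite ?lte_fin; lra.
  by exists (b + 1); [exact: ltry|lra].
have h : \forall n \near \oo, (q%:E < (u n)%:E)%E by exact: uL _ (open_ereal_gt' Lq).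
by exists q => //; apply: filterS h => n; rewrite lte_fin.
Qed.

End thresholds.

(** * Comparison of n with log M *)

Section growth.
Variables (R : realType) (d : nat) (M : nat -> nat).
Hypotheses (d2 : (2 <= d)%N) (M0 : forall n, (0 < M n)%N) (Moo : M @ \oo --> \oo).
Local Notation nu := d.+1.
Local Notation dR := (d%:R : R).
Local Notation nuR := (d.+1%:R : R).

Let M0R n : 0 < (M n)%:R :> R. Proof. by rewrite ltr0n. Qed.

Lemma cvg_ln_M : ln ((M n)%:R : R) @[n --> \oo] --> +oo.
Proof.
apply/cvgryPge => A.
have : (M n)%:R @[n --> \oo] --> (+oo : set_system R).
  exact: (cvg_comp M (fun m => m%:R) Moo (@cvgr_idn R)).
move=> /cvgryPge /(_ (expR A)); apply: filterS => n h.
by rewrite -[A]expRK ler_ln ?posrE ?expR_gt0.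
Qed.

Lemma near_ln_M_gt0 : \forall n \near \oo, 0 < ln ((M n)%:R : R).
Proof. by move/cvgryPgt: cvg_ln_M; apply. Qed.

Lemma ln_nu_gt0 : 0 < ln nuR.
Proof. by rewrite ln_gt0// ltr1n ltnS (leq_trans _ d2). Qed.

Lemma first_moment_ge0 n : 0 <= first_moment R d M n.
Proof.
rewrite /first_moment /balanced_avg mulVKf ?expf_neq0 ?pnatr_eq0//.
by apply: sumr_ge0 => c _; exact: balanced_prob_ge0.
Qed.

Lemma first_moment_le n : (0 < n)%N -> first_moment R d M n <= nuR ^+ n / (M n)%:R ^+ d.
Proof.
move=> n0; rewrite /first_moment /balanced_avg mulVKf ?expf_neq0 ?pnatr_eq0//.
have -> : nuR ^+ n / (M n)%:R ^+ d = \sum_(c : {ffun 'I_n -> 'I_d.+1}) (M n)%:R ^- d.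
  by rewrite sumr_const card_ffun !card_ord -natrX mulr_natl.
by apply: ler_sum => c _; exact: balanced_prob_le.
Qed.

(** As d >= 2, nu^n M^(-d) is at most nu^n M^(-2), whose logarithm n ln nu - 2 ln M is eventually at
    most - k ln M, with k = 2 - q ln nu > 0. *)
Lemma first_moment_cvg0 (q : R) : q < 2 / ln nuR ->
  (\forall n \near \oo, n%:R / ln (M n)%:R < q) ->
  first_moment R d M n @[n --> \oo] --> (0 : R).
Proof.
move=> q2 hq; have l0 := ln_nu_gt0.
pose k := 2 - q * ln nuR.
have k0 : 0 < k by rewrite /k subr_gt0 -ltr_pdivlMr.
have h0 : expR (- (k * ln (M n)%:R)) @[n --> \oo] --> (0 : R).
  apply: (cvg_comp (fun n => k * ln ((M n)%:R : R)) (fun x => expR (- x)) _ (@cvgr_expR R)).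
  exact: (cvg_comp _ (fun x => k * x) cvg_ln_M (gt0_cvgMry k0 cvg_id)).
apply: (@squeeze_cvgr _ _ _ _ (cst 0) (fun n => expR (- (k * ln (M n)%:R)))) => //.
  have l := near_ln_M_gt0.
  near=> n; rewrite first_moment_ge0/=.
  have n0 : (0 < n)%N by near: n; exact: nbhs_infty_gt.
  have lM : 0 < ln ((M n)%:R : R) by near: n.
  apply: le_trans (first_moment_le n0) _.
  have : n%:R / ln ((M n)%:R : R) < q by near: n.
  rewrite ltr_pdivrMr// => hn.
  have e1 : nuR ^+ n = expR (n%:R * ln nuR) by rewrite expRM_natl lnK ?posrE.
  have e2 : (M n)%:R ^+ 2 = expR (2 * ln ((M n)%:R : R)) by rewrite expRM_natl lnK ?posrE.
  apply: (@le_trans _ _ (nuR ^+ n / (M n)%:R ^+ 2)).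
    rewrite ler_wpM2l ?exprn_ge0// lef_pV2 ?posrE ?exprn_gt0//.
    by rewrite ler_weXn2l// ler1n.
  rewrite e1 e2 -expRN -expRD ler_expR.
  have : n%:R * ln nuR <= q * ln (M n)%:R * ln nuR by rewrite ler_wpM2r ?(ltW hn)// ltW.
  rewrite /k; lra.
exact: cvg_cst.
Unshelve. all: by end_near. Qed.

(** Eventually M^d <= expR (n d / q), so up to constants the main term is at least expR (n de) / n^d
    with de = ln nu - d / q > 0. The bound [cM] <= 1 controls the variance factor. *)
Lemma main_term_cvgy (q : R) : dR / ln nuR < q ->
  (\forall n \near \oo, q < n%:R / ln (M n)%:R) ->
  main_term R nu (M n) n @[n --> \oo] --> +oo.
Proof.
move=> q2 hq; have l0 := ln_nu_gt0; have p0 := pi_gt0 R.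
have dd0 : 0 < dR by rewrite ltr0n (leq_trans _ d2).
have q0 : 0 < q by apply: lt_trans q2; rewrite divr_gt0.
pose de := ln nuR - dR / q.
have de0 : 0 < de.
  by rewrite /de subr_gt0 ltr_pdivrMr// mulrC -ltr_pdivrMr.
pose S := Num.sqrt (2 * pi * nuR).
have S0 : 0 < S ^+ d by rewrite exprn_gt0// sqrtr_gt0 !mulr_gt0// ltr0n.
pose C := nuR `^ (nuR - 3 / 2).
have C0 : 0 < C by rewrite powR_gt0.
apply/cvgryPge => A; pose A' := Num.max A 1.
have A0 : 0 < A' by rewrite lt_max ltr01 orbT.
have e0 : 0 < C / S ^+ d / A' by rewrite !divr_gt0.
have [K hK] := poly_expR_small d de0 e0.
have l := near_ln_M_gt0.
near=> n.
have n0 : (0 < n)%N by near: n; exact: nbhs_infty_gt.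
have n1 : 1 <= n%:R :> R by rewrite ler1n.
have lM : 0 < ln ((M n)%:R : R) by near: n.
have : q < n%:R / ln ((M n)%:R : R) by near: n.
rewrite ltr_pdivlMr// => hn.
have v0 := @variance_gt0 R d M M0 n.
have s0 : 0 < Num.sqrt (n%:R : R) by rewrite sqrtr_gt0; lra.
have P0 : 0 < ((M n)%:R * Num.sqrt n%:R) ^+ d :> R by rewrite exprn_gt0// mulr_gt0.
have V0 : 0 < Num.sqrt (2 * pi * nuR * cM R (M n)) ^+ d by rewrite exprn_gt0// sqrtr_gt0.
apply: (@le_trans _ _ A'); first by rewrite le_max lexx.
rewrite main_termE// mulf_div ler_pdivlMr ?mulr_gt0//.
have V1 : Num.sqrt (2 * pi * nuR * cM R (M n)) ^+ d <= S ^+ d.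
  rewrite lerXn2r ?nnegrE ?sqrtr_ge0// ler_wsqrtr// ler_piMr ?cM_le//.
  by rewrite !mulr_ge0// ltW.
have P1 : ((M n)%:R * Num.sqrt n%:R) ^+ d <= expR (n%:R * (dR / q)) * n%:R ^+ d.
  rewrite exprMn ler_pM ?exprn_ge0 ?sqrtr_ge0//.
    have -> : (M n)%:R ^+ d = expR (dR * ln (M n)%:R) by rewrite expRM_natl lnK ?posrE.
    by rewrite ler_expR mulrCA ler_pM2l// ler_pdivlMr// mulrC ltW.
  rewrite lerXn2r ?nnegrE ?sqrtr_ge0//.
  rewrite -[leRHS]sqr_sqrtr// expr2 ler_peMr ?sqrtr_ge0// -[leLHS]sqrtr1 ler_wsqrtr//.
have nK : n%:R ^+ d <= C / S ^+ d / A' * expR (n%:R * de).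
  rewrite -ler_pdivrMr ?expR_gt0// -expRN; apply: hK.
  by near: n; exact: nbhs_infty_gt.
have e1 : nuR ^+ n = expR (n%:R * ln nuR) by rewrite expRM_natl lnK ?posrE.
have -> : nuR ^+ n * C = A' * ((expR (n%:R * (dR / q)) * (C / S ^+ d / A' * expR (n%:R * de))) * S ^+ d).
  rewrite e1; have -> : n%:R * ln nuR = n%:R * (dR / q) + n%:R * de by rewrite /de; ring.
  rewrite expRD; field; rewrite !gt_eqF//.
rewrite ler_wpM2l ?(ltW A0)// ler_pM ?(ltW P0) ?(ltW V0)//.
by apply: le_trans P1 _; rewrite ler_wpM2l ?expR_ge0.
Unshelve. all: by end_near. Qed.

Lemma first_moment_asymptoticsP (q : R) (EZ : nat -> \bar R) : dR / ln nuR < q ->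
  (\forall n \near \oo, q < n%:R / ln (M n)%:R) ->
  (\forall n \near \oo, EZ n = (first_moment R d M n)%:E) ->
  first_moment_asymptotics nu M EZ.
Proof.
move=> q2 hq hE; have h := @first_moment_ratio R d M d2 M0 Moo; split.
  exists (fun n => first_moment R d M n / main_term R nu (M n) n - 1).
    rewrite -[X in _ --> X](subrr (1 : R)); apply: cvgB => //; exact: cvg_cst.
  near=> n.
  have n0 : (0 < n)%N by near: n; exact: nbhs_infty_gt.
  have -> : EZ n = (first_moment R d M n)%:E by near: n.
  by rewrite subrKC divfK// gt_eqF// main_term_gt0.
suff : first_moment R d M n @[n --> \oo] --> +oo.
  move=> /cvgeryP; apply: cvg_trans; apply: near_eq_cvg.
  by apply: filterS hE => n ->.
have half : (1 / 2 : R) < 1 by lra.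
apply: (@ger_cvgy _ _ _ _ (fun n => main_term R nu (M n) n * (1 / 2))); last first.
  have half0 : (0 : R) < 1 / 2 by lra.
  exact: (cvg_comp _ (fun x => x * (1 / 2)) (main_term_cvgy q2 hq) (gt0_cvgMly half0 cvg_id)).
near=> n.
have n0 : (0 < n)%N by near: n; exact: nbhs_infty_gt.
have m0 := @main_term_gt0 R d M M0 n n0.
rewrite mulrC -ler_pdivlMr// ltW//.
by near: n; apply: (cvgr_gt _ h).
Unshelve. all: by end_near. Qed.

End growth.

Theorem theorem3p1 (R : realType) (nu : nat) (hnu : (3 <= nu)%N)
    (M : nat -> nat) (hM0 : forall n, (0 < M n)%N) (hM : M @ \oo --> \oo)
    (d : nat -> measure_display) (T : forall n, measurableType (d n))
    (P : forall n, probability (T n) R)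
    (X : forall n, 'I_n -> {RV (P n) >-> nat})
    (hind : forall n, mutually_independent (X n))
    (hunif : forall n (i : 'I_n), uniform_upto (M n) (X n i))
    (L : \bar R)
    (hL : (n%:R / ln (M n)%:R)%:E @[n --> \oo] --> L) :
  let EZ n := 'E_(P n)[num_perfect_rv nu (X n)]%E in
  [/\ (exists C : R, forall m : nat, (0 < m)%N -> `|cM R m - 1 / 3| <= C / m%:R),
      ((L < (2 / ln nu%:R)%:E)%E -> EZ n @[n --> \oo] --> 0%E),
      (nu = 3%N ->
         ((2 / ln 3)%:E < L < +oo)%E -> L <> 2%:E -> L <> 4%:E ->
         first_moment_asymptotics nu M EZ)
    & ((4 <= nu)%N ->
         exists eta0 eta1 : R,
         [/\ 0 < eta0 < 1 / (nu%:R - 1),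
             1 / (nu%:R - 1) < eta1 < 2 * ln nu%:R / (nu%:R - 1),
             (forall eta : R, 0 < eta ->
                eta_fun nu eta = 0 <-> eta = eta0 \/ eta = eta1)
           & ((2 / eta1)%:E < L < +oo)%E -> L <> (2 * (nu%:R - 1))%:E ->
             first_moment_asymptotics nu M EZ])].
Proof.
case: nu hnu => // k k2 EZ.
have hE : \forall n \near \oo, EZ n = (first_moment R k M n)%:E.
  near=> n; apply: expectation_num_perfect => //.
  by near: n; exact: nbhs_infty_gt.
split.
- by exists (2 / 3) => m m0; exact: cM_bound.
- move=> hl; have [q ql hq] := near_lt_ereal hL hl.
  have h : (first_moment R k M n)%:E @[n --> \oo] --> 0%E.
    by apply: cvg_EFin; [exact: nearW|exact: first_moment_cvg0 hq].
  apply: cvg_trans (h); apply: near_eq_cvg.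
  by apply: filterS hE => n ->.
- move=> k3 /andP[hl _] _ _; have [q ql hq] := near_gt_ereal hL hl.
  apply: first_moment_asymptoticsP hq hE => //.
  (* For nu = 3 the growth threshold d / ln nu is 2 / ln 3. *)
  by case: k3 => ->; exact: ql.
- move=> k4; have [eta0 [eta1 [h0 h1 h2]]] := eta_roots R k4.
  exists eta0, eta1; split => // /andP[hl _] _.
  have [q ql hq] := near_gt_ereal hL hl.
  apply: first_moment_asymptoticsP hq hE => //; apply: le_lt_trans ql.
  have l0 := ln_nu_gt0 R k2.
  move: h1 => /andP[h3 h4].
  have k0 : 0 < k%:R :> R by rewrite ltr0n -ltnS; exact: ltnW.
  have e0 : 0 < eta1 by apply: lt_trans h3; rewrite -natr1 addrK divr_gt0.
  (* The upper bound eta1 < 2 ln nu / d says that 2 / eta1 lies above the growth threshold d / ln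
     nu. *)
  rewrite ler_pdivrMr// mulrAC ler_pdivlMr//.
  move: h4; rewrite -[in X in _ / X]natr1 addrK ltr_pdivlMr//.
  by rewrite mulrC => /ltW.
Unshelve. all: by end_near. Qed.
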